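(* Let $q$ be a real-valued function on $\mathbb{R}$ with $q(x)=0$ for $|x|>1$ and $q\in L^\infty[-1,1]$, and assume that the self-adjoint operator $\ell=-\frac{d^2}{dx^2}+q(x)$ in $L^2(\mathbb{R})$ has no negative eigenvalues. For $k>0$ let $u(x,k)$ be the solution of $$-u''+q(x)u-k^2u=\delta(x),\quad x\in\mathbb{R},\qquad \frac{\partial u}{\partial|x|}-iku\to0\ \text{ as } |x|\to\infty .$$ Then the inverse problem of finding $q$ from the data $\{u(-1,k),u(1,k)\}$, given for all $k>0$, has at most one solution; that is, if two potentials satisfying these assumptions have the same data for all $k>0$, then they coincide.
   Context: $\delta(x)$ is the delta-function at the origin. The operator $\ell$ is the closure in $L^2(\mathbb{R})$ of the symmetric operator $\ell_0u=-u''+q(x)u$ defined on $C_0^\infty(\mathbb{R})$. *)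

(* Defs.v *)
From HB Require Import structures.
From mathcomp Require Import all_boot all_order all_algebra.
From mathcomp Require Import all_classical all_reals all_analysis.
From mathcomp Require Import complex.
Set Implicit Arguments.
Unset Strict Implicit.
Unset Printing Implicit Defensive.
Import Order.TTheory GRing.Theory Num.Theory.
Import numFieldNormedType.Exports.
Local Open Scope classical_set_scope.
Local Open Scope ring_scope.
Local Open Scope complex_scope.

(* All functions are Borel functions on the line, with the (Borel) Lebesgue
   measure.  Complex-valued functions of a real variable are differentiated and
   integrated componentwise, R[i] being no normed module over R in the library;
   limits and continuity use the topology of the norm of R[i], carried by
   R[i]^o. *)

Definition rpart {R : realType} (f : R -> R[i]) : R -> R :=
  fun x => complex.Re (f x).

Definition ipart {R : realType} (f : R -> R[i]) : R -> R :=
  fun x => complex.Im (f x).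

Definition cderivable {R : realType} (f : R -> R[i]) (x : R) : Prop :=
  derivable (rpart f) x 1 /\ derivable (ipart f) x 1.

Definition cderiven {R : realType} (n : nat) (f : R -> R[i]) : R -> R[i] :=
  fun x => derive1n n (rpart f) x +i* derive1n n (ipart f) x.

Definition cintegral {R : realType} (f : R -> R[i]) : R[i] :=
  Rintegral lebesgue_measure setT (rpart f) +i*
  Rintegral lebesgue_measure setT (ipart f).

(* C_0^oo(R), complex-valued. *)
Definition test_function {R : realType} (phi : R -> R[i]) : Prop :=
  (forall (n : nat) (x : R), cderivable (cderiven n phi) x) /\
  (exists M : R, forall x : R, M < `|x| -> phi x = 0).

Definition in_L2 {R : realType} (f : R -> R[i]) : Prop :=
  rpart f \in Lfun (@lebesgue_measure R) 2%:E /\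
  ipart f \in Lfun (@lebesgue_measure R) 2%:E.

Definition L2_norm {R : realType} (f : R -> R[i]) : \bar R :=
  Lnorm (@lebesgue_measure R) 2%:E (fun x => (Normc.normc (f x))%:E).

Definition L2_cvg {R : realType} (f_ : nat -> R -> R[i]) (f : R -> R[i]) :
    Prop :=
  L2_norm (fun x => f_ n x - f x) @[n --> \oo] --> 0%E.

Definition ell0 {R : realType} (q : R -> R) (f : R -> R[i]) : R -> R[i] :=
  fun x => - cderiven 2 f x + (q x)%:C * f x.

(* The closure ell of ell0 on C_0^oo(R), given by its graph (the closure in
   L^2 x L^2 of the graph of ell0): [ell_graph q f g] says that f is in the
   domain of ell and ell f = g. *)
Definition ell_graph {R : realType} (q : R -> R) (f g : R -> R[i]) : Prop :=
  [/\ in_L2 f, in_L2 g &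
      exists phi_ : nat -> R -> R[i],
        [/\ forall n, test_function (phi_ n),
            L2_cvg phi_ f &
            L2_cvg (fun n => ell0 q (phi_ n)) g]].

Definition ell_eigenvalue {R : realType} (q : R -> R) (lam : R[i]) : Prop :=
  exists f : R -> R[i],
    ell_graph q f (fun x => lam * f x) /\
    ~ {ae @lebesgue_measure R, forall x, f x = 0}.

Definition no_negative_eigenvalue {R : realType} (q : R -> R) : Prop :=
  forall lam : R, lam < 0 -> ~ ell_eigenvalue q lam%:C.

Definition potential {R : realType} (q : R -> R) : Prop :=
  q \in Lfun (@lebesgue_measure R) +oo%E /\
  (forall x : R, 1 < `|x| -> q x = 0).

(* - u'' + q u - k^2 u = delta in the sense of distributions. *)
Definition point_source_equation {R : realType} (q : R -> R) (k : R)
    (u : R -> R[i]) : Prop :=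
  forall phi : R -> R[i], test_function phi ->
    cintegral (fun x => u x * (ell0 q phi x - (k ^+ 2)%:C * phi x)) = phi 0.

(* du/d|x| is u' at +oo and - u' at -oo. *)
Definition radiation_condition {R : realType} (k : R) (u : R -> R[i]) : Prop :=
  [/\ \forall x \near +oo%R, cderivable u x,
      \forall x \near -oo%R, cderivable u x,
      (cderiven 1 u x - 'i%C * k%:C * u x : R[i]^o) @[x --> +oo%R] --> (0 : R[i]^o) &
      (- cderiven 1 u x - 'i%C * k%:C * u x : R[i]^o) @[x --> -oo%R] -->
        (0 : R[i]^o)].

(* A solution is represented by its continuous version, so that its values at
   the points -1 and 1 make sense. *)
Definition outgoing_solution {R : realType} (q : R -> R) (k : R)
    (u : R -> R[i]) : Prop :=
  [/\ continuous (u : R -> R[i]^o),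
      point_source_equation q k u &
      radiation_condition k u].

(* Main.v *)
(* Let [f] be the solution of [- f'' + q f = k^2 f] which is outgoing to the right
   of [1] and [g] the one which is outgoing to the left of [-1].  The radiation
   condition makes [u] a multiple of [f] on the right of the source and of [g] on
   its left, and the jump of [u'] at [0] gives [u (1) = g (0) / W] and
   [u (-1) = f (0) / W], where [W] is the Wronskian of [f] and [g].  On the closed
   upper half-plane without [0], [W] has no zero: off the imaginary axis by the
   flux identity, and on it because a zero would be a negative eigenvalue.

   For two potentials with the same data, a Liouville argument is applied three
   times: a quotient of entire functions which is even in [k], whose denominator
   has no zero in the closed upper half-plane except possibly [0], and which is
   [o(k^2)] there, is constant.  First, the difference of the Green functions at
   [(0, 0)] has an even quotient tending to [0], so that [f (0)], [g (0)] and [W]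
   are the same for both potentials.  Then the derivatives at [0] agree up to a
   constant multiple of the values.  Finally, as in the Borg-Marchenko theorem,
   [s_1 f_2 - s_2 f_1], with [s_j] the solution vanishing at [0], divided by
   [f (0)] is even and tends to [0]; its vanishing forces the solutions, hence the
   potentials, to agree on [0, 1], and by reflection on [-1, 0]. *)

(* Growth is controlled only in the closed upper half-plane, where a bounded analytic function need
   not be constant. Evenness is the remedy: a bound on |P/Q| above the real axis also holds below
   it, so a maximum found on a rectangle is global and the local maximum principle suffices. Each
   quotient is therefore arranged to be even, its odd part being computed from Wronskians of
   solutions at k and -k. Of entire functions one only uses approximation by polynomials, division
   by X - k and orders of zeros.

   The point k = 0 cannot be excluded: for q = 0 the Wronskian W is a multiple of k exp (- 2 i k).
   The flux identity gives |W| >= 2 k for k > 0, so the quotients have at most a simple pole at 0,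
   which evenness forbids.

   The potential is merely bounded, so second derivatives exist only almost everywhere. Equations
   are kept in integrated form, and mollification links them to smooth test functions, both for the
   distributional equation of u and for placing a decaying Jost solution in the domain of the
   closure ell. *)
Require Import Defs.
From HB Require Import structures.
From mathcomp Require Import all_boot all_order all_algebra.
From mathcomp Require Import all_classical all_reals all_analysis.
From mathcomp Require Import measurable_realfun complex.
From mathcomp Require Import ring lra zify.
Import Order.TTheory GRing.Theory Num.Theory.
Import numFieldNormedType.Exports.
Local Open Scope classical_set_scope.
Local Open Scope ring_scope.
Local Open Scope complex_scope.
Set Implicit Arguments.
Unset Strict Implicit.
Unset Printing Implicit Defensive.

(** * Primitives of locally bounded functions *)

Section Primitive.
Context {R : realType}.
Implicit Types (f g F G : R -> R) (a b c x y : R).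
Local Notation mu := (@lebesgue_measure R).

Definition locally_bounded f :=
  measurable_fun setT f /\
  forall K, exists M, forall x, `|x| <= K -> `|f x| <= M.

(* [F] is locally Lipschitz with a.e. derivative [f]; second order equations with
   a bounded measurable potential are understood in this sense. *)
Definition primitive F f :=
  locally_bounded f /\
  forall a b, a <= b -> F b - F a = \int[mu]_(x in `[a, b]) f x.

Lemma locally_bounded_integrable f a b :
  locally_bounded f -> mu.-integrable `[a, b] (EFin \o f).
Proof.
move=> [mf bf]; apply: measurable_bounded_integrable => //.
- rewrite /= lebesgue_measure_itv /=.
  by case: ifP => //= _; rewrite -EFinD ltry.
- exact: measurable_funTS.
- have [M hM] := bf (`|a| + `|b|); exists M; split; first exact: num_real.
  move=> N MN x /=; rewrite in_itv/= => /andP[ax xb].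
  apply: le_trans (ltW MN); apply: hM; rewrite ler_norml.
  have := ler_norm b; have := ler_norm (- a); rewrite normrN.
  have := normr_ge0 a; have := normr_ge0 b; lra.
Qed.

Lemma locally_boundedD f g : locally_bounded f -> locally_bounded g ->
  locally_bounded (fun x => f x + g x).
Proof.
move=> [mf bf] [mg bg]; split; first exact: measurable_funD.
move=> K; have [M hM] := bf K; have [N hN] := bg K; exists (M + N) => x xK.
by rewrite (le_trans (ler_normD _ _))// lerD ?hM ?hN.
Qed.

Lemma locally_boundedM f g : locally_bounded f -> locally_bounded g ->
  locally_bounded (fun x => f x * g x).
Proof.
move=> [mf bf] [mg bg]; split; first exact: measurable_funM.
move=> K; have [M hM] := bf K; have [N hN] := bg K; exists (M * N) => x xK.
by rewrite normrM ler_pM ?hM ?hN.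
Qed.

Lemma continuous_locally_bounded f : continuous f -> locally_bounded f.
Proof.
move=> cf; split; first exact: continuous_measurable_fun.
move=> K; have [K0|K0] := ltP K 0.
  by exists 0 => x xK; have := le_lt_trans xK K0; rewrite normr_lt0.
have cn : {within `[- K, K], continuous (fun x => `|f x|)}.
  apply: continuous_subspaceT => x; apply: continuous_comp; first exact: cf.
  exact: norm_continuous.
have KK : - K <= K by lra.
have [c _ hc] := EVT_max KK cn.
by exists `|f c| => x; rewrite ler_norml => xK; apply: hc; rewrite in_itv.
Qed.

Lemma locally_bounded_cst c : locally_bounded (fun=> c).
Proof. by apply: continuous_locally_bounded => x; exact: cst_continuous. Qed.

Lemma locally_boundedN f : locally_bounded f ->
  locally_bounded (fun x => - f x).
Proof.
move=> /(locally_boundedM (locally_bounded_cst (-1))).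
by congr locally_bounded; apply/funext => x; rewrite mulN1r.
Qed.

Lemma locally_boundedB f g : locally_bounded f -> locally_bounded g ->
  locally_bounded (fun x => f x - g x).
Proof. by move=> hf hg; apply/locally_boundedD/locally_boundedN. Qed.

Lemma primitive_lb F f : primitive F f -> locally_bounded f.
Proof. by case. Qed.

Lemma primitive_cst c : primitive (fun=> c) (fun=> 0).
Proof.
split; first exact: locally_bounded_cst.
by move=> a b ab; rewrite subrr Rintegral_cst ?mul0r.
Qed.

Lemma primitiveD F f G g : primitive F f -> primitive G g ->
  primitive (fun x => F x + G x) (fun x => f x + g x).
Proof.
move=> [lf hF] [lg hG]; split; first exact: locally_boundedD.
move=> a b ab; rewrite RintegralD//; try exact: locally_bounded_integrable.
by rewrite -hF// -hG//; ring.
Qed.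

Lemma primitiveZ c F f : primitive F f ->
  primitive (fun x => c * F x) (fun x => c * f x).
Proof.
move=> [lf hF]; split; first exact/locally_boundedM/lf/locally_bounded_cst.
move=> a b ab; rewrite RintegralZl//; last exact: locally_bounded_integrable.
by rewrite -hF//; ring.
Qed.

Lemma primitive_eq F f G g : primitive F f -> F =1 G -> f =1 g ->
  primitive G g.
Proof. by move=> + /funext <- /funext <-. Qed.

Lemma primitiveN F f : primitive F f ->
  primitive (fun x => - F x) (fun x => - f x).
Proof.
by move=> /(primitiveZ (-1)) /primitive_eq; apply => x; rewrite mulN1r.
Qed.

Lemma primitiveB F f G g : primitive F f -> primitive G g ->
  primitive (fun x => F x - G x) (fun x => f x - g x).
Proof. by move=> hF hG; apply/primitiveD/primitiveN. Qed.

Lemma primitive_le F f a b : primitive F f -> a <= b ->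
  (forall x, a <= x <= b -> 0 <= f x) -> F a <= F b.
Proof.
move=> [lf hF] ab f0; rewrite -subr_ge0 hF//; apply: Rintegral_ge0 => x /=.
by rewrite in_itv/=; exact: f0.
Qed.

Lemma primitive_id : primitive id (fun=> 1).
Proof.
split; first exact: locally_bounded_cst.
move=> a b ab; rewrite Rintegral_cst//= lebesgue_measure_itv/= lte_fin.
by case: ltgtP ab => //= [|->] _; rewrite ?mul1r ?mulr0 ?subrr.
Qed.

Lemma primitive_approx F f c e x y : primitive F f -> x <= y ->
  (forall t, x <= t <= y -> `|f t - c| <= e) ->
  `|F y - F x - c * (y - x)| <= e * (y - x).
Proof.
move=> hF xy he.
have h1 : primitive (fun t => e * t - (F t - c * t))
                    (fun t => e * 1 - (f t - c * 1)).
  by do ![apply: primitiveB|apply: primitiveZ|exact: hF|exact: primitive_id].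
have h2 : primitive (fun t => e * t + (F t - c * t))
                    (fun t => e * 1 + (f t - c * 1)).
  by do ![apply: primitiveB|apply: primitiveD|apply: primitiveZ|exact: hF
         |exact: primitive_id].
have A t : x <= t <= y -> - e <= f t - c <= e by move=> /he; rewrite ler_norml.
have H1 := primitive_le h1 xy (fun t ht => ltac:(by have := A t ht; lra)).
have H2 := primitive_le h2 xy (fun t ht => ltac:(by have := A t ht; lra)).
rewrite ler_norml; lra.
Qed.

Lemma primitive_derive F f x : primitive F f -> {for x, continuous f} ->
  is_derive x 1 F (f x).
Proof.
move=> hF cf.
suff H : h^-1 *: (F (h *: 1 + x) - F x) @[h --> 0^'] --> f x.
  by split; [apply/cvg_ex; exists (f x)|apply/cvg_lim].
apply/cvgrPdist_le => /= e e0.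
have [d /= d0 hd] : \forall t \near x, `|f x - f t| <= e.
  by move/cvgrPdist_le : cf; exact.
near=> h.
have h0 : h != 0 by near: h; exact: nbhs_dnbhs_neq.
have hd' : `|h| < d by near: h; apply: dnbhs0_lt.
have -> : f x - h^-1 *: (F (h *: 1 + x) - F x) =
   - (h^-1 * (F (h + x) - F x - f x * h)).
  by rewrite /GRing.scale/= mulr1; field.
rewrite normrN normrM normfV ler_pdivrMl ?normr_gt0//.
have [h_gt0|h_le0] := ltP 0 h.
  have := @primitive_approx F f (f x) e x (h + x) hF.
  rewrite (gtr0_norm h_gt0) !ler_norml => H.
  suff : - (e * (h + x - x)) <= F (h + x) - F x - f x * (h + x - x) <=
      e * (h + x - x) by lra.
  apply: H; first lra.
  move=> t tx; rewrite distrC; apply: hd => /=.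
  by move: hd'; rewrite ltr_norml => hd'; rewrite ltr_distlC; lra.
have := @primitive_approx F f (f x) e (h + x) x hF.
rewrite (ler0_norm h_le0) !ler_norml => H.
suff : - (e * (x - (h + x))) <= F x - F (h + x) - f x * (x - (h + x)) <=
    e * (x - (h + x)) by lra.
apply: H; first lra.
move=> t tx; rewrite distrC; apply: hd => /=.
by move: hd'; rewrite ltr_norml => hd'; rewrite ltr_distlC; lra.
Unshelve. all: by end_near. Qed.

Lemma Rintegral_itv_split f a b c : locally_bounded f -> a <= b -> b <= c ->
  \int[mu]_(x in `[a, c]) f x =
  \int[mu]_(x in `[a, b]) f x + \int[mu]_(x in `[b, c]) f x.
Proof.
move=> lf ab bc.
have -> : \int[mu]_(x in `[b, c]) f x = \int[mu]_(x in `]b, c]) f x.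
  rewrite Rintegral_itv_obnd_cbnd//.
  apply: integrableS (locally_bounded_integrable b c lf) => //.
  by apply: subset_itvr; rewrite bnd_simp.
rewrite -(@Rintegral_itvB _ _ (BLeft a)) ?bnd_simp//; first by ring.
exact: locally_bounded_integrable.
Qed.

Definition integral0 f x :=
  \int[mu]_(t in `[0, x]) f t - \int[mu]_(t in `[x, 0]) f t.

Lemma integral0_0 f : integral0 f 0 = 0.
Proof. by rewrite /integral0 subrr. Qed.

Lemma primitive_integral0 f : locally_bounded f -> primitive (integral0 f) f.
Proof.
move=> lf; pose I a b := \int[mu]_(x in `[a, b]) f x.
have I0 a b : b <= a -> I a b = 0.
  rewrite le_eqVlt => /predU1P[->|ba]; rewrite /I.
    by rewrite set_itv1 Rintegral_set1.
  by rewrite set_itv_ge ?Rintegral_set0// bnd_simp -ltNge.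
split=> // a b ab; have split := Rintegral_itv_split lf.
rewrite /integral0 -/(I 0 a) -/(I a 0) -/(I 0 b) -/(I b 0) -/(I a b).
have [a0|a0] := leP 0 a.
  rewrite (I0 b 0) ?(I0 a 0)//; last exact: le_trans ab.
  by rewrite /I (split 0 a b)//; ring.
have [b0|b0] := leP 0 b.
  by rewrite (I0 b 0)// (I0 0 a) ?(ltW a0)// /I (split a 0 b) ?(ltW a0)//; ring.
rewrite (I0 0 b) ?(ltW b0)// (I0 0 a) ?(ltW a0)// {2}/I (split a b 0) ?(ltW b0)//.
by rewrite /I; ring.
Qed.

Lemma primitive_lipschitz F f M x y : primitive F f -> x <= y ->
  (forall t, x <= t <= y -> `|f t| <= M) -> `|F y - F x| <= M * (y - x).
Proof.
move=> hF xy fM; have := @primitive_approx F f 0 M x y hF xy.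
by rewrite mul0r subr0; apply => t /fM; rewrite subr0.
Qed.

Lemma primitive_lipschitz_sym F f M K x y : primitive F f ->
  (forall t, `|t| <= K -> `|f t| <= M) -> `|x| <= K -> `|y| <= K ->
  `|F y - F x| <= M * `|y - x|.
Proof.
move=> hF fM; wlog xy : x y / x <= y => [H xK yK|].
  have [xy|/ltW yx] := leP x y; first exact: H.
  by rewrite distrC (distrC y) H.
move=> xK yK; rewrite [`|y - x|]ger0_norm ?subr_ge0//.
apply: primitive_lipschitz hF xy _ => t txy; apply: fM.
by move: xK yK; rewrite !ler_norml; lra.
Qed.

Lemma locally_bounded_gt0 f K : locally_bounded f ->
  exists2 M, 0 < M & forall x, `|x| <= K -> `|f x| <= M.
Proof.
move=> [_ /(_ K)[M hM]]; exists (`|M| + 1) => [|x /hM fx].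
  by rewrite ltr_wpDl.
by rewrite (le_trans fx)// (le_trans (ler_norm _))// lerDl.
Qed.

Lemma primitive_continuous F f : primitive F f -> continuous F.
Proof.
move=> hF x; apply/cvgrPdist_le => /= e e0.
have [M M0 hM] := locally_bounded_gt0 (`|x| + 1) (primitive_lb hF).
near=> y.
have yx : `|y - x| < e / M.
  by rewrite distrC; near: y; apply: cvgr_dist_lt; rewrite ?divr_gt0//.
have yx1 : `|y - x| < 1 by rewrite distrC; near: y; apply: cvgr_dist_lt.
have H : `|x| <= `|x| + 1 by rewrite lerDl.
have H' : `|y| <= `|x| + 1.
  rewrite -[y](subrK x) addrC (le_trans (ler_normD _ _))// lerD2l.
  exact: ltW.
rewrite (le_trans (primitive_lipschitz_sym hF hM H' H))//.
by rewrite distrC mulrC -ler_pdivlMr// ltW.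
Unshelve. all: by end_near. Qed.

Lemma primitive_locally_bounded F f : primitive F f -> locally_bounded F.
Proof. by move=> /primitive_continuous/continuous_locally_bounded. Qed.

(** A quadratic error bound stands in for a limit computation. It serves for the product rule, for
    [bump] at the points of modulus 1 and for differentiation under the integral sign. *)
Lemma quadratic_is_derive f x d C :
  (forall t, `|t - x| <= 1 -> `|f t - f x - d * (t - x)| <= C * (t - x) ^+ 2) ->
  is_derive x 1 f d.
Proof.
move=> H.
suff E : h^-1 *: (f (h *: 1 + x) - f x) @[h --> 0^'] --> (d : R).
  by split; [apply/cvg_ex; exists d|apply/cvg_lim].
apply/cvgrPdist_le => /= e e0; near=> h.
have h0 : h != 0 by near: h; exact: nbhs_dnbhs_neq.
have hC1 : `|h| < e / (`|C| + 1).
  by near: h; apply: dnbhs0_lt; rewrite divr_gt0// ltr_wpDl.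
have h1 : `|h| <= 1 by near: h; apply: dnbhs0_le.
have := H (h + x); rewrite addrK => /(_ h1) le1.
have -> : d - h^-1 *: (f (h *: 1 + x) - f x) = - (h^-1 * (f (h + x) - f x - d * h)).
  by rewrite /GRing.scale/= mulr1; field.
rewrite normrN normrM normfV ler_pdivrMl ?normr_gt0//.
apply: le_trans le1 _; rewrite -[h ^+ 2]real_normK ?num_real// expr2 mulrCA.
rewrite ler_pM2l ?normr_gt0//.
apply: (@le_trans _ _ ((`|C| + 1) * `|h|)).
  by rewrite ler_wpM2r// (le_trans (ler_norm _))// lerDl.
by rewrite mulrC -ler_pdivlMr ?ltr_wpDl// ltW.
Unshelve. all: by end_near. Qed.

Lemma quadratic_increment_cst F x y :
  (forall K, exists C, forall s t, `|s| <= K -> `|t| <= K -> s <= t ->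
     `|F t - F s| <= C * (t - s) ^+ 2) -> F x = F y.
Proof.
move=> H; apply: is_derive_0_is_cst => {}x {y}.
have [C hC] := H (`|x| + 1); apply: (@quadratic_is_derive _ _ _ C) => t tx.
have xK : `|x| <= `|x| + 1 by rewrite lerDl.
have tK : `|t| <= `|x| + 1.
  by rewrite -(subrK x t) addrC (le_trans (ler_normD _ _))// lerD2l.
rewrite mul0r subr0; have [xt|/ltW tx'] := leP x t; first exact: hC.
by rewrite distrC -[(t - x) ^+ 2]sqrrN opprB; exact: hC.
Qed.

(** The product rule is obtained without differentiating [F] or [G]: if [H] is the primitive of the
    expected density, the increment of [F G - H] between x and y is O((y - x)^2), so [F G - H] is
    constant. *)
Lemma primitiveM F f G g : primitive F f -> primitive G g ->
  primitive (fun x => F x * G x) (fun x => f x * G x + F x * g x).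
Proof.
move=> hF hG.
have lb : locally_bounded (fun x => f x * G x + F x * g x).
  have := (primitive_lb hF, primitive_lb hG).
  have := (primitive_locally_bounded hF, primitive_locally_bounded hG).
  by move=> [? ?] [? ?]; apply/locally_boundedD/locally_boundedM;
    first exact: locally_boundedM.
have hH := primitive_integral0 lb; set H := integral0 _ in hH.
split=> // a b ab; case: (hH) => _ <-//.
suff : F b * G b - H b = F a * G a - H a by lra.
apply: (@quadratic_increment_cst (fun x => F x * G x - H x)) => K.
have [M M0 hM] := locally_bounded_gt0 K (primitive_lb hF).
have [N N0 hN] := locally_bounded_gt0 K (primitive_lb hG).
exists (2 * M * N) => x y xK yK xy.
(* Freezing [G] at y and [F] at x makes the increment of [P] equal to that of [F G - H], while the
   density of [P] is of the order of y - x. *)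
pose P t := F t * G y + F x * G t - H t.
have hP : primitive P
    (fun t => f t * G y + F x * g t - (f t * G t + F t * g t)).
  apply: primitiveB hH; apply: primitiveD; last exact: primitiveZ.
  by apply: primitive_eq (primitiveZ (G y) hF) _ _ => t; rewrite mulrC.
have -> : F y * G y - H y - (F x * G x - H x) = P y - P x by rewrite /P; ring.
rewrite expr2 mulrA; apply: (primitive_lipschitz hP xy) => t txy.
have tK : `|t| <= K by move: xK yK; rewrite !ler_norml; lra.
have -> : f t * G y + F x * g t - (f t * G t + F t * g t) =
  f t * (G y - G t) + (F x - F t) * g t by ring.
have h1 : `|G y - G t| <= N * (y - x).
  have [_ ty] := andP txy.
  apply: le_trans (primitive_lipschitz_sym hG hN tK yK) _.
  rewrite ler_pM2l// ger0_norm ?subr_ge0//; lra.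
have h2 : `|F x - F t| <= M * (y - x).
  have [xt _] := andP txy.
  apply: le_trans (primitive_lipschitz_sym hF hM tK xK) _.
  rewrite ler_pM2l// distrC ger0_norm ?subr_ge0//; lra.
apply: le_trans (ler_normD _ _) _; rewrite !normrM.
have -> : 2 * M * N * (y - x) = M * (N * (y - x)) + M * (y - x) * N by ring.
by apply: lerD; apply: ler_pM; rewrite // ?hM ?hN.
Qed.

Lemma derive_primitive F f : (forall x, is_derive x 1 F (f x)) ->
  continuous f -> primitive F f.
Proof.
move=> dF cf.
have hG := primitive_integral0 (continuous_locally_bounded cf).
set G := integral0 _ in hG.
split=> [|a b ab]; first exact: primitive_lb hG.
case: (hG) => _ <-//.
suff : F b - G b = F a - G a by lra.
apply: (@is_derive_0_is_cst R (fun x => F x - G x)) => x.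
have dG := primitive_derive hG (cf x).
by rewrite -(subrr (f x)); exact: is_deriveB.
Qed.

Lemma measurable_reflect c :
  measurable_fun [set: R] (fun x => c - x : measurableTypeR R).
Proof. by apply: measurable_funB => //; exact: measurable_id. Qed.

Lemma lebesgue_measure_reflect c (A : set R) : measurable A ->
  mu A = pushforward mu (fun x => c - x : measurableTypeR R) A.
Proof.
move=> mA; apply: lebesgue_measure_unique => //= [|_ _ [[a b]] _ <-].
  exact: measurable_reflect.
rewrite /pushforward /=.
have -> : (fun x => c - x) @^-1` `]a, b] = `[c - b, c - a[%classic.
  by apply/seteqP; split=> x /=; rewrite !in_itv/=; lra.
rewrite !lebesgue_measure_itv/= !lte_fin.
have -> : (c - b < c - a) = (a < b) by apply/idP/idP; lra.
by case: ifP => // _; rewrite -!EFinD; congr (_%:E); ring.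
Qed.

Lemma locally_bounded_reflect c f : locally_bounded f ->
  locally_bounded (fun x => f (c - x)).
Proof.
move=> [mf bf]; split.
  by apply: (measurableT_comp mf); exact: measurable_reflect.
move=> K; have [M hM] := bf (`|c| + K); exists M => x xK; apply: hM.
by rewrite (le_trans (ler_normB _ _))// lerD2l.
Qed.

Lemma Rintegral_reflect c f a b : locally_bounded f ->
  \int[mu]_(x in `[c - b, c - a]) f x = \int[mu]_(x in `[a, b]) f (c - x).
Proof.
move=> lf.
have E : (fun x => c - x : measurableTypeR R) @^-1` `[c - b, c - a] = `[a, b]%classic.
  by apply/seteqP; split=> x /=; rewrite !in_itv/=; lra.
rewrite /Rintegral; congr fine.
transitivity (\int[pushforward mu (fun x => (c - x)%R : measurableTypeR R)]_(x in
    `[(c - b)%R, (c - a)%R]) (f x)%:E)%E.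
  apply: eq_measure_integral => /= [|? A mA _]; first exact: measurable_reflect.
  exact: lebesgue_measure_reflect.
rewrite integral_pushforward//= ?E//.
- exact: measurable_reflect.
- by apply/measurable_EFinP; case: lf.
- exact: (locally_bounded_integrable a b (locally_bounded_reflect c lf)).
Qed.

Lemma primitive_reflect c F f : primitive F f ->
  primitive (fun x => F (c - x)) (fun x => - f (c - x)).
Proof.
move=> hF; have lb := locally_bounded_reflect c (primitive_lb hF).
split=> [|a b ab]; first exact: locally_boundedN.
have -> : \int[mu]_(x in `[a, b]) (- f (c - x)) =
    - \int[mu]_(x in `[a, b]) f (c - x).
  transitivity (\int[mu]_(x in `[a, b]) (-1 * f (c - x))).
    by apply: eq_Rintegral => x _; rewrite mulN1r.
  by rewrite RintegralZl ?mulN1r//; exact: (locally_bounded_integrable _ _ lb).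
rewrite -opprB; congr (- _).
by case: hF => lf ->; [rewrite Rintegral_reflect|rewrite lerD2l lerN2].
Qed.

Lemma locally_bounded_locally_integrable f : locally_bounded f ->
  locally_integrable setT f.
Proof.
move=> lf; split; [by case: lf|exact: openT|move=> K _ cK].
have [M [_ hM]] := compact_bounded cK.
have /integrableP[_ H] :=
  locally_bounded_integrable (- (`|M| + 1)) (`|M| + 1) lf.
apply: le_lt_trans H; apply: ge0_subset_integral => //=.
- exact: compact_measurable.
- apply/measurable_EFinP/measurable_funTS; apply: measurableT_comp => //.
  by case: lf.
- move=> x Kx /=; rewrite in_itv/= -ler_norml; apply: (hM (`|M| + 1)) => //.
  by rewrite ltr_pwDr// ler_norm.
Qed.

(** The derivative exists at every Lebesgue point of [f]. The integral is started at x - 1, and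
    agrees with [F] up to a constant within distance 1 of x. *)
Lemma primitive_ae_derive F f : primitive F f ->
  {ae mu, forall x, is_derive x 1 F (f x)}.
Proof.
move=> hF; have lf := primitive_lb hF.
have := lebesgue_differentiation (locally_bounded_locally_integrable lf).
apply: (@filterS _ _ (ae_filter_ringOfSetsType mu)) => x fx.
have x1 : x < x + 1 by rewrite ltrDl.
have x0 : (BLeft (x - 1)%R < BRight x)%E by rewrite lte_fin; lra.
have /= := @FTC1_lebesgue_pt _ f (BLeft (x - 1)) x (x + 1) x1
  (locally_bounded_integrable _ _ lf) x0 fx.
set G := (G in derivable G) => -[dG G'].
have hG : is_derive x 1 G (f x) by split; [exact: dG|rewrite -derive1E; exact: G'].
have dH : is_derive x 1 (fun y => F (x - 1) + G y) (f x).
  by rewrite -[f x]add0r; apply: is_deriveD.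
apply: near_eq_is_derive dH.
near=> y; rewrite /G; case: (hF) => _ <-; first by ring.
have : `|x - y| < 1 by near: y; apply: cvgr_dist_lt.
by rewrite ltr_norml; lra.
Unshelve. all: by end_near. Qed.

End Primitive.

(** * Entire functions *)

Section Entire.
Context {R : realType}.
Local Notation C := R[i].
Local Notation N z := (Normc.normc z).
Implicit Types (p r : {poly C}) (h : C -> C) (k z : C) (rho e : R).

Lemma normc_ge0 z : 0 <= N z.
Proof. by case: z => a b; exact: sqrtr_ge0. Qed.

Lemma normc_eq0 z : (N z == 0) = (z == 0).
Proof.
by apply/eqP/eqP => [/Normc.eq0_normc//|->]; exact: Normc.normc0.
Qed.

Lemma normc_gt0 z : (0 < N z) = (z != 0).
Proof. by rewrite lt_neqAle normc_ge0 andbT eq_sym normc_eq0. Qed.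

Lemma normcX z n : N (z ^+ n) = N z ^+ n.
Proof.
elim: n => [|n ih]; first by rewrite !expr0 Normc.normc1.
by rewrite !exprS Normc.normcM ih.
Qed.

Lemma le_normcB z z' : N (z - z') <= N z + N z'.
Proof. by rewrite -(normcN z'); exact: le_normcD. Qed.

Lemma ler_distD_normc z z' : N z - N z' <= N (z - z').
Proof. by rewrite lerBlDr -{1}(subrK z' z); exact: le_normcD. Qed.

Lemma normc_distC z z' : N (z - z') = N (z' - z).
Proof. by rewrite -normcN opprB. Qed.

Lemma normc_ltP z : (forall e, 0 < e -> N z <= e) -> z = 0.
Proof.
move=> H; apply/eqP; rewrite -normc_eq0 eq_le normc_ge0 andbT.
by apply/ler_addgt0Pr => e e0; rewrite add0r H.
Qed.

Lemma ge_Re_normc z : `|complex.Re z| <= N z.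
Proof.
by case: z => a b /=; rewrite -[`|a|]sqrtr_sqr ler_wsqrtr// lerDl sqr_ge0.
Qed.

Lemma ge_Im_normc z : `|complex.Im z| <= N z.
Proof.
by case: z => a b /=; rewrite -[`|b|]sqrtr_sqr ler_wsqrtr// lerDr sqr_ge0.
Qed.

Lemma normc_real (x : R) : N x%:C = `|x|.
Proof. by rewrite /= [0 ^+ 2]expr0n addr0 sqrtr_sqr. Qed.

Lemma normc_i : N ('i : C) = 1.
Proof. by rewrite /= [0 ^+ 2]expr0n expr1n add0r sqrtr1. Qed.

(** This weighted l^1 norm of the coefficients dominates the supremum on the disc of radius [rho]
    and is submultiplicative. It is preferred to the supremum because division by X - k is bounded
    for it by an elementary induction. *)
Definition coefnorm rho p := \sum_(i < size p) N p`_i * rho ^+ i.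

Lemma coefnormE rho p n : (size p <= n)%N ->
  coefnorm rho p = \sum_(i < n) N p`_i * rho ^+ i.
Proof.
move=> pn; rewrite /coefnorm (big_ord_widen _ (fun i => N p`_i * rho ^+ i) pn).
rewrite big_mkcond; apply: eq_bigr => i _; case: ltnP => // ip.
by rewrite nth_default// Normc.normc0 mul0r.
Qed.

Lemma coefnorm_ge0 rho p : 0 <= rho -> 0 <= coefnorm rho p.
Proof.
by move=> r0; apply: sumr_ge0 => i _; rewrite mulr_ge0 ?normc_ge0 ?exprn_ge0.
Qed.

Lemma coefnormD rho p r : 0 <= rho ->
  coefnorm rho (p + r) <= coefnorm rho p + coefnorm rho r.
Proof.
move=> r0; have sz := size_polyD p r.
rewrite (coefnormE _ sz) (coefnormE _ (leq_maxl (size p) (size r))).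
rewrite (coefnormE rho (leq_maxr (size p) (size r))) -big_split/=.
apply: ler_sum => i _; rewrite coefD -mulrDl ler_wpM2r ?exprn_ge0//.
exact: le_normcD.
Qed.

Lemma coefnormN rho p : coefnorm rho (- p) = coefnorm rho p.
Proof.
by rewrite /coefnorm size_polyN; apply: eq_bigr => i _; rewrite coefN normcN.
Qed.

Lemma coefnorm0 rho : coefnorm rho 0 = 0.
Proof. by rewrite /coefnorm size_poly0 big_ord0. Qed.

Lemma coefnorm_cons rho p z :
  coefnorm rho (p * 'X + z%:P) = rho * coefnorm rho p + N z.
Proof.
rewrite (@coefnormE _ _ (size p).+1); last first.
  by rewrite size_MXaddC; case: ifP.
rewrite big_ord_recl coefD coefMX coefC/= add0r expr0 mulr1 addrC; congr (_ + _).
rewrite mulr_sumr; apply: eq_bigr => i _.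
by rewrite coefD coefMX coefC/= addr0 exprS mulrCA.
Qed.

Lemma coefnorm_horner rho p k : N k <= rho -> N p.[k] <= coefnorm rho p.
Proof.
move=> kr; elim/poly_ind: p => [|p z ih].
  by rewrite horner0 Normc.normc0 coefnorm0.
rewrite coefnorm_cons hornerMXaddC (le_trans (le_normcD _ _))// lerD2r.
by rewrite Normc.normcM mulrC ler_pM ?normc_ge0.
Qed.

Lemma coefnormZ rho z p : coefnorm rho (z%:P * p) = N z * coefnorm rho p.
Proof.
have [->|z0] := eqVneq z 0; first by rewrite mul0r coefnorm0 Normc.normc0 mul0r.
rewrite /coefnorm size_Cmul// mulr_sumr; apply: eq_bigr => i _.
by rewrite coefCM Normc.normcM mulrA.
Qed.

Lemma coefnormM rho p r : 0 <= rho ->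
  coefnorm rho (p * r) <= coefnorm rho p * coefnorm rho r.
Proof.
move=> r0; elim/poly_ind: p => [|p z ih]; first by rewrite mul0r coefnorm0 mul0r.
rewrite mulrDl (le_trans (coefnormD _ _ r0))// coefnorm_cons coefnormZ mulrDl.
rewrite lerD2r -mulrA (mulrC 'X) mulrA -[p * r * 'X]addr0 -polyC0.
by rewrite coefnorm_cons Normc.normc0 addr0 -mulrA ler_wpM2l.
Qed.

Definition divX k p := (p - p.[k]%:P) %/ ('X - k%:P).

Lemma divXE k p : p = divX k p * ('X - k%:P) + p.[k]%:P.
Proof.
rewrite /divX divpK ?subrK// dvdp_XsubCl rootE hornerD hornerN hornerC.
by rewrite subrr.
Qed.

Lemma divX_unique k p r z : p = r * ('X - k%:P) + z%:P -> divX k p = r.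
Proof.
move=> E; have zE : z = p.[k].
  by rewrite E hornerD hornerM hornerXsubC subrr mulr0 add0r hornerC.
apply: (mulIf (negbT (polyXsubC_eq0 k))); apply: (addIr p.[k]%:P).
by rewrite -divXE -zE.
Qed.

(** One step of Horner's scheme; it makes induction on the coefficients available for [divX]. *)
Lemma divX_cons k p z : divX k (p * 'X + z%:P) = divX k p * 'X + p.[k]%:P.
Proof.
apply: (@divX_unique _ _ _ (p.[k] * k + z)).
rewrite {1}(divXE k p) polyCD polyCM; ring.
Qed.

Lemma divXB k p r : divX k (p - r) = divX k p - divX k r.
Proof.
apply: (@divX_unique _ _ _ (p.[k] - r.[k])).
rewrite {1}(divXE k p) {1}(divXE k r) polyCB; ring.
Qed.

(** For a monomial this is the equality (rho - |k|) sum_j rho^j |k|^(n-1-j) + |k|^n = rho^n. The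
    term [coefnorm (N k) p] makes the induction close; dropping it bounds the division by 1 / (rho -
    |k|). *)
Lemma coefnorm_divX rho k p : N k <= rho ->
  (rho - N k) * coefnorm rho (divX k p) + coefnorm (N k) p <= coefnorm rho p.
Proof.
move=> kr; have k0 := normc_ge0 k.
elim/poly_ind: p => [|p z ih].
  by rewrite /divX horner0 subr0 div0p !coefnorm0; lra.
rewrite divX_cons !coefnorm_cons.
have := coefnorm_horner p (lexx (N k)).
have := ler_wpM2l (le_trans k0 kr) ih; nra.
Qed.

End Entire.
Section EntireFunctions.
Context {R : realType}.
Local Notation C := R[i].
Local Notation N z := (Normc.normc z).
Implicit Types (h g : C -> C) (k z : C) (rho e : R) (P Q : nat -> {poly C}).

Definition poly_cauchy P := forall rho e, 0 < rho -> 0 < e ->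
  exists n0, forall m n, (n0 <= m)%N -> (n0 <= n)%N ->
    coefnorm rho (P m - P n) <= e.

Definition poly_limit P h := forall k e, 0 < e ->
  exists n0, forall n, (n0 <= n)%N -> N ((P n).[k] - h k) <= e.

(* Limits of polynomials in all the norms [sum_j |c_j| rho^j]; dividing the
   approximating polynomials by [X - k] divides the limit. *)
Definition entire h := exists2 P, poly_cauchy P & poly_limit P h.

Lemma poly_limit_uniform P h rho e : poly_cauchy P -> poly_limit P h ->
  0 < rho -> 0 < e -> exists n0, forall n k, (n0 <= n)%N -> N k <= rho ->
    N ((P n).[k] - h k) <= e.
Proof.
move=> cP lP r0 e0; have e2 : 0 < e / 2 by lra.
have [n0 hn0] := cP rho (e / 2) r0 e2; exists n0 => n k nn0 kr.
have [n1 hn1] := lP k (e / 2) e2.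
have -> : (P n).[k] - h k = (P n - P (maxn n0 n1)).[k] +
    ((P (maxn n0 n1)).[k] - h k) by rewrite hornerD hornerN; ring.
have := le_normcD (P n - P (maxn n0 n1)).[k] ((P (maxn n0 n1)).[k] - h k).
have := hn1 (maxn n0 n1) (leq_maxr _ _).
have := coefnorm_horner (P n - P (maxn n0 n1)) kr.
have := hn0 n (maxn n0 n1) nn0 (leq_maxl _ _).
by lra.
Qed.

Lemma poly_cauchy_bounded P rho : poly_cauchy P -> 0 < rho ->
  exists M n0, 0 < M /\ forall n, (n0 <= n)%N -> coefnorm rho (P n) <= M.
Proof.
move=> cP r0; have [n0 hn0] := cP rho 1 r0 ltr01.
exists (coefnorm rho (P n0) + 1), n0; split.
  by rewrite ltr_wpDl// coefnorm_ge0// ltW.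
move=> n nn0; have := hn0 n n0 nn0 (leqnn _).
have := coefnormD (P n - P n0) (P n0) (ltW r0); rewrite subrK; lra.
Qed.

Lemma entire_poly (p : {poly C}) : entire (horner p).
Proof.
exists (fun=> p) => [rho e r0 e0|k e e0]; exists 0%N => *.
  by rewrite subrr coefnorm0 ltW.
by rewrite subrr Normc.normc0 ltW.
Qed.

Lemma entire_eq h g : entire h -> h =1 g -> entire g.
Proof. by move=> + /funext <-. Qed.

Lemma entire_cst z : entire (fun=> z).
Proof. by apply: entire_eq (entire_poly z%:P) _ => k; rewrite hornerC. Qed.

Lemma entire_id : entire id.
Proof. by apply: entire_eq (entire_poly 'X) _ => k; rewrite hornerX. Qed.

Lemma entireD h g : entire h -> entire g -> entire (fun k => h k + g k).
Proof.
move=> [P cP lP] [Q cQ lQ]; exists (fun n => P n + Q n).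
  move=> rho e r0 e0; have e2 : 0 < e / 2 by lra.
  have [n0 hn0] := cP rho _ r0 e2; have [n1 hn1] := cQ rho _ r0 e2.
  exists (maxn n0 n1) => m n; rewrite !geq_max => /andP[m0 m1] /andP[n0' n1'].
  have -> : P m + Q m - (P n + Q n) = (P m - P n) + (Q m - Q n) by ring.
  have := coefnormD (P m - P n) (Q m - Q n) (ltW r0).
  by have := hn0 m n m0 n0'; have := hn1 m n m1 n1'; lra.
move=> k e e0; have e2 : 0 < e / 2 by lra.
have [n0 hn0] := lP k _ e2; have [n1 hn1] := lQ k _ e2.
exists (maxn n0 n1) => n; rewrite !geq_max => /andP[n0' n1'].
have -> : (P n + Q n).[k] - (h k + g k) = ((P n).[k] - h k) + ((Q n).[k] - g k).
  by rewrite hornerD; ring.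
have := le_normcD ((P n).[k] - h k) ((Q n).[k] - g k).
by have := hn0 n n0'; have := hn1 n n1'; lra.
Qed.

Lemma entireM h g : entire h -> entire g -> entire (fun k => h k * g k).
Proof.
move=> [P cP lP] [Q cQ lQ]; exists (fun n => P n * Q n).
  move=> rho e r0 e0.
  have [M [a [M0 hM]]] := poly_cauchy_bounded cP r0.
  have [M' [b [M'0 hM']]] := poly_cauchy_bounded cQ r0.
  have e1 : 0 < e / (2 * M') by rewrite divr_gt0// mulr_gt0.
  have e2 : 0 < e / (2 * M) by rewrite divr_gt0// mulr_gt0.
  have [n0 hn0] := cP rho _ r0 e1; have [n1 hn1] := cQ rho _ r0 e2.
  exists (maxn (maxn n0 n1) (maxn a b)) => m n; rewrite !geq_max.
  move=> /andP[/andP[m0 m1] /andP[ma mb]] /andP[/andP[n0' n1'] /andP[na nb]].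
  have -> : P m * Q m - P n * Q n = (P m - P n) * Q m + P n * (Q m - Q n) by ring.
  apply: le_trans (coefnormD _ _ (ltW r0)) _.
  have -> : e = e / (2 * M') * M' + M * (e / (2 * M)).
    by field; rewrite !gt_eqF.
  apply: lerD; (apply: le_trans (coefnormM _ _ (ltW r0)) _).
    by apply: ler_pM; rewrite ?coefnorm_ge0 ?(ltW r0)// ?hn0 ?hM'.
  by apply: ler_pM; rewrite ?coefnorm_ge0 ?(ltW r0)// ?hn1 ?hM.
move=> k e e0.
have [n0 hn0] := lP k 1 ltr01.
have M0 : 0 < N (h k) + 1 by rewrite ltr_wpDl// normc_ge0.
have M'0 : 0 < N (g k) + 1 by rewrite ltr_wpDl// normc_ge0.
have e1 : 0 < e / (2 * (N (h k) + 1)) by rewrite divr_gt0// mulr_gt0.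
have e2 : 0 < e / (2 * (N (g k) + 1)) by rewrite divr_gt0// mulr_gt0.
have [n1 hn1] := lQ k _ e1; have [n2 hn2] := lP k _ e2.
exists (maxn n0 (maxn n1 n2)) => n; rewrite !geq_max => /and3P[a b c].
rewrite hornerM.
have -> : (P n).[k] * (Q n).[k] - h k * g k =
  (P n).[k] * ((Q n).[k] - g k) + ((P n).[k] - h k) * g k by ring.
apply: le_trans (le_normcD _ _) _; rewrite !Normc.normcM.
have -> : e = (N (h k) + 1) * (e / (2 * (N (h k) + 1))) +
    e / (2 * (N (g k) + 1)) * (N (g k) + 1) by field; rewrite !gt_eqF.
apply: lerD; apply: ler_pM; rewrite ?normc_ge0 ?hn1 ?hn2//; last first.
  by rewrite lerDl.
have := hn0 n a; have := ler_distD_normc (P n).[k] (h k); lra.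
Qed.

Lemma entireN h : entire h -> entire (fun k => - h k).
Proof.
move=> /(entireM (entire_cst (-1))) /entire_eq; apply => k.
by rewrite mulN1r.
Qed.

Lemma entireB h g : entire h -> entire g -> entire (fun k => h k - g k).
Proof. by move=> hh /entireN; exact: entireD. Qed.

Lemma entireX n : entire (fun k => k ^+ n).
Proof. by apply: entire_eq (entire_poly 'X^n) _ => k; rewrite hornerXn. Qed.

Lemma coefnorm_comp_oppX rho (p : {poly C}) :
  coefnorm rho (p \Po (- 'X)) = coefnorm rho p.
Proof.
elim/poly_ind: p => [|p z ih]; first by rewrite comp_poly0.
rewrite comp_poly_MXaddC mulrN -mulNr !coefnorm_cons coefnormN ih//.
Qed.

Lemma entire_comp_opp h : entire h -> entire (fun k => h (- k)).
Proof.
move=> [P cP lP]; exists (fun n => P n \Po (- 'X)).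
  move=> rho e r0 e0; have [n0 hn0] := cP rho e r0 e0; exists n0 => m n mn nn.
  by rewrite -comp_polyB coefnorm_comp_oppX hn0.
move=> k e e0; have [n0 hn0] := lP (- k) e e0; exists n0 => n nn.
by rewrite horner_comp hornerN hornerX hn0.
Qed.

Lemma cauchy_normc_limit (u : nat -> C) :
  (forall e, 0 < e -> exists n0, forall m n, (n0 <= m)%N -> (n0 <= n)%N ->
     N (u m - u n) <= e) ->
  exists l, forall e, 0 < e -> exists n0, forall n, (n0 <= n)%N -> N (u n - l) <= e.
Proof.
move=> H.
have real_limit (v : nat -> R) : (forall m n, `|v m - v n| <= N (u m - u n)) ->
  exists l, forall e, 0 < e -> exists n0, forall n, (n0 <= n)%N -> `|v n - l| <= e.
  move=> vu; have : cvg (v @ \oo).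
    apply: cauchy_cvg; apply/cauchyP => /= e e0.
    have e2 : 0 < e / 2 by lra.
    have [n0 hn0] := H _ e2; exists (v n0), n0 => // n /= nn0.
    rewrite /ball/=; apply: le_lt_trans (vu _ _) _.
    by apply: le_lt_trans (hn0 _ _ _ _) _ => //; lra.
  move=> /cvg_ex[l /cvgrPdist_le vl]; exists l => e e0.
  have [n0 _ hn0] := vl e e0; exists n0 => n nn0.
  by rewrite distrC; exact: hn0.
have ReB (z z' : C) : complex.Re (z - z') = complex.Re z - complex.Re z'.
  by case: z z' => [a b] [].
have ImB (z z' : C) : complex.Im (z - z') = complex.Im z - complex.Im z'.
  by case: z z' => [a b] [].
have [|a ha] := real_limit (fun n => complex.Re (u n)).
  by move=> m n; rewrite -ReB; exact: ge_Re_normc.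
have [|b hb] := real_limit (fun n => complex.Im (u n)).
  by move=> m n; rewrite -ImB; exact: ge_Im_normc.
exists (a +i* b) => e e0; have e2 : 0 < e / 2 by lra.
have [n0 hn0] := ha _ e2; have [n1 hn1] := hb _ e2.
exists (maxn n0 n1) => n; rewrite geq_max => /andP[n0n n1n].
have -> : u n - (a +i* b) = (complex.Re (u n) - a)%:C + 'i * (complex.Im (u n) - b)%:C.
  by rewrite [LHS]complexE ReB ImB.
apply: le_trans (le_normcD _ _) _; rewrite Normc.normcM normc_i.
rewrite mul1r !normc_real; have := hn0 n n0n; have := hn1 n n1n; lra.
Qed.

Lemma poly_cauchy_limit P : poly_cauchy P -> exists h, poly_limit P h.
Proof.
move=> cP.
suff H k : exists l, forall e, 0 < e -> exists n0,
    forall n, (n0 <= n)%N -> N ((P n).[k] - l) <= e.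
  by have [h hh] := choice H; exists h.
apply: cauchy_normc_limit => e e0.
have k1 : 0 < N k + 1 by rewrite ltr_wpDl// normc_ge0.
have [n0 hn0] := cP (N k + 1) e k1 e0; exists n0 => m n mn nn.
rewrite -hornerN -hornerD (le_trans _ (hn0 m n mn nn))//.
by apply: coefnorm_horner; rewrite lerDl.
Qed.

End EntireFunctions.

(** * Orders of zeros, the maximum principle and Liouville arguments *)

Section Liouville.
Context {R : realType}.
Local Notation C := R[i].
Local Notation N z := (Normc.normc z).
Implicit Types (h g : C -> C) (k z : C) (rho e : R) (P Q : nat -> {poly C}).

Lemma coefnorm_divX_le rho z (p : {poly C}) : N z < rho ->
  coefnorm rho (divX z p) <= coefnorm rho p / (rho - N z).
Proof.
move=> zr; rewrite ler_pdivlMr ?subr_gt0// mulrC.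
have := coefnorm_divX p (ltW zr).
have := coefnorm_ge0 p (normc_ge0 z); lra.
Qed.

Lemma poly_cauchy_divX P z : poly_cauchy P -> poly_cauchy (fun n => divX z (P n)).
Proof.
move=> cP rho e r0 e0.
have r1 : 0 < rho + N z + 1 by rewrite ltr_wpDl// addr_ge0 ?normc_ge0// ltW.
(* At this enlarged radius, division by X - z has norm at most 1 / (rho + 1), hence at most 1. *)
have [n0 hn0] := cP (rho + N z + 1) e r1 e0.
exists n0 => m n mn nn; rewrite -divXB.
have le1 (p : {poly C}) : coefnorm rho p <= coefnorm (rho + N z + 1) p.
  rewrite /coefnorm; apply: ler_sum => i _; rewrite ler_wpM2l ?normc_ge0//.
  have := normc_ge0 z => z0; apply: lerXn2r; rewrite ?nnegrE; lra.
apply: le_trans (le1 _) _.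
apply: le_trans (@coefnorm_divX_le _ z _ _) _; first lra.
rewrite ler_pdivrMr; last lra.
apply: le_trans (hn0 m n mn nn) _; rewrite ler_peMr// ?ltW//; lra.
Qed.

Lemma poly_limit_divX P h z : poly_cauchy P -> poly_limit P h ->
  exists2 g, poly_limit (fun n => divX z (P n)) g &
    forall k, h k = h z + (k - z) * g k.
Proof.
move=> cP lP; have cD := poly_cauchy_divX z cP.
have [g hg] := poly_cauchy_limit cD; exists g => // k.
suff : h k - (h z + (k - z) * g k) = 0 by move/eqP; rewrite subr_eq0 => /eqP.
apply: normc_ltP => e e0; have e3 : 0 < e / 3 by rewrite divr_gt0.
have d0 : 0 < N (k - z) + 1 by rewrite ltr_wpDl// normc_ge0.
have [a ha] := lP k _ e3; have [b hb] := lP z _ e3.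
have [c hc] := hg k (e / 3 / (N (k - z) + 1)) (divr_gt0 e3 d0).
pose n := maxn a (maxn b c).
have := ha n (leq_maxl _ _).
have := hb n (leq_trans (leq_maxl b c) (leq_maxr _ _)).
have := hc n (leq_trans (leq_maxr b c) (leq_maxr _ _)).
set D := divX z (P n).
have -> : h k - (h z + (k - z) * g k) =
  - ((P n).[k] - h k) + (((P n).[z] - h z) + (k - z) * (D.[k] - g k)).
  rewrite {1}(divXE z (P n)) hornerD hornerM hornerXsubC hornerC -/D; ring.
move=> H1 H2 H3; apply: le_trans (le_normcD _ _) _.
rewrite normcN; apply: le_trans (lerD (lexx _) (le_normcD _ _)) _.
rewrite Normc.normcM.
have : N (k - z) * N (D.[k] - g k) <= e / 3.
  apply: le_trans (_ : (N (k - z) + 1) * N (D.[k] - g k) <= _).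
    by rewrite ler_wpM2r ?normc_ge0// lerDl.
  by rewrite mulrC -ler_pdivlMr.
lra.
Qed.

Lemma entire_div h z : entire h ->
  exists2 g, entire g & forall k, h k = h z + (k - z) * g k.
Proof.
move=> [P cP lP]; have [g lg hg] := poly_limit_divX z cP lP.
by exists g => //; exists (fun n => divX z (P n)) => //; exact: poly_cauchy_divX.
Qed.

Lemma entire_bounded h rho : entire h ->
  exists2 M, 0 < M & forall k, N k <= rho -> N (h k) <= M.
Proof.
move=> [P cP lP]; have r0 : 0 < `|rho| + 1 by rewrite ltr_wpDl.
have [n0 hn0] := poly_limit_uniform cP lP r0 ltr01.
exists (coefnorm (`|rho| + 1) (P n0) + 1).
  by rewrite ltr_wpDl// coefnorm_ge0// ltW.
move=> k kr; have kr' : N k <= `|rho| + 1.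
  by rewrite (le_trans kr)// (le_trans (ler_norm _))// lerDl.
have := hn0 n0 k (leqnn _) kr'; have := coefnorm_horner (P n0) kr'.
by have := ler_distD_normc (h k) (P n0).[k]; rewrite normc_distC; lra.
Qed.

Lemma entire_lipschitz h z : entire h ->
  exists2 M, 0 < M & forall k, N (k - z) <= 1 -> N (h k - h z) <= M * N (k - z).
Proof.
move=> /(entire_div z)[g eg hg].
have [M M0 hM] := entire_bounded (N z + 1) eg; exists M => // k kz.
rewrite hg addrC addKr Normc.normcM mulrC ler_wpM2r ?normc_ge0//; apply: hM.
by rewrite -(subrK z k) (le_trans (le_normcD _ _))// addrC lerD2l.
Qed.

Lemma entire_continuous h z e : entire h -> 0 < e ->
  exists2 d, 0 < d & forall k, N (k - z) <= d -> N (h k - h z) <= e.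
Proof.
move=> /(entire_lipschitz z)[M M0 hM] e0; exists (Num.min 1 (e / M)).
  by rewrite lt_min ltr01 divr_gt0.
move=> k; rewrite le_min => /andP[k1 kM]; apply: le_trans (hM k k1) _.
by rewrite mulrC -ler_pdivlMr.
Qed.

Lemma entire_neq0_near h z : entire h -> h z != 0 ->
  exists2 d, 0 < d & forall k, N (k - z) <= d -> h k != 0.
Proof.
move=> eh hz; have e0 : 0 < N (h z) / 2 by rewrite divr_gt0// normc_gt0.
have [d d0 hd] := entire_continuous z eh e0; exists d => // k /hd.
apply: contraTneq => ->; rewrite sub0r normcN -ltNge.
by rewrite ltr_pdivrMr// ltr_pMr ?normc_gt0// ltr1n.
Qed.

Definition divXs z m P := fun n => iter m (divX z) (P n).

Lemma poly_cauchy_divXs P z m : poly_cauchy P -> poly_cauchy (divXs z m P).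
Proof.
by move=> cP; elim: m => [//|m ih]; exact: poly_cauchy_divX.
Qed.

Lemma coefnorm_divXs_le rho z m (p : {poly C}) : N z < rho ->
  coefnorm rho (iter m (divX z) p) <= coefnorm rho p / (rho - N z) ^+ m.
Proof.
move=> zr; have r0 : 0 < rho - N z by rewrite subr_gt0.
elim: m => [|m ih]; first by rewrite expr0 divr1.
rewrite iterS (le_trans (coefnorm_divX_le _ zr))// exprSr invfM mulrA.
by rewrite ler_pM2r ?invr_gt0.
Qed.

(* If h vanished to infinite order at z, the m-th quotients of the approximating
   polynomials would be O((rho - |z|)^-m), so |h k| <= M / 2^m for every m once
   rho - |z| >= 2 |k - z|. *)
Lemma entire_order h z : entire h ->
  (forall k, h k = 0) \/
  exists m g, [/\ entire g, g z != 0 & forall k, h k = (k - z) ^+ m * g k].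
Proof.
move=> [P cP lP].
pose S m g := poly_limit (divXs z m P) g /\ forall k, h k = (k - z) ^+ m * g k.
have [[m [g [[lg hg] gz]]]|NS] := pselect (exists m g, S m g /\ g z != 0).
  by right; exists m, g; split => //; exists (divXs z m P) => //;
    exact: poly_cauchy_divXs.
left; have {}NS m g : S m g -> g z = 0.
  by move=> Smg; apply/eqP/negPn/negP => gz; apply: NS; exists m, g.
have allS m : exists g, S m g.
  elim: m => [|m [g Sg]]; first by exists h; split => // k; rewrite mul1r.
  have [lg hg] := Sg.
  have [g' lg' hg'] := poly_limit_divX z (poly_cauchy_divXs z m cP) lg.
  exists g'; split=> // k; rewrite hg hg' (NS _ _ Sg) add0r mulrA.
  by rewrite -exprSr.
move=> k; pose rho := N z + N k + 2 * N (k - z) + 1.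
have ? := normc_ge0 z; have ? := normc_ge0 k; have ? := normc_ge0 (k - z).
have r0 : 0 < rho by rewrite /rho; lra.
have [M [n1 [M0 hM]]] := poly_cauchy_bounded cP r0.
have d0 : 0 < rho - N z by rewrite /rho; lra.
have bound m : N (h k) <= 2 * (M * 2^-1 ^+ m).
  have [g [lg hg]] := allS m.
  pose e := M / (rho - N z) ^+ m.
  have e0 : 0 < e by rewrite divr_gt0// exprn_gt0.
  have [n0 hn0] := lg k e e0; pose n := maxn n0 n1.
  have gk : N (g k) <= 2 * e.
    have := hn0 n (leq_maxl _ _); rewrite normc_distC.
    have := ler_distD_normc (g k) (divXs z m P n).[k].
    have kr : N k <= rho by rewrite /rho; lra.
    have := coefnorm_horner (divXs z m P n) kr.
    have zr : N z < rho by rewrite -subr_gt0.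
    have := coefnorm_divXs_le m (P n) zr.
    have := hM n (leq_maxr _ _); rewrite -(ler_pM2r (_ : 0 < ((rho - N z) ^+ m)^-1)).
      rewrite -/e /divXs; lra.
    by rewrite invr_gt0 exprn_gt0.
  rewrite hg Normc.normcM normcX.
  apply: le_trans (ler_wpM2l _ gk) _; first by rewrite exprn_ge0// normc_ge0.
  rewrite mulrCA ler_pM2l// /e mulrCA ler_pM2l// -exprVn -exprMn.
  apply: lerXn2r; rewrite ?nnegrE ?mulr_ge0 ?invr_ge0 ?(ltW d0)//.
  rewrite ler_pdivrMr// /rho; lra.
apply: normc_ltP => e e0.
have c0 : 2^-1 ^+ m @[m --> \oo] --> (0 : R).
  by apply: cvg_expr; rewrite ger0_norm; lra.
have e1 : 0 < e / (2 * M) by rewrite divr_gt0// mulr_gt0.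
move/cvgrPdist_le : c0 => /(_ _ e1)[m _ /(_ m (leqnn m))] /=.
rewrite sub0r normrN ger0_norm ?exprn_ge0// => hm.
apply: le_trans (bound m) _.
by rewrite mulrA mulrC -ler_pdivlMr// mulr_gt0.
Qed.

(** A zero of finite order is isolated, whereas 1 is a limit of the zeros 1 + d. This is how
    identities between data, known for k > 0, pass to all complex k. *)
Lemma entire_eq0 h : entire h -> (forall x : R, 0 < x -> h x%:C = 0) ->
  forall k, h k = 0.
Proof.
move=> eh h0; have [//|[m [g [eg g1 hg]]]] := entire_order 1 eh.
exfalso; have [d d0 hd] := entire_neq0_near eg g1.
have xd : N ((1 + d)%:C - 1) <= d.
  have -> : (1 + d)%:C - 1 = d%:C :> C by rewrite rmorphD rmorph1 addrC addKr.
  by rewrite normc_real ger0_norm// ltW.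
have := h0 (1 + d) (addr_gt0 ltr01 d0); rewrite hg => /eqP.
rewrite mulf_eq0 (negbTE (hd _ xd)) orbF expf_eq0.
rewrite rmorphD rmorph1 addrC addKr => /andP[_].
by rewrite -(rmorph0 (real_complex R)) (inj_eq (@complexI R)) gt_eqF.
Qed.

Lemma entire_eq0_dense h z : entire h -> (forall k, k != z -> h k = 0) -> h z = 0.
Proof.
move=> eh h0; apply: normc_ltP => e e0.
have [d d0 hd] := entire_continuous z eh e0.
have k0 : z + d%:C != z.
  rewrite -subr_eq0 addrC addKr -(rmorph0 (real_complex R)).
  by rewrite (inj_eq (@complexI R)) gt_eqF.
have Nk : N (z + d%:C - z) = d by rewrite addrC addKr normc_real gtr0_norm.
by have := hd (z + d%:C); rewrite Nk (h0 _ k0) sub0r normcN; exact.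
Qed.

(* Along a direction in which (k - z)^m g(z) is a positive multiple of d Q(z),
   the quotient P / Q = d (1 + t^m (1 + o(1))) has modulus larger than |d|. *)
Lemma max_modulus (P Q : C -> C) d z : entire P -> entire Q ->
  Q z != 0 -> P z = d * Q z -> (forall k, N (P k) <= N d * N (Q k)) ->
  forall k, P k = d * Q k.
Proof.
move=> eP eQ Qz Pz PQ.
have eh : entire (fun k => P k - d * Q k).
  by apply: entireB => //; apply: entireM => //; exact: entire_cst.
suff H : forall k, P k - d * Q k = 0.
  by move=> k; apply/eqP; rewrite -subr_eq0 H.
have [//|[m [g [eg gz hg]]]] := entire_order z eh; exfalso.
have m0 : (0 < m)%N.
  rewrite lt0n; apply/eqP => m0; have := hg z.
  by rewrite Pz subrr m0 expr0 mul1r => /esym/eqP; rewrite (negbTE gz).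
(* If d = 0, the bound already forces P = 0 everywhere, against the nonvanishing of [g] near z. *)
have [d0|d0] := eqVneq d 0.
  have [r r0 hr] := entire_neq0_near eg gz.
  have zrE : z + r%:C - z = r%:C by rewrite addrC addKr.
  have zr : N (z + r%:C - z) <= r by rewrite zrE normc_real gtr0_norm.
  have := PQ (z + r%:C); rewrite d0 Normc.normc0 mul0r => P0.
  have {P0} /eqP : N (P (z + r%:C)) = 0 by apply/eqP; rewrite eq_le P0 normc_ge0.
  rewrite normc_eq0 => /eqP P0.
  have := hg (z + r%:C); rewrite P0 d0 mul0r subrr => /esym/eqP.
  rewrite mulf_eq0 (negbTE (hr _ zr)) orbF expf_eq0 m0 zrE/=.
  by rewrite -(rmorph0 (real_complex R)) (inj_eq (@complexI R)) gt_eqF.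
pose c := d * Q z / g z.
have c0 : c != 0 by rewrite mulf_neq0 ?mulf_neq0 ?invr_eq0.
have [zeta zetam] : exists zeta : C, zeta ^+ m = c.
  by exists (m.-root c); rewrite rootCK.
have eF : entire (fun k => c * g k - d * Q k).
  by apply: entireB; apply: entireM => //; exact: entire_cst.
(* Let B = |d Q(z)|. At k = z + t zeta one has P(k) = (1 + t^m) d Q(k) + t^m F, where F = c g(k) - d
   Q(k) vanishes at z. With |F| <= B / 4 and |d Q(k)| >= 3 B / 4, the modulus of P(k) exceeds that
   of d Q(k). *)
have e0 : 0 < N (d * Q z) / 4 by rewrite divr_gt0// normc_gt0 mulf_neq0.
have [r1 r10 hr1] := entire_continuous z eF e0.
have edQ : entire (fun k => d * Q k) by apply: entireM => //; exact: entire_cst.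
have [r2 r20 hr2] := entire_continuous z edQ e0.
have z0 : zeta != 0.
  by apply: contraNneq c0 => E; rewrite -zetam E expr0n gtn_eqF.
have Nz0 : 0 < N zeta by rewrite normc_gt0.
pose t := Num.min r1 r2 / N zeta.
have t0 : 0 < t by rewrite divr_gt0// lt_min r10.
pose k := z + t%:C * zeta.
have kzE : k - z = t%:C * zeta by rewrite /k addrC addKr.
have kz : N (k - z) = Num.min r1 r2.
  rewrite kzE Normc.normcM normc_real gtr0_norm// /t.
  by rewrite divfK// gt_eqF.
have := hr1 k; rewrite kz ge_min lexx => /(_ isT).
have -> : c * g z - d * Q z = 0 by rewrite /c divfK// subrr.
rewrite subr0; set F := c * g k - d * Q k => HF.
have := hr2 k; rewrite kz ge_min lexx orbT => /(_ isT) HQ.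
have tm0 : 0 < t ^+ m by rewrite exprn_gt0.
have E : P k = d * Q k + (t ^+ m)%:C * (d * Q k + F).
  have := hg k; rewrite kzE exprMn zetam -rmorphXn/= => Hk.
  rewrite -[P k](subrK (d * Q k)) Hk /F; ring.
have E' : P k = (1 + t ^+ m)%:C * (d * Q k) + (t ^+ m)%:C * F.
  by rewrite E rmorphD rmorph1; ring.
have := PQ k; rewrite -Normc.normcM.
have := ler_distD_normc ((1 + t ^+ m)%:C * (d * Q k)) (- ((t ^+ m)%:C * F)).
rewrite opprK -E' normcN 2!(Normc.normcM (_ %:C)) !normc_real.
rewrite !gtr0_norm ?addr_gt0//.
have := ler_distD_normc (d * Q z) (d * Q k); rewrite normc_distC.
have := e0; move: HF HQ; set A := N (d * Q k); set B := N (d * Q z) => HF HQ B0 H1 H2 H3.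
have A0 : B / 2 < A by lra.
have : t ^+ m * N F <= t ^+ m * (B / 4) by rewrite ler_pM2l.
have : t ^+ m * (B / 2) < t ^+ m * A by rewrite ltr_pM2l.
have : 0 < t ^+ m * B by rewrite mulr_gt0//; lra.
nra.
Qed.

Lemma entire_normc_continuous h (p : R * R) : entire h ->
  {for p, continuous (fun p : R * R => N (h (p.1 +i* p.2)))}.
Proof.
move=> eh; apply/cvgrPdist_le => /= e e0.
have [d d0 hd] := entire_continuous (p.1 +i* p.2) eh e0.
have d2 : 0 < d / 2 by lra.
have /cvgrPdist_le/(_ _ d2) c1 : q.1 @[q --> p] --> p.1.
  by case: (p) => a b; exact: cvg_fst.
have /cvgrPdist_le/(_ _ d2) c2 : q.2 @[q --> p] --> p.2.
  by case: (p) => a b; exact: cvg_snd.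
near=> q.
have H1 : `|p.1 - q.1| <= d / 2 by near: q; exact: c1.
have H2 : `|p.2 - q.2| <= d / 2 by near: q; exact: c2.
have : N ((q.1 +i* q.2) - (p.1 +i* p.2)) <= d.
  rewrite normc_distC [X in N X]complexE.
  apply: le_trans (le_normcD _ _) _; rewrite Normc.normcM normc_i mul1r.
  by rewrite !normc_real /=; lra.
move=> /hd; apply: le_trans.
rewrite ler_norml.
have := ler_distD_normc (h (q.1 +i* q.2)) (h (p.1 +i* p.2)).
have := ler_distD_normc (h (p.1 +i* p.2)) (h (q.1 +i* q.2)).
rewrite [in X in X -> _]normc_distC; lra.
Unshelve. all: by end_near. Qed.

(** If P(x) is nonzero for some x > 0, the decay of P/Q confines the search for a maximum of |P/Q|
    in the upper half-plane to a rectangle containing x. Evenness of the modulus makes this maximum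
    global, so P = d Q by the maximum principle, with d nonzero, against the decay. *)
Lemma liouville_quotient (P Q : C -> C) : entire P -> entire Q ->
  (forall k, 0 <= complex.Im k -> Q k != 0) ->
  (forall k, N (P k) * N (Q (- k)) = N (P (- k)) * N (Q k)) ->
  (forall e, 0 < e -> exists K, forall k, 0 <= complex.Im k -> K <= N k ->
     N (P k) <= e * N (Q k)) ->
  forall k, P k = 0.
Proof.
move=> eP eQ Q0 PQ lim.
have QN k : 0 <= complex.Im k -> 0 < N (Q k) by move=> /Q0; rewrite normc_gt0.
apply: entire_eq0 => // x x0; apply/eqP/negPn/negP => Px.
have Ix : 0 <= complex.Im x%:C by [].
pose F (p : R * R) := N (P (p.1 +i* p.2)) / N (Q (p.1 +i* p.2)).
have F0 : 0 < F (x, 0) by rewrite divr_gt0 ?QN// normc_gt0.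
have e0 : 0 < F (x, 0) / 2 by lra.
have [K hK] := lim _ e0.
pose L := Num.max K x.
have xL : x <= L by rewrite le_max lexx orbT.
have KL : K <= L by rewrite le_max lexx.
pose A := `[- L, L]%classic `*` `[0, L]%classic : set (R * R).
have cA : compact A by apply: compact_setX; exact: segment_compact.
have Ax : A (x, 0).
  split => /=; rewrite in_itv/=; lra.
have cF : {within A, continuous F}.
  apply: continuous_in_subspaceT => p; rewrite inE => -[_ /=].
  rewrite in_itv/= => /andP[p2 _].
  have c1 := @entire_normc_continuous P p eP; have c2 := @entire_normc_continuous Q p eQ.
  apply: (continuousM c1); apply: continuousV c2.
  by rewrite gt_eqF// QN.
have [|p /set_mem Ap hp] := compact_EVT_max _ cA cF; first by exists (x, 0).
pose z := p.1 +i* p.2.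
have Iz : 0 <= complex.Im z by case: Ap => _ /=; rewrite in_itv/= => /andP[].
have hx : F (x, 0) <= F p by apply: hp; rewrite inE.
pose d := P z / Q z.
have Nd : N d = F p by rewrite /d Normc.normcM Normc.normcV.
have maxU k : 0 <= complex.Im k -> N (P k) <= N d * N (Q k).
  move=> Ik; rewrite Nd; have [Kk|kK] := leP K (N k).
    apply: le_trans (hK k Ik Kk) _; rewrite ler_pM2r ?QN//; lra.
  have Ak : A (complex.Re k, complex.Im k).
    have := ge_Re_normc k; have := ge_Im_normc k; rewrite !ler_norml.
    by split => /=; rewrite in_itv/=; lra.
  have := hp _ (mem_set Ak); rewrite /F/=.
  have -> : complex.Re k +i* complex.Im k = k by case: (k).
  by rewrite -/(F p) ler_pdivrMr ?QN.
(* [Q] may vanish below the real axis, so the evenness relation is used in multiplied form, with the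
   nonzero factor Q(-k). *)
have maxC k : N (P k) <= N d * N (Q k).
  have [|Ik] := leP 0 (complex.Im k); first exact: maxU.
  have Ik' : 0 <= complex.Im (- k) by case: (k) Ik => a b /=; lra.
  rewrite -(ler_pM2r (QN _ Ik')) PQ.
  apply: le_trans (ler_wpM2r (normc_ge0 _) (maxU _ Ik')) _.
  by rewrite mulrAC.
have E := max_modulus eP eQ (Q0 _ Iz) (_ : P z = d * Q z) maxC.
have {}E : forall k, P k = d * Q k by apply: E; rewrite /d divfK ?Q0.
have d2 : 0 < N d / 2 by rewrite Nd; lra.
have [K' hK'] := lim _ d2.
have IK : 0 <= complex.Im ((`|K'|)%:C : C) by [].
have := hK' (`|K'|)%:C IK; rewrite normc_real normr_id ler_norm => /(_ isT).
rewrite E Normc.normcM ler_pM2r ?QN//; lra.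
Qed.

Lemma entire_eq0_near0 h : entire h ->
  (exists C, forall x : R, 0 < x <= 1 -> N (h x%:C) <= C * x) -> h 0 = 0.
Proof.
move=> eh [M hM]; apply: normc_ltP => e e0.
have e2 : 0 < e / 2 by lra.
have [d d0 hd] := entire_continuous 0 eh e2.
have M1 : 0 < `|M| + 1 by rewrite ltr_wpDl.
pose x := Num.min (Num.min d 1) (e / 2 / (`|M| + 1)).
have x0 : 0 < x by rewrite !lt_min d0 ltr01 divr_gt0.
have xd : x <= d by rewrite !ge_min lexx.
have x1 : x <= 1 by rewrite !ge_min lexx !orbT.
have xe : x * (`|M| + 1) <= e / 2 by rewrite -ler_pdivlMr// ge_min lexx orbT.
have := hd x%:C; rewrite subr0 normc_real gtr0_norm// => /(_ xd).
have := hM x; rewrite x0 x1 => /(_ isT).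
have := ler_distD_normc (h 0) (h x%:C); rewrite normc_distC.
have : M * x <= x * (`|M| + 1).
  by rewrite mulrC ler_pM2l// (le_trans (ler_norm M))// lerDl.
lra.
Qed.

(** Subtracting from P/Q its value at 0 and dividing by k gives an odd quotient, hence one of even
    modulus, and the bound o(|k|) on P/Q makes it tend to 0. *)
Lemma even_quotient_cst_neq0 (P Q : C -> C) : entire P -> entire Q ->
  (forall k, 0 <= complex.Im k -> Q k != 0) ->
  (forall k, P k * Q (- k) = P (- k) * Q k) ->
  (forall e, 0 < e -> exists K, forall k, 0 <= complex.Im k -> K <= N k ->
     N (P k) <= e * N k * N (Q k)) ->
  exists c, forall k, P k = c * Q k.
Proof.
move=> eP eQ Q0 PQ lim; pose c := P 0 / Q 0; exists c => k.
have Q00 : Q 0 != 0 by exact: Q0.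
have eh : entire (fun k => P k - c * Q k).
  by apply: entireB => //; apply: entireM => //; exact: entire_cst.
have [g eg hg] := entire_div 0 eh.
have {}hg z : P z - c * Q z = z * g z.
  by rewrite hg /c divfK// subrr add0r subr0.
suff g0 : forall k, g k = 0.
  by apply/eqP; rewrite -subr_eq0 hg g0 mulr0.
apply: (liouville_quotient eg eQ Q0) => [z|e e0].
  have [->|z0] := eqVneq z 0; first by rewrite oppr0.
  have Nz : 0 < N z by rewrite normc_gt0.
  apply: (mulfI (lt0r_neq0 Nz)); rewrite -{2}(normcN z) !mulrA -!Normc.normcM.
  rewrite -!hg !mulrBl PQ; congr (N (_ - _)); ring.
have Nc := normc_ge0 c.
have e2 : 0 < e / 2 by lra.
have [K hK] := lim _ e2.
exists (Num.max (Num.max K 1) (2 * N c / e)) => z Iz.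
rewrite !ge_max => /andP[/andP[Kz z1]]; rewrite ler_pdivrMr// => cz.
have Nz : 0 < N z by lra.
rewrite -(ler_pM2l Nz) -Normc.normcM -hg.
apply: le_trans (le_normcB _ _) _; rewrite Normc.normcM.
have := hK z Iz Kz; have NQ := normc_ge0 (Q z).
have := ler_wpM2r NQ cz; lra.
Qed.

(* The evenness of P/Q excludes the simple pole at 0 that the bound leaves open. *)
Lemma even_quotient_cst (P Q : C -> C) : entire P -> entire Q ->
  (forall k, 0 <= complex.Im k -> k != 0 -> Q k != 0) ->
  (forall k, P k * Q (- k) = P (- k) * Q k) ->
  (exists M, forall x : R, 0 < x <= 1 -> x * N (P x%:C) <= M * N (Q x%:C)) ->
  (forall e, 0 < e -> exists K, forall k, 0 <= complex.Im k -> K <= N k ->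
     N (P k) <= e * N k * N (Q k)) ->
  exists c, forall k, P k = c * Q k.
Proof.
move=> eP eQ Q0 PQ near0 lim.
have [Q00|[b [Q1 [eQ1 Q10 hQ]]]] := entire_order 0 eQ.
  have I1 : 0 <= complex.Im (1 : C) by [].
  by have := Q0 1 I1 (oner_neq0 _); rewrite Q00 eqxx.
have [P0|[a [P1 [eP1 P10 hP]]]] := entire_order 0 eP.
  by exists 0 => k; rewrite mul0r.
have {}hQ k : Q k = k ^+ b * Q1 k by rewrite hQ subr0.
have {}hP k : P k = k ^+ a * P1 k by rewrite hP subr0.
have Q1neq0 k : 0 <= complex.Im k -> Q1 k != 0.
  have [->//|k0 Ik] := eqVneq k 0.
  by have := Q0 k Ik k0; rewrite hQ mulf_eq0 => /norP[].
have PQ1 k : k != 0 -> (-1) ^+ b * (P1 k * Q1 (- k)) =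
    (-1) ^+ a * (P1 (- k) * Q1 k).
  move=> k0; have := PQ k; rewrite !hP !hQ !(exprNn k) => H.
  have ka : k ^+ a * k ^+ b != 0 by rewrite mulf_neq0 ?expf_neq0.
  apply: (mulfI ka); move: H; set x := k ^+ a; set y := k ^+ b => H.
  transitivity (x * P1 k * ((-1) ^+ b * y * Q1 (- k))); first by ring.
  by rewrite H; ring.
have [ba|ab] := leqP b a.
  pose P2 k := k ^+ (a - b) * P1 k.
  have hP2 k : P k = k ^+ b * P2 k by rewrite /P2 mulrA -exprD subnKC.
  have eP2 : entire P2 by apply: entireM => //; exact: entireX.
  have [k|e e0|c hc] := even_quotient_cst_neq0 eP2 eQ1 Q1neq0.
  - have [->|k0] := eqVneq k 0; first by rewrite oppr0.
    have kb : k ^+ b * ((-1) ^+ b * k ^+ b) != 0.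
      by rewrite !mulf_neq0 ?expf_neq0// oppr_eq0 oner_eq0.
    apply: (mulfI kb); have := PQ k; rewrite !hP2 !hQ !(exprNn k) => H.
    transitivity (k ^+ b * P2 k * ((-1) ^+ b * k ^+ b * Q1 (- k))); first by ring.
    by rewrite H; ring.
  - have [K hK] := lim _ e0; exists (Num.max K 1) => k Ik.
    rewrite ge_max => /andP[/(hK k Ik) + k1].
    rewrite hP2 hQ !Normc.normcM [X in _ <= X]mulrCA => H.
    have Nb : 0 < N (k ^+ b) by rewrite normcX exprn_gt0//; lra.
    by move: H; rewrite ler_pM2l.
  - by exists c => k; rewrite hP2 hc hQ mulrCA.
exfalso; have [M hM] := near0.
have [M1 M10 hM1] := entire_bounded 1 eQ1.
have bound (x : R) : 0 < x <= 1 -> x * N (P1 x%:C) <= `|M| * M1 * x ^+ (b - a).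
  move=> /[dup] x01 /andP[x0 x1]; have := hM x x01.
  rewrite hP hQ !Normc.normcM !normcX !normc_real gtr0_norm// => H.
  have xa : 0 < x ^+ a by rewrite exprn_gt0.
  rewrite -(ler_pM2l xa) mulrCA; apply: le_trans H _.
  have -> : x ^+ a * (`|M| * M1 * x ^+ (b - a)) = `|M| * (x ^+ b * M1).
    rewrite mulrCA -exprD subnKC ?(ltnW ab)//; ring.
  apply: le_trans (ler_wpM2r _ (ler_norm M)) _.
    by rewrite mulr_ge0 ?exprn_ge0 ?(ltW x0)// normc_ge0.
  rewrite ler_wpM2l// ler_wpM2l ?exprn_ge0 ?(ltW x0)//.
  by apply: hM1; rewrite normc_real gtr0_norm.
(* If b - a is odd, then P1/Q1 is odd and P1(0) Q1(0) = 0. If b - a is even, it is at least 2, and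
   the bound near 0 gives P1(x) = O(x), so P1(0) = 0. Both contradict the choice of the orders a and
   b. *)
have [odd_ba|even_ba] := boolP (odd (b - a)).
  pose G k := P1 k * Q1 (- k) + P1 (- k) * Q1 k.
  have eG : entire G.
    by apply: entireD; apply: entireM => //; exact: entire_comp_opp.
  have : G 0 = 0.
    apply: entire_eq0_dense => // k k0; rewrite /G.
    have := PQ1 k k0; rewrite -(subnKC (ltnW ab)) exprD -mulrA.
    have s0 : (-1) ^+ a != 0 :> C by rewrite expf_neq0// oppr_eq0 oner_eq0.
    move=> /(mulfI s0); rewrite -signr_odd odd_ba expr1 mulN1r => <-.
    exact: subrr.
  rewrite /G oppr0 -mulr2n => /eqP; rewrite mulrn_eq0/=.
  by rewrite mulf_eq0 (negbTE P10) (negbTE Q10).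
move/negP : P10; apply; apply/eqP/entire_eq0_near0 => //.
exists (`|M| * M1) => x x01; have [x0 x1] := andP x01.
rewrite -(ler_pM2l x0); apply: le_trans (bound x x01) _.
rewrite mulrCA ler_wpM2l//; first by rewrite mulr_ge0// ltW.
have : (1 < b - a)%N.
  by have := even_ba; rewrite -subn_gt0 in ab; case: (b - a)%N ab => [|[]].
move=> ba; rewrite -expr2; apply: ler_wiXn2l => //; exact: ltW.
Qed.

End Liouville.

(** * The Schroedinger equation *)

Section ComplexPrimitive.
Context {R : realType}.
Local Notation C := R[i].
Local Notation N z := (Normc.normc z).
Implicit Types (F G f g y z : R -> C) (q : R -> R) (k c : C) (x a b : R).

Lemma ReD (u v : C) : complex.Re (u + v) = complex.Re u + complex.Re v.
Proof. by case: u v => [? ?] []. Qed.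

Lemma ImD (u v : C) : complex.Im (u + v) = complex.Im u + complex.Im v.
Proof. by case: u v => [? ?] []. Qed.

Lemma ReM (u v : C) : complex.Re (u * v) =
  complex.Re u * complex.Re v - complex.Im u * complex.Im v.
Proof. by case: u v => [? ?] []. Qed.

Lemma ImM (u v : C) : complex.Im (u * v) =
  complex.Re u * complex.Im v + complex.Im u * complex.Re v.
Proof. by case: u v => [? ?] []. Qed.

Lemma eq_ReIm (u v : C) :
  complex.Re u = complex.Re v -> complex.Im u = complex.Im v -> u = v.
Proof. by case: u v => [? ?] [? ?] /= -> ->. Qed.

Definition cprimitive F f :=
  primitive (rpart F) (rpart f) /\ primitive (ipart F) (ipart f).

Lemma cprimitive_eq F f G g : cprimitive F f -> F =1 G -> f =1 g ->
  cprimitive G g.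
Proof. by move=> + /funext <- /funext <-. Qed.

Lemma cprimitiveD F f G g : cprimitive F f -> cprimitive G g ->
  cprimitive (fun x => F x + G x) (fun x => f x + g x).
Proof.
move=> [rF iF] [rG iG]; split.
  by apply: primitive_eq (primitiveD rF rG) _ _ => x; rewrite /rpart ReD.
by apply: primitive_eq (primitiveD iF iG) _ _ => x; rewrite /ipart ImD.
Qed.

Lemma cprimitiveM F f G g : cprimitive F f -> cprimitive G g ->
  cprimitive (fun x => F x * G x) (fun x => f x * G x + F x * g x).
Proof.
move=> [rF iF] [rG iG]; split.
  apply: primitive_eq (primitiveB (primitiveM rF rG) (primitiveM iF iG)) _ _ => x;
    rewrite /rpart /ipart ?ReD !ReM//; ring.
apply: primitive_eq (primitiveD (primitiveM rF iG) (primitiveM iF rG)) _ _ => x;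
  rewrite /rpart /ipart ?ImD !ImM//; ring.
Qed.

Lemma cprimitive_cst c : cprimitive (fun=> c) (fun=> 0).
Proof. by split; exact: primitive_cst. Qed.

Lemma cprimitiveZ c F f : cprimitive F f ->
  cprimitive (fun x => c * F x) (fun x => c * f x).
Proof.
move=> /(cprimitiveM (cprimitive_cst c)) /cprimitive_eq; apply => // x.
by rewrite mul0r add0r.
Qed.

Lemma cprimitiveN F f : cprimitive F f ->
  cprimitive (fun x => - F x) (fun x => - f x).
Proof.
by move=> /(cprimitiveZ (-1)) /cprimitive_eq; apply => x; rewrite mulN1r.
Qed.

Lemma cprimitiveB F f G g : cprimitive F f -> cprimitive G g ->
  cprimitive (fun x => F x - G x) (fun x => f x - g x).
Proof. by move=> hF /cprimitiveN; exact: cprimitiveD. Qed.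

Lemma cprimitive_real (F f : R -> R) : primitive F f ->
  cprimitive (fun x => (F x)%:C) (fun x => (f x)%:C).
Proof. by move=> hF; split => //; exact: primitive_cst. Qed.

Lemma cprimitive_conj F f : cprimitive F f ->
  cprimitive (fun x => (F x)^*) (fun x => (f x)^*).
Proof.
move=> [rF iF]; split.
  by apply: primitive_eq rF _ _ => x; rewrite /rpart; first [by case: (F x)|by case: (f x)].
apply: primitive_eq (primitiveN iF) _ _ => x;
  by rewrite /ipart; first [by case: (F x)|by case: (f x)].
Qed.

Lemma cprimitive_reflect a F f : cprimitive F f ->
  cprimitive (fun x => F (a - x)) (fun x => - f (a - x)).
Proof.
move=> [rF iF]; split.
  apply: primitive_eq (primitive_reflect a rF) _ _ => x //.
  by rewrite /rpart; case: (f _).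
apply: primitive_eq (primitive_reflect a iF) _ _ => x //.
by rewrite /ipart; case: (f _).
Qed.

Lemma cprimitive_sum n (F f : 'I_n -> R -> C) :
  (forall i, cprimitive (F i) (f i)) ->
  cprimitive (fun x => \sum_i F i x) (fun x => \sum_i f i x).
Proof.
elim: n F f => [|n ih] F f H.
  apply: cprimitive_eq (cprimitive_cst 0) _ _ => x; by rewrite big_ord0.
have := cprimitiveD (ih _ _ (fun i => H (widen_ord (leqnSn n) i))) (H ord_max).
by move=> /cprimitive_eq; apply => x; rewrite big_ord_recr.
Qed.

Lemma primitive0_cst (F : R -> R) a b : primitive F (fun=> 0) -> F a = F b.
Proof.
move=> hF; wlog ab : a b / a <= b => [H|].
  by have [/H//|/ltW/H] := leP a b.
have H0 t : a <= t <= b -> `|0 : R| <= 0 by rewrite normr0.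
have := primitive_lipschitz hF ab H0.
by rewrite mul0r normr_le0 subr_eq0 eq_sym => /eqP.
Qed.

Lemma cprimitive0_cst F a b : cprimitive F (fun=> 0) -> F a = F b.
Proof.
by move=> [/(primitive0_cst a b) rF /(primitive0_cst a b) iF]; exact: eq_ReIm.
Qed.

Definition schrodinger q k y y' :=
  cprimitive y y' /\ cprimitive y' (fun x => ((q x)%:C - k ^+ 2) * y x).

Lemma wronskian_cst q k y y' z z' a b :
  schrodinger q k y y' -> schrodinger q k z z' ->
  y a * z' a - y' a * z a = y b * z' b - y' b * z b.
Proof.
move=> [hy hy'] [hz hz'].
apply: (@cprimitive0_cst (fun x => y x * z' x - y' x * z x)).
apply: cprimitive_eq (cprimitiveB (cprimitiveM hy hz') (cprimitiveM hy' hz)) _ _.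
  by [].
by move=> x /=; ring.
Qed.

Lemma schrodingerD q k y y' z z' : schrodinger q k y y' -> schrodinger q k z z' ->
  schrodinger q k (fun x => y x + z x) (fun x => y' x + z' x).
Proof.
move=> [hy hy'] [hz hz']; split; first exact: cprimitiveD.
by apply: cprimitive_eq (cprimitiveD hy' hz') _ _ => // x; rewrite mulrDr.
Qed.

Lemma schrodingerZ q k c y y' : schrodinger q k y y' ->
  schrodinger q k (fun x => c * y x) (fun x => c * y' x).
Proof.
move=> [hy hy']; split; first exact: cprimitiveZ.
by apply: cprimitive_eq (cprimitiveZ c hy') _ _ => // x; rewrite mulrCA.
Qed.

Lemma schrodinger_reflect a q k y y' : schrodinger q k y y' ->
  schrodinger (fun x => q (a - x)) k (fun x => y (a - x)) (fun x => - y' (a - x)).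
Proof.
move=> [hy hy']; split; first exact: cprimitive_reflect.
apply: cprimitive_eq (cprimitiveN (cprimitive_reflect a hy')) _ _ => // x.
by rewrite opprK.
Qed.

End ComplexPrimitive.

(** * Locally uniform limits of primitives, and factorial estimates *)

Section UniformLimits.
Context {R : realType}.
Local Notation C := R[i].
Local Notation N z := (Normc.normc z).

Definition uniform_limit {T : Type} (dist : T -> T -> R) (F_ : nat -> R -> T)
    (F : R -> T) :=
  forall L e : R, 0 < e -> exists n0, forall n x, (n0 <= n)%N -> `|x| <= L ->
    dist (F_ n x) (F x) <= e.

Definition uniform_limitR := uniform_limit (fun u v : R => `|u - v|).
Definition uniform_limitC := uniform_limit (fun u v : C => N (u - v)).

Lemma uniform_limit_continuous (F_ : nat -> R -> R) F :
  (forall n, continuous (F_ n)) -> uniform_limitR F_ F -> continuous F.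
Proof.
move=> cF uF x; apply/cvgrPdist_le => /= e e0.
have e3 : 0 < e / 3 by lra.
have [n hn] := uF (`|x| + 1) _ e3.
have /cvgrPdist_le/(_ _ e3) := cF n x.
move=> cn; near=> y.
have H1 : `|F_ n x - F_ n y| <= e / 3 by near: y; exact: cn.
have yx1 : `|x - y| < 1 by near: y; apply: cvgr_dist_lt.
have xL : `|x| <= `|x| + 1 by lra.
have yL : `|y| <= `|x| + 1.
  by have := ler_distD x 0 y; rewrite !sub0r !normrN; lra.
have := hn n x (leqnn n) xL; have := hn n y (leqnn n) yL.
move: H1; rewrite !ler_norml; lra.
Unshelve. all: by end_near. Qed.

Lemma primitive_limit (F_ f_ : nat -> R -> R) F f :
  (forall n, primitive (F_ n) (f_ n)) -> locally_bounded f ->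
  uniform_limitR F_ F -> uniform_limitR f_ f -> primitive F f.
Proof.
move=> hF lf uF uf; have hH := primitive_integral0 lf.
set H := integral0 f in hH; split => // a b ab; case: hH (hH) => _ <-// hH.
apply/eqP; rewrite -subr_eq0 -normr_le0; apply/ler_addgt0Pr => e e0; rewrite add0r.
have e3 : 0 < e / 3 by lra.
have e4 : 0 < e / 3 / (b - a + 1) by rewrite divr_gt0//; lra.
have [n hn] := uF (`|a| + `|b|) _ e3.
have [m hm] := uf (`|a| + `|b|) _ e4.
pose p := maxn n m.
have P := primitive_lipschitz (primitiveB (hF p) hH) ab.
have {}P := P (e / 3 / (b - a + 1)) _.
have {}P : `|F_ p b - H b - (F_ p a - H a)| <= e / 3 / (b - a + 1) * (b - a).
  apply: P => t tab; apply: hm; first exact: leq_maxr.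
  rewrite ler_norml; have := ler_norm b; have := ler_norm (- a).
  by rewrite normrN; have := normr_ge0 a; have := normr_ge0 b; lra.
have Q : e / 3 / (b - a + 1) * (b - a) <= e / 3.
  by rewrite -mulrA ler_piMr//; [lra|rewrite mulrC ler_pdivrMr; lra].
have La : `|a| <= `|a| + `|b| by rewrite lerDl.
have Lb : `|b| <= `|a| + `|b| by rewrite lerDr.
have := hn p a (leq_maxl _ _) La; have := hn p b (leq_maxl _ _) Lb.
by move: P; rewrite !ler_norml; lra.
Qed.

Lemma uniform_limit_rpart F_ F : uniform_limitC F_ F ->
  uniform_limitR (fun n => rpart (F_ n)) (rpart F).
Proof.
move=> uF L e e0; have [n0 hn] := uF L e e0; exists n0 => n x nn xL.
apply: le_trans (hn n x nn xL); apply: le_trans (ge_Re_normc _).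
by rewrite /rpart; case: (F_ n x) => ? ?; case: (F x).
Qed.

Lemma uniform_limit_ipart F_ F : uniform_limitC F_ F ->
  uniform_limitR (fun n => ipart (F_ n)) (ipart F).
Proof.
move=> uF L e e0; have [n0 hn] := uF L e e0; exists n0 => n x nn xL.
apply: le_trans (hn n x nn xL); apply: le_trans (ge_Im_normc _).
by rewrite /ipart; case: (F_ n x) => ? ?; case: (F x).
Qed.

Lemma cprimitive_limit F_ f_ F f :
  (forall n, cprimitive (F_ n) (f_ n)) -> locally_bounded (rpart f) ->
  locally_bounded (ipart f) ->
  uniform_limitC F_ F -> uniform_limitC f_ f -> cprimitive F f.
Proof.
move=> hF lr li uF uf; split.
  apply: (primitive_limit (fun n => (hF n).1) lr).
    exact: uniform_limit_rpart.
  exact: uniform_limit_rpart.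
apply: (primitive_limit (fun n => (hF n).2) li).
  exact: uniform_limit_ipart.
exact: uniform_limit_ipart.
Qed.

Lemma exp_tail (c e : R) : 0 <= c -> 0 < e -> exists n0, forall m n,
  (n0 <= m)%N -> (m <= n)%N -> \sum_(m <= i < n) c ^+ i / i`!%:R <= e.
Proof.
move=> c0 e0; have := is_cvg_series_exp_coeff c => /cvg_ex[l /cvgrPdist_le hl].
have e2 : 0 < e / 2 by lra.
have [n0 _ hn0] := hl _ e2; exists n0 => m n nm mn.
have -> : \sum_(m <= i < n) c ^+ i / i`!%:R =
    series (exp_coeff c) n - series (exp_coeff c) m.
  by rewrite sub_series_geq.
have /= := hn0 m nm; have /= := hn0 n (leq_trans nm mn).
rewrite !ler_norml; lra.
Qed.

Lemma primitive_exp n :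
  primitive (fun x : R => x ^+ n.+1) (fun x => n.+1%:R * x ^+ n).
Proof.
elim: n => [|n ih].
  by apply: primitive_eq (@primitive_id R) _ _ => x; rewrite ?expr1 ?expr0 ?mulr1.
apply: primitive_eq (primitiveM (@primitive_id R) ih) _ _ => x /=.
  by rewrite -exprS.
by rewrite mul1r mulrCA -exprS [n.+2%:R]mulrSr; ring.
Qed.

Lemma primitive_exp_bound (F f : R -> R) (M L : R) n : primitive F f -> F 0 = 0 ->
  (forall t, `|t| <= L -> `|f t| <= M * (`|t| ^+ n / n`!%:R)) ->
  forall x, `|x| <= L -> `|F x| <= M * (`|x| ^+ n.+1 / n.+1`!%:R).
Proof.
move=> hF F0 hf x.
wlog x0 : F f x hF F0 hf / 0 <= x => [H xL|xL].
  have [x0|x0] := leP 0 x; first exact: (H F f).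
  have F0' : F (0 - 0) = 0 by rewrite subr0.
  have hf' t : `|t| <= L -> `|- f (0 - t)| <= M * (`|t| ^+ n / n`!%:R).
    by have := hf (0 - t); rewrite !sub0r !normrN.
  have xL' : `|- x| <= L by rewrite normrN.
  have x0' : 0 <= - x by lra.
  have := H _ _ (- x) (primitive_reflect 0 hF) F0' hf' x0' xL'.
  by rewrite sub0r opprK normrN.
have fn0 : (n.+1`!%:R : R) != 0 by rewrite pnatr_eq0 -lt0n fact_gt0.
have fn1 : (n`!%:R : R) != 0 by rewrite pnatr_eq0 -lt0n fact_gt0.
have hG := primitiveZ (M / n.+1`!%:R) (primitive_exp n).
have E t : M / n.+1`!%:R * (n.+1%:R * t ^+ n) = M * (t ^+ n / n`!%:R).
  have n0 : n.+1%:R != 0 :> R by rewrite pnatr_eq0.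
  by rewrite factS natrM; move: n0 fn1; move: (n.+1%:R) (n`!%:R) => u v u0 v0; field; rewrite u0 v0.
have fb t : 0 <= t <= x -> `|f t| <= M * (t ^+ n / n`!%:R).
  move=> /andP[t0 tx]; rewrite -[in X in _ <= X](ger0_norm t0); apply: hf.
  by move: xL; rewrite !ger0_norm//; lra.
have H1 := primitive_le (primitiveB hG hF) x0 _.
have H2 := primitive_le (primitiveD hG hF) x0 _.
have {}H1 : F x <= M / n.+1`!%:R * x ^+ n.+1.
  rewrite -subr_ge0; apply: le_trans (H1 _); first by rewrite F0 expr0n/= mulr0 subr0.
  by move=> t /fb; rewrite E ler_norml; lra.
have {}H2 : 0 <= M / n.+1`!%:R * x ^+ n.+1 + F x.
  apply: le_trans (H2 _); first by rewrite F0 expr0n/= mulr0 addr0.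
  by move=> t /fb; rewrite E ler_norml; lra.
rewrite (ger0_norm x0) ler_norml; have -> : M * (x ^+ n.+1 / n.+1`!%:R) = M / n.+1`!%:R * x ^+ n.+1.
  by ring.
lra.
Qed.

Lemma coefnorm_poly_le m (E : nat -> R) (rho M : R) : 0 <= rho -> 0 <= M ->
  (forall j, `|E j| <= M) ->
  coefnorm rho (\poly_(j < m) (E j)%:C) <= m%:R * M * (1 + rho) ^+ m.
Proof.
move=> r0 M0 hE; rewrite (coefnormE rho (size_poly _ _)).
have -> : m%:R * M * (1 + rho) ^+ m = \sum_(j < m) M * (1 + rho) ^+ m.
  by rewrite sumr_const card_ord -[RHS]mulr_natl mulrA.
apply: ler_sum => j _; rewrite coef_poly ltn_ord normc_real.
apply: ler_pM; rewrite ?exprn_ge0//.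
apply: le_trans (_ : (1 + rho) ^+ j <= _).
  apply: lerXn2r; rewrite ?nnegrE; lra.
by apply: ler_weXn2l; [lra|exact: ltnW].
Qed.

End UniformLimits.

Local Ltac nonneg := repeat first [assumption | exact: ler0n
  | apply: exprn_ge0 | apply: mulr_ge0 | apply: addr_ge0 | rewrite invr_ge0
  | exact: normr_ge0].

(** * Solutions that are entire in k, by Picard iteration *)

Section Picard.
Context {R : realType} (q : R -> R) (sigma : R).
Context (lbq : locally_bounded q) (qs : forall x, `|q x| <= sigma) (a b : R).
Local Notation C := R[i].
Local Notation N z := (Normc.normc z).

(** The coefficient of k^j in (q - k^2) sum_j d_j k^j; the factor k^2 shifts the index by two. *)
Definition picard_source (d : nat -> R -> R) j x :=
  q x * d j x - (if j is j'.+2 then d j' x else 0).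

(* [picard n j] is the coefficient of [k ^ j] in the [n]-th Picard correction to
   the solution of [y'' = (q - k^2) y], [y 0 = a], [y' 0 = b]. *)
Fixpoint picard n : nat -> R -> R :=
  if n is n'.+1 then
    fun j => integral0 (integral0 (picard_source (picard n') j))
  else fun j x => if j is 0%N then a + b * x else 0.

Definition picard' n j := integral0 (picard_source (picard n) j).

Lemma picard_locally_bounded n j : locally_bounded (picard n j) /\
  locally_bounded (picard_source (picard n) j).
Proof.
have src d : (forall j, locally_bounded (d j)) ->
    locally_bounded (picard_source d j).
  move=> hd; apply: locally_boundedB; first exact: locally_boundedM.
  by case: j => [|[|j]]; [exact: locally_bounded_cst|exact: locally_bounded_cst|].
suff H m : forall i, locally_bounded (picard m i) by split; [|apply: src].
elim: m {src} => [|m ih] i.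
  case: i => [|i] /=; last exact: locally_bounded_cst.
  apply: (@primitive_locally_bounded _ _ (fun=> 0 + b * 1)).
  by apply: primitiveD; [exact: primitive_cst|apply/primitiveZ/primitive_id].
have src : locally_bounded (picard_source (picard m) i).
  apply: locally_boundedB; first exact: locally_boundedM.
  by case: i => [|[|i]]; [exact: locally_bounded_cst|exact: locally_bounded_cst|].
apply: (primitive_locally_bounded (primitive_integral0 _)).
exact: (primitive_locally_bounded (primitive_integral0 src)).
Qed.

Lemma primitive_picard' n j :
  primitive (picard' n j) (picard_source (picard n) j).
Proof. exact/primitive_integral0/(picard_locally_bounded n j).2. Qed.

Lemma primitive_picard n j : primitive (picard n.+1 j) (picard' n j).
Proof.
apply: primitive_integral0.
exact: (primitive_locally_bounded (primitive_picard' n j)).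
Qed.

Lemma integral0_zero (f : R -> R) x : (forall t, f t = 0) -> integral0 f x = 0.
Proof.
move=> f0; rewrite -(integral0_0 f); apply: primitive0_cst.
have -> : f = (fun=> 0) by apply/funext.
exact/primitive_integral0/locally_bounded_cst.
Qed.

Lemma picard_deg n j x : (n.*2 < j)%N -> picard n j x = 0.
Proof.
elim: n j x => [|n ih] j x /=; first by case: j.
rewrite doubleS => nj; apply: integral0_zero => t; apply: integral0_zero => {}t.
rewrite /picard_source ih; last exact: leq_trans (leqW (leqnSn _)) nj.
rewrite mulr0 sub0r; case: j nj => [|[|j]] nj; rewrite ?oppr0//.
by rewrite ih ?oppr0// -2!ltnS.
Qed.

(** Of the two integrations in one correction, the first gains the next factor of the factorial and
    the second only costs a factor |x| <= L. A single factorial is enough against the geometric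
    factors. *)
Lemma picard_bound L n j : 1 <= L ->
  (forall x, `|x| <= L ->
    `|picard n j x| <= (`|a| + `|b| * L) * ((sigma + 1) * L) ^+ n * (`|x| ^+ n / n`!%:R)) /\
  (forall x, `|x| <= L ->
    `|picard' n j x| <= (`|a| + `|b| * L) * ((sigma + 1) * L) ^+ n.+1 *
       (`|x| ^+ n.+1 / n.+1`!%:R)).
Proof.
move=> L1; have s0 : 0 <= sigma by exact: le_trans (qs 0).
set B := `|a| + `|b| * L; set K := (sigma + 1) * L.
have B0 : 0 <= B by rewrite addr_ge0// mulr_ge0//; lra.
have K0 : 0 <= K by rewrite mulr_ge0//; lra.
have step m : (forall i x, `|x| <= L -> `|picard m i x| <= B * K ^+ m * (`|x| ^+ m / m`!%:R)) ->
   forall i x, `|x| <= L -> `|picard' m i x| <=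
     B * K ^+ m * (sigma + 1) * (`|x| ^+ m.+1 / m.+1`!%:R).
  move=> H i x xL.
  apply: (primitive_exp_bound (primitive_picard' m i)) xL.
    exact: integral0_0.
  move=> t tL; rewrite /picard_source.
  set M := `|t| ^+ m / m`!%:R.
  have M0 : 0 <= B * K ^+ m * M.
    by rewrite !mulr_ge0 ?exprn_ge0 ?invr_ge0.
  have h1 : `|q t * picard m i t| <= sigma * (B * K ^+ m * M).
    by rewrite normrM ler_pM ?qs ?H.
  have h2 : `|if i is i'.+2 then picard m i' t else 0| <= B * K ^+ m * M.
    by case: i {h1} => [|[|i]]; rewrite ?normr0 ?H.
  apply: le_trans (ler_normB _ _) _.
  have -> : B * K ^+ m * (sigma + 1) * M = sigma * (B * K ^+ m * M) + B * K ^+ m * M by ring.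
  exact: lerD.
have step' m : (forall i x, `|x| <= L -> `|picard m i x| <= B * K ^+ m * (`|x| ^+ m / m`!%:R)) ->
   forall i x, `|x| <= L -> `|picard' m i x| <=
     B * K ^+ m.+1 * (`|x| ^+ m.+1 / m.+1`!%:R).
  move=> H i x xL; apply: le_trans (step m H i x xL) _.
  rewrite ler_wpM2r ?mulr_ge0 ?exprn_ge0 ?invr_ge0//.
  rewrite exprSr mulrA ler_wpM2l ?mulr_ge0 ?exprn_ge0//.
  by rewrite /K ler_peMr//; lra.
have H m : forall i x, `|x| <= L -> `|picard m i x| <= B * K ^+ m * (`|x| ^+ m / m`!%:R).
  elim: m => [|m ih] i x xL.
    rewrite !expr0 fact0 invr1 !mulr1 /=; case: i => [|i]; last by rewrite normr0.
    apply: le_trans (ler_normD _ _) _; rewrite lerD2l normrM ler_wpM2l//.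
  have E : forall t, `|t| <= `|x| -> `|picard' m i t| <= B * K ^+ m * (sigma + 1) * (`|x| ^+ m.+1 / m.+1`!%:R).
    move=> t tx; apply: le_trans (step m ih i t (le_trans tx xL)) _.
    rewrite ler_wpM2l ?mulr_ge0 ?exprn_ge0//; first lra.
    by rewrite ler_wpM2r ?invr_ge0// lerXn2r ?nnegrE.
  have x0 : `|0 : R| <= `|x| by rewrite normr0.
  have := primitive_lipschitz_sym (primitive_picard m i) E x0 (lexx _).
  rewrite /= integral0_0 !subr0 => /le_trans; apply.
  rewrite mulrAC ler_wpM2r ?mulr_ge0 ?exprn_ge0 ?invr_ge0//.
  rewrite exprSr -[X in X <= _]mulrA [X in _ <= X]mulrA.
  rewrite ler_wpM2l ?mulr_ge0 ?exprn_ge0//.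
  by rewrite /K ler_wpM2l//; lra.
by split=> x xL; [exact: H|exact: (step' n (H n))].
Qed.


(** Absorbs the number of coefficients of [picard_poly] into the geometric ratio. *)
Lemma double_lt_exp3 n : (n.*2.+1 <= 3 ^ n)%N.
Proof.
elim: n => // n ih; rewrite doubleS expnS.
apply: leq_trans (_ : 3 * n.*2.+1 <= _)%N; last by rewrite leq_mul2l.
by rewrite mulnS; lia.
Qed.

Lemma series_poly_cauchy (p : nat -> R -> {poly C}) :
  (forall rho L, 0 < rho -> 1 <= L -> exists B c, [/\ 0 <= B, 0 <= c &
     forall n x, `|x| <= L -> coefnorm rho (p n x) <= B * (c ^+ n / n`!%:R)]) ->
  forall rho L e, 0 < rho -> 0 < e -> exists n0, forall m n x,
    (n0 <= m)%N -> (n0 <= n)%N -> `|x| <= L ->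
    coefnorm rho (\sum_(i < m) p i x - \sum_(i < n) p i x) <= e.
Proof.
move=> H rho L e r0 e0.
have L1 : 1 <= `|L| + 1 by rewrite lerDr.
have [B [c [B0 c0 hp]]] := H rho _ r0 L1.
have B1 : 0 < B + 1 by lra.
have [n0 hn0] := exp_tail c0 (divr_gt0 e0 B1).
exists n0 => m n x; wlog mn : m n / (n <= m)%N => [W|] n0m n0n xL.
  have [mn|/ltnW mn] := leqP n m; first exact: W.
  by rewrite -coefnormN opprB W.
have -> : \sum_(i < m) p i x - \sum_(i < n) p i x = \sum_(n <= i < m) p i x.
  rewrite -(big_mkord xpredT (fun i => p i x)) (big_cat_nat _ mn)//=.
  by rewrite big_mkord addrAC subrr add0r.
have le1 : coefnorm rho (\sum_(n <= i < m) p i x) <=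
    \sum_(n <= i < m) B * (c ^+ i / i`!%:R).
  elim/big_ind2 : _ => [|u v u' v' uv uv'|i _]; first by rewrite coefnorm0.
    exact: le_trans (coefnormD _ _ (ltW r0)) (lerD uv uv').
  by apply: hp; rewrite (le_trans xL)// (le_trans (ler_norm L))// lerDl.
apply: le_trans le1 _; rewrite -mulr_sumr.
apply: le_trans (_ : (B + 1) * (e / (B + 1)) <= _); last by rewrite mulrC divfK// gt_eqF.
apply: ler_pM => //; [|lra|exact: hn0].
by apply: sumr_ge0 => i _; rewrite mulr_ge0 ?exprn_ge0 ?invr_ge0.
Qed.

(** By [picard_deg], the n-th correction has degree at most 2 n in k; [picard' n] integrates (q -
    k^2) times it, so its degree is at most 2 n + 2. *)
Definition picard_poly n x : {poly C} := \poly_(j < n.*2.+1) (picard n j x)%:C.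
Definition picard_poly' n x : {poly C} := \poly_(j < n.*2.+3) (picard' n j x)%:C.

Lemma picard_poly_coefnorm rho L : 0 < rho -> 1 <= L -> exists B c,
  [/\ 0 <= B, 0 <= c & forall n x, `|x| <= L ->
   coefnorm rho (picard_poly n x) <= B * (c ^+ n / n`!%:R) /\
   coefnorm rho (picard_poly' n x) <= B * (c ^+ n / n`!%:R)].
Proof.
move=> r0 L1; have s0 : 0 <= sigma by exact: le_trans (qs 0).
set B := `|a| + `|b| * L; set K := (sigma + 1) * L.
have B0 : 0 <= B by rewrite addr_ge0// mulr_ge0//; lra.
have K0 : 0 <= K by rewrite mulr_ge0//; lra.
have L0 : 0 <= L by lra.
have r1 : 0 <= 1 + rho by lra.
pose c := 3 * (K * L * (1 + rho) ^+ 2).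
have c0 : 0 <= c by nonneg.
pose B1 := B * (1 + rho); pose B2 := 3 * (B * (K * L) * (1 + rho) ^+ 3).
have B10 : 0 <= B1 by rewrite mulr_ge0.
have B20 : 0 <= B2 by nonneg.
exists (B1 + B2), c; split => //; first exact: addr_ge0.
move=> n x xL; have cn : 0 <= c ^+ n / n`!%:R.
  by nonneg.
have three : n.*2.+1%:R <= 3 ^+ n :> R by rewrite -natrX ler_nat double_lt_exp3.
split.
  have H j : `|picard n j x| <= B * K ^+ n * (L ^+ n / n`!%:R).
    apply: le_trans ((picard_bound n j L1).1 x xL) _.
    rewrite ler_wpM2l ?mulr_ge0 ?exprn_ge0// ler_wpM2r ?invr_ge0//.
    by rewrite lerXn2r ?nnegrE.
  apply: le_trans (coefnorm_poly_le _ (ltW r0) _ H) _.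
    by nonneg.
  apply: (@le_trans _ _ (B1 * (c ^+ n / n`!%:R))); last by rewrite ler_wpM2r ?lerDl.
  have -> : B1 * (c ^+ n / n`!%:R) =
      3 ^+ n * (B * K ^+ n * (L ^+ n / n`!%:R)) * (1 + rho) ^+ n.*2.+1.
    have -> : (1 + rho) ^+ n.*2.+1 = ((1 + rho) ^+ 2) ^+ n * (1 + rho).
      by rewrite exprSr -mul2n exprM.
    by rewrite /B1 /c; set r2 := (1 + rho) ^+ 2; rewrite !exprMn; ring.
  by do 2 (apply: ler_wpM2r; first by nonneg).
have H j : `|picard' n j x| <= B * K ^+ n.+1 * (L ^+ n.+1 / n`!%:R).
  apply: le_trans ((picard_bound n j L1).2 x xL) _.
  rewrite ler_wpM2l ?mulr_ge0 ?exprn_ge0// ler_pM ?exprn_ge0 ?invr_ge0//.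
    by rewrite lerXn2r ?nnegrE.
  rewrite lef_pV2 ?posrE ?ltr0n ?fact_gt0// ler_nat factS leq_pmull//.
apply: le_trans (coefnorm_poly_le _ (ltW r0) _ H) _.
  by nonneg.
apply: (@le_trans _ _ (B2 * (c ^+ n / n`!%:R))); last by rewrite ler_wpM2r ?lerDr.
have -> : B2 * (c ^+ n / n`!%:R) =
    3 * 3 ^+ n * (B * K ^+ n.+1 * (L ^+ n.+1 / n`!%:R)) * (1 + rho) ^+ n.*2.+3.
  have -> : (1 + rho) ^+ n.*2.+3 = ((1 + rho) ^+ 2) ^+ n * (1 + rho) ^+ 3.
    by rewrite -exprM -exprD mul2n addn3.
  rewrite !(exprSr _ n) /B2 /c; set r2 := (1 + rho) ^+ 2.
  by rewrite !exprMn; ring.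
apply: ler_wpM2r; first by nonneg.
apply: ler_wpM2r; first by nonneg.
apply: le_trans (_ : 3 * n.*2.+1%:R <= _); last by rewrite ler_wpM2l.
by rewrite -natrM ler_nat; clear; lia.
Qed.

Definition picard_sum n x := \sum_(i < n) picard_poly i x.
(** [picard_poly' i] is the derivative of the correction of rank i + 1, and that of the correction
    of rank 0 is b. Hence this is the derivative of [picard_sum n.+1], while its own derivative
    involves [picard_sum n]. *)
Definition picard_sum' n x := b%:C%:P + \sum_(i < n) picard_poly' i x.

Lemma picard_poly_deriv n k :
  cprimitive (fun x => (picard_poly n.+1 x).[k]) (fun x => (picard_poly' n x).[k]).
Proof.
have := cprimitive_sum (fun j : 'I_(n.*2.+3) =>
  cprimitiveZ (k ^+ j) (cprimitive_real (primitive_picard n j))).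
move=> /cprimitive_eq; apply => x; rewrite horner_poly.
  by rewrite doubleS; apply: eq_bigr => j _; rewrite mulrC.
by apply: eq_bigr => j _; rewrite mulrC.
Qed.

Lemma picard_poly'_deriv n k :
  cprimitive (fun x => (picard_poly' n x).[k])
    (fun x => ((q x)%:C - k ^+ 2) * (picard_poly n x).[k]).
Proof.
have := cprimitive_sum (fun j : 'I_(n.*2.+3) =>
  cprimitiveZ (k ^+ j) (cprimitive_real (primitive_picard' n j))).
move=> /cprimitive_eq; apply => x; rewrite horner_poly.
  by apply: eq_bigr => j _; rewrite mulrC.
pose shifted i := if i is i'.+2 then (picard n i' x)%:C * k ^+ i'.+2 else 0.
have -> : \sum_(i < n.*2.+3) k ^+ i * (picard_source (picard n) i x)%:C =
  \sum_(i < n.*2.+3) (q x)%:C * ((picard n i x)%:C * k ^+ i) -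
  \sum_(i < n.*2.+3) shifted i.
  have E (i : nat) : k ^+ i * (picard_source (picard n) i x)%:C =
      (q x)%:C * ((picard n i x)%:C * k ^+ i) - shifted i.
    rewrite /shifted /picard_source rmorphB rmorphM/=.
    by case: i => [|[|i]]; rewrite ?subr0 ?rmorph0; ring.
  by rewrite -sumrB; apply: eq_bigr => i _; exact: E.
(* The two top coefficients of the first sum vanish by [picard_deg], and the two lowest terms of the
   shifted sum are 0. *)
rewrite mulrBl; congr (_ - _).
  rewrite big_ord_recr/= big_ord_recr/= !picard_deg ?leqnn//.
  rewrite !rmorph0 !mul0r !mulr0 !addr0.
  by rewrite mulr_sumr.
rewrite big_ord_recl big_ord_recl/= !add0r mulr_sumr; apply: eq_bigr => i _.
by rewrite add0n (exprS _ i.+1) (exprS _ i); ring.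
Qed.

Lemma horner_sum n (p : 'I_n -> {poly C}) k :
  (\sum_(i < n) p i).[k] = \sum_(i < n) (p i).[k].
Proof. by rewrite -(big_morph (horner^~ k) (fun u v => hornerD u v k) (horner0 k)). Qed.

Lemma picard_poly0 x k : (picard_poly 0 x).[k] = (a + b * x)%:C.
Proof.
by rewrite /picard_poly horner_poly big_ord_recl big_ord0 /= expr0 mulr1 addr0.
Qed.

Lemma picard_sum_deriv n k : cprimitive (fun x => (picard_sum n.+1 x).[k])
  (fun x => (picard_sum' n x).[k]).
Proof.
have h0 : cprimitive (fun x => (picard_poly 0 x).[k]) (fun=> b%:C).
  have := cprimitive_real (primitiveD (primitive_cst a) (primitiveZ b (@primitive_id R))).
  move=> /cprimitive_eq; apply => x; first by rewrite picard_poly0.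
  by rewrite mulr1 add0r.
have := cprimitiveD h0 (cprimitive_sum (fun i : 'I_n => picard_poly_deriv i k)).
move=> /cprimitive_eq; apply => x.
  by rewrite /picard_sum big_ord_recl hornerD horner_sum.
by rewrite /picard_sum' hornerD hornerC horner_sum.
Qed.

Lemma picard_sum'_deriv n k : cprimitive (fun x => (picard_sum' n x).[k])
  (fun x => ((q x)%:C - k ^+ 2) * (picard_sum n x).[k]).
Proof.
have := cprimitiveD (cprimitive_cst b%:C)
  (cprimitive_sum (fun i : 'I_n => picard_poly'_deriv i k)).
move=> /cprimitive_eq; apply => x.
  by rewrite /picard_sum' hornerD hornerC horner_sum.
by rewrite add0r /picard_sum horner_sum mulr_sumr.
Qed.

Lemma uniform_limitC_poly (P : nat -> R -> {poly C}) (y : R -> C -> C) k :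
  (forall rho L e, 0 < rho -> 0 < e -> exists n0, forall m n x,
    (n0 <= m)%N -> (n0 <= n)%N -> `|x| <= L -> coefnorm rho (P m x - P n x) <= e) ->
  (forall x, poly_limit (P^~ x) (y x)) ->
  uniform_limitC (fun n x => (P n x).[k]) (y^~ k).
Proof.
move=> U H L e e0; have e2 : 0 < e / 2 by lra.
have k1 : 0 < N k + 1 by rewrite ltr_wpDl// normc_ge0.
have kk : N k <= N k + 1 by rewrite lerDl.
have [n0 hn0] := U _ L _ k1 e2; exists n0 => n x nn xL.
have [n1 hn1] := H x k _ e2; pose m := maxn n0 n1.
have := hn0 n m x nn (leq_maxl _ _) xL; have := hn1 m (leq_maxr _ _).
have := coefnorm_horner (P n x - P m x) kk.
have -> : (P n x).[k] - y x k = (P n x - P m x).[k] + ((P m x).[k] - y x k).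
  by rewrite hornerD hornerN; ring.
have := le_normcD (P n x - P m x).[k] ((P m x).[k] - y x k); lra.
Qed.

Definition clocally_bounded (f : R -> C) :=
  locally_bounded (rpart f) /\ locally_bounded (ipart f).

Lemma clocally_boundedM f g : clocally_bounded f -> clocally_bounded g ->
  clocally_bounded (fun x => f x * g x).
Proof.
move=> [rf if_] [rg ig]; split.
  have := locally_boundedB (locally_boundedM rf rg) (locally_boundedM if_ ig).
  by congr locally_bounded; apply/funext => x; rewrite /rpart ReM.
have := locally_boundedD (locally_boundedM rf ig) (locally_boundedM if_ rg).
by congr locally_bounded; apply/funext => x; rewrite /ipart ImM.
Qed.

Lemma clocally_bounded_potential k : clocally_bounded (fun x => (q x)%:C - k ^+ 2).
Proof.
split.
  have := locally_boundedB lbq (locally_bounded_cst (complex.Re (k ^+ 2))).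
  by congr locally_bounded; apply/funext => x; rewrite /rpart; case: (k ^+ 2).
have := locally_bounded_cst (- complex.Im (k ^+ 2)).
congr locally_bounded; apply/funext => x; rewrite /ipart; case: (k ^+ 2) => ? ? /=.
by rewrite sub0r.
Qed.

Lemma uniform_limit_clocally_bounded (F_ f_ : nat -> R -> C) F :
  (forall n, cprimitive (F_ n) (f_ n)) -> uniform_limitC F_ F -> clocally_bounded F.
Proof.
move=> hF uF; split; apply: continuous_locally_bounded.
  apply: uniform_limit_continuous (uniform_limit_rpart uF) => n.
  exact: primitive_continuous (hF n).1.
apply: uniform_limit_continuous (uniform_limit_ipart uF) => n.
exact: primitive_continuous (hF n).2.
Qed.

Lemma picard_solution : exists y y' : R -> C -> C,
  [/\ forall k, schrodinger q k (y^~ k) (y'^~ k), forall k, y 0 k = a%:C,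
     forall k, y' 0 k = b%:C, forall x, entire (y x) & forall x, entire (y' x)].
Proof.
have U : forall rho L e, 0 < rho -> 0 < e -> exists n0, forall m n x,
    (n0 <= m)%N -> (n0 <= n)%N -> `|x| <= L ->
    coefnorm rho (picard_sum m x - picard_sum n x) <= e.
  apply: series_poly_cauchy => rho L r0 L1.
  have [B [c [B0 c0 H]]] := picard_poly_coefnorm r0 L1.
  by exists B, c; split => // n x xL; exact: (H n x xL).1.
have U' : forall rho L e, 0 < rho -> 0 < e -> exists n0, forall m n x,
    (n0 <= m)%N -> (n0 <= n)%N -> `|x| <= L ->
    coefnorm rho (picard_sum' m x - picard_sum' n x) <= e.
  have V : forall rho L e, 0 < rho -> 0 < e -> exists n0, forall m n x,
      (n0 <= m)%N -> (n0 <= n)%N -> `|x| <= L ->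
      coefnorm rho (\sum_(i < m) picard_poly' i x - \sum_(i < n) picard_poly' i x) <= e.
    apply: series_poly_cauchy => rho L r0 L1.
    have [B [c [B0 c0 H]]] := picard_poly_coefnorm r0 L1.
    by exists B, c; split => // n x xL; exact: (H n x xL).2.
  move=> rho L e r0 e0; have [n0 hn0] := V rho L e r0 e0; exists n0 => m n x *.
  by rewrite /picard_sum' opprD addrACA subrr add0r hn0.
have cS x : poly_cauchy (picard_sum^~ x).
  move=> rho e r0 e0; have [n0 hn0] := U rho `|x| e r0 e0.
  by exists n0 => m n mn nn; exact: hn0.
have cS' x : poly_cauchy (picard_sum'^~ x).
  move=> rho e r0 e0; have [n0 hn0] := U' rho `|x| e r0 e0.
  by exists n0 => m n mn nn; exact: hn0.
have [y hy] := choice (fun x => poly_cauchy_limit (cS x)).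
have [y' hy'] := choice (fun x => poly_cauchy_limit (cS' x)).
have uS k := uniform_limitC_poly k U hy.
have uS' k := uniform_limitC_poly k U' hy'.
have uS1 k : uniform_limitC (fun n x => (picard_sum n.+1 x).[k]) (y^~ k).
  move=> L e e0; have [n0 hn0] := uS k L e e0; exists n0 => n x nn xL.
  by apply: hn0 => //; exact: leqW.
exists y, y'; split=> [k|k|k|x|x].
- have lb' : clocally_bounded (y'^~ k).
    exact: uniform_limit_clocally_bounded (picard_sum'_deriv^~ k) (uS' k).
  have lb : clocally_bounded (y^~ k).
    exact: uniform_limit_clocally_bounded (picard_sum_deriv^~ k) (uS1 k).
  split; first exact: (cprimitive_limit (picard_sum_deriv^~ k) lb'.1 lb'.2).
  have [lb1 lb2] := clocally_boundedM (clocally_bounded_potential k) lb.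
  apply: (cprimitive_limit (picard_sum'_deriv^~ k) lb1 lb2 (uS' k)).
  move=> L e e0; pose M := sigma + N (k ^+ 2) + 1.
  have M0 : 0 < M.
    by rewrite ltr_wpDl// addr_ge0 ?normc_ge0//; exact: le_trans (qs 0).
  have [n0 hn0] := uS k L _ (divr_gt0 e0 M0); exists n0 => n x nn xL.
  rewrite -mulrBr Normc.normcM.
  have qM : N ((q x)%:C - k ^+ 2) <= M.
    by apply: le_trans (le_normcB _ _) _; rewrite normc_real /M; have := qs x; lra.
  apply: le_trans (ler_pM (normc_ge0 _) (normc_ge0 _) qM (hn0 n x nn xL)) _.
  by rewrite mulrC divfK// gt_eqF.
- apply/eqP; rewrite eq_sym -subr_eq0; apply/eqP/normc_ltP => e e0.
  have [n0 hn0] := hy 0 k e e0; have := hn0 n0.+1 (leqnSn _).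
  rewrite /picard_sum horner_sum big_ord_recl picard_poly0 mulr0 addr0 big1 ?addr0//.
  move=> i _; rewrite horner_poly big1// => j _.
  by rewrite /= integral0_0 mul0r.
- apply/eqP; rewrite eq_sym -subr_eq0; apply/eqP/normc_ltP => e e0.
  have [n0 hn0] := hy' 0 k e e0; have := hn0 n0 (leqnn _).
  rewrite /picard_sum' hornerD hornerC horner_sum big1 ?addr0//.
  move=> i _; rewrite horner_poly big1// => j _.
  by rewrite /picard' integral0_0 mul0r.
- by exists (picard_sum^~ x).
- by exists (picard_sum'^~ x).
Qed.

End Picard.

(** * Jost solutions *)

Section Jost.
Context {R : realType}.
Local Notation C := R[i].
Local Notation N z := (Normc.normc z).
Implicit Types (q : R -> R) (k : C) (x : R).

(** The names refer to q = 0, where the two solutions normalized at 0 are cos (k x) and sin (k x) /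
    k. *)
Record solution_pair := SolutionPair {
  sol_cos : R -> C -> C; sol_cos' : R -> C -> C;
  sol_sin : R -> C -> C; sol_sin' : R -> C -> C }.

Implicit Type S : solution_pair.
Local Notation "S .th" := (sol_cos S) (at level 2, format "S .th").
Local Notation "S .th'" := (sol_cos' S) (at level 2, format "S .th'").
Local Notation "S .ph" := (sol_sin S) (at level 2, format "S .ph").
Local Notation "S .ph'" := (sol_sin' S) (at level 2, format "S .ph'").

Definition fundamental q S :=
  [/\ forall k, schrodinger q k (S.th^~ k) (S.th'^~ k) /\
        schrodinger q k (S.ph^~ k) (S.ph'^~ k),
      forall k, [/\ S.th 0 k = 1, S.th' 0 k = 0, S.ph 0 k = 0 & S.ph' 0 k = 1] &
      forall x, [/\ entire (S.th x), entire (S.th' x), entire (S.ph x) &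
                    entire (S.ph' x)]].

Lemma fundamental_exists q sigma : locally_bounded q ->
  (forall x, `|q x| <= sigma) -> exists S, fundamental q S.
Proof.
move=> lbq qs.
have [th [th' [H1 H2 H3 H4 H5]]] := picard_solution lbq qs 1 0.
have [ph [ph' [K1 K2 K3 K4 K5]]] := picard_solution lbq qs 0 1.
by exists (SolutionPair th th' ph ph'); split => //= k; split.
Qed.

Section FundamentalTheory.
Context (q : R -> R) (S : solution_pair) (fS : fundamental q S).

Lemma sol_wronskian x k : S.th x k * S.ph' x k - S.th' x k * S.ph x k = 1.
Proof.
have [/(_ k)[ht hp] /(_ k)[t0 t0' p0 p0'] _] := fS.
by rewrite (wronskian_cst x 0 ht hp) t0 t0' p0 p0' mulr1 mul0r subr0.
Qed.

Lemma solution_decomp y y' x k : schrodinger q k y y' ->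
  y x = y 0 * S.th x k + y' 0 * S.ph x k /\
  y' x = y 0 * S.th' x k + y' 0 * S.ph' x k.
Proof.
move=> hy; have [/(_ k)[ht hp] /(_ k)[t0 t0' p0 p0'] _] := fS.
have := wronskian_cst x 0 hy hp; have := wronskian_cst x 0 ht hy.
rewrite t0 t0' p0 p0' mul1r mul0r subr0 mulr0 subr0 mulr1 => E1 E2.
have W := sol_wronskian x k.
by rewrite -E1 -E2; split; [rewrite -[LHS]mulr1|rewrite -[LHS]mulr1]; rewrite -W; ring.
Qed.

(** The equation depends on k^2 only and the initial values do not depend on k. *)
Lemma sol_even x k : [/\ S.th x (- k) = S.th x k, S.th' x (- k) = S.th' x k,
  S.ph x (- k) = S.ph x k & S.ph' x (- k) = S.ph' x k].
Proof.
have [hS iS _] := fS; have [ht hp] := hS (- k).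
have [a1 a2 a3 a4] := iS (- k).
have E y y' : schrodinger q (- k) y y' -> schrodinger q k y y'.
  by rewrite /schrodinger sqrrN.
have [h1 h2] := solution_decomp x (E _ _ ht).
have [h3 h4] := solution_decomp x (E _ _ hp).
rewrite h1 h2 h3 h4 a1 a2 a3 a4; split; ring.
Qed.

(* [jost] is the solution with [jost 1 = 1] and [jost' 1 = i k], that is
   [exp (i k (x - 1))] to the right of the support of [q]; [jostA] and [jostB] are
   its value and its derivative at [0]. *)
Definition jostA k := S.ph' 1 k - 'i * k * S.ph 1 k.
Definition jostB k := 'i * k * S.th 1 k - S.th' 1 k.
Definition jost x k := jostA k * S.th x k + jostB k * S.ph x k.
Definition jost' x k := jostA k * S.th' x k + jostB k * S.ph' x k.

Lemma jost_schrodinger k : schrodinger q k (jost^~ k) (jost'^~ k).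
Proof.
have [/(_ k)[ht hp] _ _] := fS.
exact: schrodingerD (schrodingerZ _ ht) (schrodingerZ _ hp).
Qed.

Lemma jost_at0 k : jost 0 k = jostA k /\ jost' 0 k = jostB k.
Proof.
have [_ /(_ k)[t0 t0' p0 p0'] _] := fS.
by rewrite /jost /jost' t0 t0' p0 p0' !mulr1 !mulr0 addr0 add0r.
Qed.

Lemma jost_at1 k : jost 1 k = 1 /\ jost' 1 k = 'i * k.
Proof.
have W := sol_wronskian 1 k.
split; first by rewrite -[RHS]W /jost /jostA /jostB; ring.
by rewrite -[RHS]mulr1 -W /jost' /jostA /jostB; ring.
Qed.

Lemma entire_jostA : entire jostA.
Proof.
have [_ _ /(_ 1)[? ? ? ?]] := fS.
apply: entireB => //; apply: entireM => //; apply: entireM; last exact: entire_id.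
exact: entire_cst.
Qed.

Lemma entire_jostB : entire jostB.
Proof.
have [_ _ /(_ 1)[? ? ? ?]] := fS.
apply: entireB => //; apply: entireM => //; apply: entireM; last exact: entire_id.
exact: entire_cst.
Qed.

(** [jost] at -k solves the same equation as [jost] at k; their Wronskian is read at 0 on the left,
    while its value at 1 is 2 i k. *)
Lemma jost_wronskian k :
  jostB k * jostA (- k) - jostA k * jostB (- k) = 2 * 'i * k.
Proof.
rewrite /jostA /jostB; have [-> -> -> ->] := sol_even 1 k.
transitivity (2 * 'i * k * (S.th 1 k * S.ph' 1 k - S.th' 1 k * S.ph 1 k)).
  by ring.
by rewrite sol_wronskian mulr1.
Qed.

(* The flux Im(f' f^* ) has derivative - Im(k^2) |f|^2 and equals Re k at x = 1. *)
Lemma jost_flux k : 0 <= complex.Im k ->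
  (0 <= complex.Re k -> complex.Re k <= complex.Im (jostB k * (jostA k)^*)) /\
  (complex.Re k <= 0 -> complex.Im (jostB k * (jostA k)^*) <= complex.Re k).
Proof.
move=> Ik; have [hf hf'] := jost_schrodinger k.
have [_ hF] := cprimitiveM hf' (cprimitive_conj hf).
have {}hF : primitive (fun x => complex.Im (jost' x k * (jost x k)^*))
    (fun x => - complex.Im (k ^+ 2) * (N (jost x k)) ^+ 2).
  apply: primitive_eq hF _ _ => x //; rewrite /ipart.
  case: (jost' x k) => c d; case: (jost x k) => a b; case: (k ^+ 2) => r s /=.
  rewrite sqr_sqrtr ?addr_ge0 ?sqr_ge0//; ring.
have Ik2 : complex.Im (k ^+ 2) = 2 * complex.Re k * complex.Im k.
  by case: (k) => a b; rewrite expr2 /=; ring.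
have F1 : complex.Im (jost' 1 k * (jost 1 k)^*) = complex.Re k.
  have [-> ->] := jost_at1 k; case: (k) => a b /=; ring.
have F0 : complex.Im (jost' 0 k * (jost 0 k)^*) = complex.Im (jostB k * (jostA k)^*).
  by have [-> ->] := jost_at0 k.
split=> Rk; rewrite -F0 -[complex.Re k]F1.
  rewrite -lerN2; apply: (primitive_le (primitiveN hF)) => // x _.
  by rewrite mulNr opprK mulr_ge0 ?sqr_ge0// Ik2 !mulr_ge0.
apply: (primitive_le hF) => // x _.
by rewrite mulr_ge0 ?sqr_ge0// Ik2 oppr_ge0 -mulrA mulr_ge0_le0// mulr_le0_ge0.
Qed.

Lemma jostA_neq0 k : 0 <= complex.Im k -> complex.Re k != 0 -> jostA k != 0.
Proof.
move=> Ik Rk; have [H1 H2] := jost_flux Ik; apply/eqP => A0.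
move: H1 H2; rewrite A0 rmorph0 mulr0 /=.
by move: Rk; rewrite neq_lt => /orP[] R0 H1 H2;
  [have := H2 (ltW R0)|have := H1 (ltW R0)]; lra.
Qed.

End FundamentalTheory.

(* With [S] for [q] and [T] for the reflected potential [q (- x)], the Wronskian
   at [0] of the Jost solutions from the left and from the right. *)
Definition jostW S T k := - (jostA S k * jostB T k + jostB S k * jostA T k).

Lemma normc_conj (z : C) : N (z^*) = N z.
Proof. by case: z => a b /=; rewrite sqrrN. Qed.

Section PairTheory.
Context (q q' : R -> R) (S T : solution_pair).
Context (fS : fundamental q S) (fT : fundamental q' T).

Lemma entire_jostW : entire (jostW S T).
Proof.
have := (entire_jostA fS, entire_jostB fS); have := (entire_jostA fT, entire_jostB fT).
by move=> [? ?] [? ?]; apply: entireN; apply: entireD; apply: entireM.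
Qed.

(** After division by |A_S A_T|^2 this says that Im (W / (A_S A_T)) = - Im (B_S / A_S) - Im (B_T /
    A_T). By [jost_flux] both terms have the same sign, so they cannot cancel off the imaginary
    axis. *)
Lemma jostW_flux k : complex.Im (jostW S T k * (jostA S k * jostA T k)^*) =
  - (complex.Im (jostB S k * (jostA S k)^*) * N (jostA T k) ^+ 2 +
     complex.Im (jostB T k * (jostA T k)^*) * N (jostA S k) ^+ 2).
Proof.
rewrite /jostW; case: (jostA S k) => a b; case: (jostA T k) => c d.
case: (jostB S k) => e f; case: (jostB T k) => g h /=.
rewrite !sqr_sqrtr ?addr_ge0 ?sqr_ge0//; ring.
Qed.

Lemma jostW_neq0 k : 0 <= complex.Im k -> complex.Re k != 0 -> jostW S T k != 0.
Proof.
move=> Ik Rk; have AS := jostA_neq0 fS Ik Rk; have AT := jostA_neq0 fT Ik Rk.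
apply/eqP => W0; have := jostW_flux k; rewrite W0 mul0r /=.
have [H1 H2] := jost_flux fS Ik; have [H3 H4] := jost_flux fT Ik.
have NS : 0 < N (jostA S k) ^+ 2 by rewrite exprn_gt0// normc_gt0.
have NT : 0 < N (jostA T k) ^+ 2 by rewrite exprn_gt0// normc_gt0.
move/eqP; rewrite eq_sym oppr_eq0 => /eqP.
by move: Rk; rewrite neq_lt => /orP[] R0; [move: (H2 (ltW R0)) (H4 (ltW R0))|
  move: (H1 (ltW R0)) (H3 (ltW R0))]; nra.
Qed.

(** The flux gives |W| / (|A_S| |A_T|) >= x (1 / |A_S|^2 + 1 / |A_T|^2), and the
    arithmetic-geometric inequality concludes. On the positive axis the singularity of 1 / W at 0 is
    thus at most that of a simple pole. *)
Lemma jostW_ge_real (x : R) : 0 < x -> 2 * x <= N (jostW S T x%:C).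
Proof.
move=> x0; have Ik : 0 <= complex.Im x%:C by [].
have Rk : complex.Re x%:C != 0 by rewrite /= gt_eqF.
have AS := jostA_neq0 fS Ik Rk; have AT := jostA_neq0 fT Ik Rk.
have [/(_ (ltW x0)) H1 _] := jost_flux fS Ik.
have [/(_ (ltW x0)) H2 _] := jost_flux fT Ik.
have NS : 0 < N (jostA S x%:C) by rewrite normc_gt0.
have NT : 0 < N (jostA T x%:C) by rewrite normc_gt0.
have := jostW_flux x%:C; set I := complex.Im (jostW _ _ _ * _) => HI.
have : - I <= N (jostW S T x%:C) * (N (jostA S x%:C) * N (jostA T x%:C)).
  rewrite -(Normc.normcM (jostA S _)) -(normc_conj (jostA S _ * _)) -Normc.normcM.
  have := ge_Im_normc (jostW S T x%:C * (jostA S x%:C * jostA T x%:C)^*).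
  by rewrite ler_norml; lra.
move: H1 H2; rewrite /= => H1 H2 H3.
rewrite -(ler_pM2r (mulr_gt0 NS NT)); apply: le_trans H3; rewrite HI opprK.
have : 0 <= x * (N (jostA S x%:C) - N (jostA T x%:C)) ^+ 2.
  by rewrite mulr_ge0 ?sqr_ge0 ?ltW.
have := ler_wpM2r (sqr_ge0 (N (jostA T x%:C))) H1.
have := ler_wpM2r (sqr_ge0 (N (jostA S x%:C))) H2.
by nra.
Qed.

(** The odd part of the Green function A_S A_T / W at (0, 0), cleared of denominators. After
    division by W(k) W(-k), the right-hand side involves only A_S / W and A_T / W, which are the
    data u(-1) and u(1). *)
Lemma jostW_odd_part k : jostA S k * jostA T k * jostW S T (- k) -
    jostA S (- k) * jostA T (- k) * jostW S T k =
  2 * 'i * k * (jostA S k * jostA S (- k) + jostA T k * jostA T (- k)).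
Proof.
rewrite [RHS]mulrDr.
transitivity ((jostB T k * jostA T (- k) - jostA T k * jostB T (- k)) *
   (jostA S k * jostA S (- k)) +
   (jostB S k * jostA S (- k) - jostA S k * jostB S (- k)) *
   (jostA T k * jostA T (- k))); first by rewrite /jostW; ring.
by rewrite (jost_wronskian fS) (jost_wronskian fT) addrC.
Qed.

End PairTheory.
End Jost.

(** * Growth in the upper half-plane *)

Section Bounds.
Context {R : realType}.
Local Notation C := R[i].
Local Notation N z := (Normc.normc z).

(** The function g t - E(t) exp (- kappa t) is nondecreasing. *)
Lemma gronwall (E e : R -> R) (kappa g x : R) : primitive E e -> 0 <= x ->
  (forall t, 0 <= t <= x -> e t <= kappa * E t + g * expR (kappa * t)) ->
  E x <= (E 0 + g * x) * expR (kappa * x).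
Proof.
move=> hE x0 he.
have hexp : primitive (fun t : R => expR (- (kappa * t)))
    (fun t => - kappa * expR (- (kappa * t))).
  apply: derive_primitive => [t|].
    have d1 : is_derive t 1 (fun t : R => - (kappa * t)) (- kappa).
      have -> : - kappa = - (kappa *: 1) by rewrite /GRing.scale/= mulr1.
      apply: is_deriveN; apply: is_deriveZ.
    have := @is_derive1_comp _ expR (fun t : R => - (kappa * t)) t _ _ _ d1.
    by move=> /(_ _ (is_derive_expR _)); rewrite mulrC.
  move=> t; apply: cvgM; first exact: cvg_cst.
  apply: (@continuous_comp _ _ _ (fun t : R => - (kappa * t)) expR).
    apply: cvgN; apply: cvgM; [exact: cvg_cst|exact: cvg_id].
  exact: continuous_expR.
have hP := primitiveM hE hexp.
have hG := primitiveB (primitiveZ g (@primitive_id R)) hP.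
have dens t : 0 <= t <= x -> 0 <= g * 1 - (e t * expR (- (kappa * t)) +
    E t * (- kappa * expR (- (kappa * t)))).
  move=> /he H; have p0 := expR_gt0 (- (kappa * t)).
  have := ler_wpM2r (ltW p0) H.
  by rewrite mulrDl -[g * _ * _]mulrA -expRD subrr expR0 => H'; lra.
have := primitive_le hG x0 dens; rewrite !mulr0 oppr0 expR0 mulr1 sub0r => H.
have p0 := expR_gt0 (kappa * x).
have H' : E x * expR (- (kappa * x)) <= E 0 + g * x by lra.
have := ler_wpM2r (ltW p0) H'.
by rewrite -mulrA -expRD addNr expR0 mulr1.
Qed.

Lemma normc_sqr (u : C) : N u ^+ 2 = complex.Re u ^+ 2 + complex.Im u ^+ 2.
Proof. by case: u => a b /=; rewrite sqr_sqrtr ?addr_ge0 ?sqr_ge0. Qed.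

Definition redot (u v : C) :=
  complex.Re u * complex.Re v + complex.Im u * complex.Im v.

Lemma redot_le u v : `|redot u v| <= N u * N v.
Proof.
have -> : redot u v = complex.Re (u^* * v).
  by rewrite /redot; case: u v => a b [c d] /=; ring.
by rewrite -(normc_conj u) -Normc.normcM ge_Re_normc.
Qed.

Lemma primitive_normc_sqr (F f : R -> C) : cprimitive F f ->
  primitive (fun x => N (F x) ^+ 2) (fun x => 2 * redot (F x) (f x)).
Proof.
move=> [rF iF].
apply: primitive_eq (primitiveD (primitiveM rF rF) (primitiveM iF iF)) _ _ => x.
  by rewrite normc_sqr !expr2.
by rewrite /redot /rpart /ipart; ring.
Qed.

Section Solution.
Context (q : R -> R) (sigma : R) (k : C) (z z' : R -> C).
Context (qs : forall x, `|q x| <= sigma) (hz : schrodinger q k z z').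
Context (k1 : 1 <= N k) (Ik : 0 <= complex.Im k).
Local Notation tau := (complex.Im k).

(** For q = 0 these two combinations are multiples of exp (i k x) and exp (- i k x). The potential
    couples them only through q z, and |z| is at most the sum of their moduli divided by 2 |k|. *)
Definition outgoing x := z' x + 'i * k * z x.
Definition incoming x := z' x - 'i * k * z x.

Lemma sigma_ge0 : 0 <= sigma.
Proof. exact: le_trans (qs 0). Qed.

Lemma outgoing_deriv :
  cprimitive outgoing (fun x => 'i * k * outgoing x + (q x)%:C * z x).
Proof.
have [hy hy'] := hz; have := cprimitiveD hy' (cprimitiveZ ('i * k) hy).
move=> /cprimitive_eq; apply => // x; rewrite /outgoing.
rewrite (_ : k ^+ 2 = - ('i * k * ('i * k))); last first.
  by rewrite -expr2 exprMn sqr_i mulN1r opprK.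
by move: ('i * k) => ik; ring.
Qed.

Lemma incoming_deriv :
  cprimitive incoming (fun x => - ('i * k) * incoming x + (q x)%:C * z x).
Proof.
have [hy hy'] := hz; have := cprimitiveB hy' (cprimitiveZ ('i * k) hy).
move=> /cprimitive_eq; apply => // x; rewrite /incoming.
rewrite (_ : k ^+ 2 = - ('i * k * ('i * k))); last first.
  by rewrite -expr2 exprMn sqr_i mulN1r opprK.
by move: ('i * k) => ik; ring.
Qed.

Lemma outgoing_dens x :
  2 * redot (outgoing x) ('i * k * outgoing x + (q x)%:C * z x) =
  - (2 * tau) * N (outgoing x) ^+ 2 + 2 * q x * redot (outgoing x) (z x).
Proof.
rewrite normc_sqr /redot; case: (outgoing x) (z x) (k) => a b [c d] [r s] /=; ring.
Qed.

Lemma incoming_dens x :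
  2 * redot (incoming x) (- ('i * k) * incoming x + (q x)%:C * z x) =
  2 * tau * N (incoming x) ^+ 2 + 2 * q x * redot (incoming x) (z x).
Proof.
rewrite normc_sqr /redot; case: (incoming x) (z x) (k) => a b [c d] [r s] /=; ring.
Qed.

Definition energy x := N (outgoing x) ^+ 2 + N (incoming x) ^+ 2.

Lemma energyE x : energy x = 2 * (N (z' x) ^+ 2 + N k ^+ 2 * N (z x) ^+ 2).
Proof.
rewrite /energy /outgoing /incoming !normc_sqr.
case: (z' x) (z x) (k) => a b [c d] [r s] /=; ring.
Qed.

Lemma coupling_le (u : C) x :
  `|2 * q x * redot u (z x)| <= 2 * sigma * (N u * N (z x)).
Proof.
rewrite -!mulrA !normrM ger0_norm// ler_pM2l// ler_pM ?qs//.
exact: redot_le.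
Qed.

(** In the rate, 2 tau is the growth of the incoming wave and 2 sigma bounds the coupling, since 2
    |z| is at most |outgoing| + |incoming| when |k| >= 1. *)
Lemma energy_bound x : 0 <= x -> energy x <= energy 0 * expR ((2 * tau + 2 * sigma) * x).
Proof.
move=> x0.
have hE := primitiveD (primitive_normc_sqr outgoing_deriv)
  (primitive_normc_sqr incoming_deriv).
have := @gronwall _ _ (2 * tau + 2 * sigma) 0 x hE x0.
rewrite mul0r addr0; apply => t _; rewrite mul0r addr0.
rewrite outgoing_dens incoming_dens -/(energy t).
have H1 := coupling_le (outgoing t) t; have H2 := coupling_le (incoming t) t.
rewrite ler_norml in H1; rewrite ler_norml in H2.
have z2 : 2 * N k * N (z t) <= N (outgoing t) + N (incoming t).
  have -> : 2 * N k * N (z t) = N (outgoing t - incoming t).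
    have -> : outgoing t - incoming t = 2%:C * ('i * k * z t).
      by rewrite /outgoing /incoming rmorphMn rmorph1; ring.
    rewrite !Normc.normcM normc_real normc_i mul1r ger0_norm//; ring.
  exact: le_normcB.
have s0 := sigma_ge0.
have z0 := normc_ge0 (z t); have X0 := normc_ge0 (outgoing t).
have Y0 := normc_ge0 (incoming t).
have z3 : 2 * N (z t) <= N (outgoing t) + N (incoming t).
  by apply: le_trans z2; rewrite -mulrA ler_pM2l// ler_peMl.
have key : 2 * (N (outgoing t) * N (z t)) + 2 * (N (incoming t) * N (z t)) <=
    2 * energy t.
  rewrite /energy; move: z3 z0 X0 Y0.
  move: (N (outgoing t)) (N (incoming t)) (N (z t)) => X Y Z z3 z0 X0 Y0.
  have : (X + Y) * (2 * Z) <= (X + Y) * (X + Y) by rewrite ler_wpM2l ?addr_ge0.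
  have := sqr_ge0 (X - Y); rewrite !expr2; nra.
have := ler_wpM2l s0 key.
have : 0 <= 4 * tau * N (outgoing t) ^+ 2.
  by rewrite !mulr_ge0// exprn_ge0.
rewrite /energy; lra.
Qed.

Lemma energy_bound01 x : 0 <= x <= 1 ->
  energy x <= energy 0 * (expR sigma ^+ 2 * expR (tau * x) ^+ 2).
Proof.
move=> /andP[x0 x1].
have E0 : 0 <= energy 0 by rewrite addr_ge0// exprn_ge0// normc_ge0.
apply: le_trans (energy_bound x0) _; rewrite ler_wpM2l// -!expRM_natl -expRD ler_expR.
have := ler_piMr sigma_ge0 x1; lra.
Qed.

Lemma solution_bound x : 0 <= x <= 1 ->
  N k ^+ 2 * N (z x) ^+ 2 <= energy 0 / 2 * (expR sigma ^+ 2 * expR (tau * x) ^+ 2) /\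
  N (z' x) ^+ 2 <= energy 0 / 2 * (expR sigma ^+ 2 * expR (tau * x) ^+ 2).
Proof.
move=> x01; have H := energy_bound01 x01.
have := exprn_ge0 2 (normc_ge0 (z' x)); have := exprn_ge0 2 (normc_ge0 (z x)).
have : 0 <= N k ^+ 2 * N (z x) ^+ 2 by rewrite mulr_ge0 ?exprn_ge0 ?normc_ge0.
move: H; rewrite energyE; lra.
Qed.

(** With S = exp sigma exp (tau t), the coupling 2 sigma |u| |z| is estimated through |u| <= 2 |k| S
    and |z| <= 2 S, which gives 8 sigma |k| S^2. *)
Definition coupling_cst : R := 8 * sigma * expR sigma ^+ 2.

(** The initial values are those of exp (- i k x). The wave stays incoming up to a relative error
    O(|k|^(-1/2)), because [outgoing] starts at 0 and is fed only by the coupling. It is applied to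
    the Jost solution read backwards from 1 to 0. *)
Lemma scattering_bound : z 0 = 1 -> z' 0 = - ('i * k) ->
  N (outgoing 1) ^+ 2 <= coupling_cst * N k * expR tau ^+ 2 /\
  (4 * N k ^+ 2 - coupling_cst * N k) * expR tau ^+ 2 <= N (incoming 1) ^+ 2.
Proof.
move=> z0 z'0; have Nk0 : 0 < N k by exact: lt_le_trans k1.
have s0 := sigma_ge0.
have out0 : outgoing 0 = 0 by rewrite /outgoing z0 z'0 mulr1 addNr.
have inc0 : N (incoming 0) ^+ 2 = 4 * N k ^+ 2.
  have -> : incoming 0 = (- 2)%:C * ('i * k).
    by rewrite /incoming z0 z'0 rmorphN rmorphMn rmorph1; ring.
  rewrite !Normc.normcM normc_real normc_i mul1r normrN ger0_norm//; ring.
have E0 : energy 0 = 4 * N k ^+ 2.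
  by rewrite /energy out0 inc0 Normc.normc0 expr0n/= add0r.
have coup t (u : C) : 0 <= t <= 1 -> N u ^+ 2 <= energy t ->
    `|2 * q t * redot u (z t)| <= coupling_cst * N k * expR (2 * tau * t).
  move=> t01 ut; apply: le_trans (coupling_le u t) _.
  have [Hz Hz'] := solution_bound t01; rewrite E0 in Hz Hz'.
  set S := expR sigma * expR (tau * t).
  have S0 : 0 < S by rewrite mulr_gt0 ?expR_gt0.
  have SE : expR sigma ^+ 2 * expR (tau * t) ^+ 2 = S ^+ 2 by rewrite exprMn.
  rewrite SE in Hz Hz'.
  have zt : N (z t) <= 2 * S.
    rewrite -ler_sqr ?nnegrE ?normc_ge0 ?mulr_ge0 ?(ltW S0)//.
    have k2 : 0 < N k ^+ 2 by rewrite exprn_gt0.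
    rewrite -(ler_pM2l k2); apply: le_trans Hz _.
    have := mulr_ge0 (ltW k2) (sqr_ge0 S); nra.
  have uS : N u <= 2 * N k * S.
    rewrite -ler_sqr ?nnegrE ?normc_ge0 ?mulr_ge0 ?(ltW S0) ?(ltW Nk0)//.
    apply: le_trans ut (le_trans (energy_bound01 t01) _).
    by rewrite E0 SE (_ : (2 * N k * S) ^+ 2 = 4 * N k ^+ 2 * S ^+ 2) //; ring.
  have -> : coupling_cst * N k * expR (2 * tau * t) =
      2 * sigma * (2 * N k * S * (2 * S)).
    have -> : expR (2 * tau * t) = expR (tau * t) ^+ 2 by rewrite -mulrA expRM_natl.
    by rewrite /coupling_cst /S; ring.
  by rewrite ler_wpM2l ?mulr_ge0// ler_pM ?normc_ge0.
have e1 : expR tau ^+ 2 = expR (2 * tau * 1) by rewrite mulr1 expRM_natl.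
have t1 (t : R) : 0 <= t <= 1 -> 0 <= t <= 1 by [].
have XE t : N (outgoing t) ^+ 2 <= energy t by rewrite lerDl exprn_ge0 ?normc_ge0.
have YE t : N (incoming t) ^+ 2 <= energy t by rewrite lerDr exprn_ge0 ?normc_ge0.
split.
  have := @gronwall _ _ (2 * tau) (coupling_cst * N k) 1
    (primitive_normc_sqr outgoing_deriv) ler01.
  rewrite e1 out0 Normc.normc0 expr0n/= add0r mulr1 mulr1; apply => t t01.
  rewrite outgoing_dens; have := coup t (outgoing t) t01 (XE t).
  have : 0 <= tau * N (outgoing t) ^+ 2 by rewrite mulr_ge0// exprn_ge0 ?normc_ge0.
  rewrite ler_norml; lra.
have := @gronwall _ _ (2 * tau) (coupling_cst * N k) 1
  (primitiveN (primitive_normc_sqr incoming_deriv)) ler01.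
rewrite e1 inc0 mulr1 => H.
suff : - N (incoming 1) ^+ 2 <= (- (4 * N k ^+ 2) + coupling_cst * N k) * expR (2 * tau * 1) by lra.
apply: H => t t01.
rewrite incoming_dens; have := coup t (incoming t) t01 (YE t).
rewrite ler_norml; lra.
Qed.

End Solution.

Section JostBounds.
Context (q : R -> R) (sigma : R) (S : @solution_pair R).
Context (qs : forall x, `|q x| <= sigma) (fS : fundamental q S).
Local Notation G := (coupling_cst sigma).

Lemma reversed_jost k : schrodinger (fun x => q (1 - x)) k
  (fun x => jost S (1 - x) k) (fun x => - jost' S (1 - x) k).
Proof. exact: (schrodinger_reflect 1 (jost_schrodinger fS k)). Qed.

Lemma jost_scattering_bound k : 1 <= N k -> 0 <= complex.Im k ->
  N ('i * k * jostA S k - jostB S k) ^+ 2 <=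
    G * N k * expR (complex.Im k) ^+ 2 /\
  (4 * N k ^+ 2 - G * N k) * expR (complex.Im k) ^+ 2 <=
    N ('i * k * jostA S k + jostB S k) ^+ 2.
Proof.
move=> k1 Ik; have [f1 f1'] := jost_at1 fS k; have [f0 f0'] := jost_at0 fS k.
have [||+ +] := scattering_bound (fun x => qs (1 - x)) (reversed_jost k) k1 Ik.
- by rewrite subr0.
- by rewrite subr0 f1'.
rewrite /outgoing /incoming subrr f0 f0' => H1 H2.
split; first by rewrite addrC in H1.
have -> : 'i * k * jostA S k + jostB S k = - (- jostB S k - 'i * k * jostA S k).
  by ring.
by rewrite normcN.
Qed.

Lemma jost_energy0 k : energy k (fun x => jost S (1 - x) k)
  (fun x => - jost' S (1 - x) k) 0 = 4 * N k ^+ 2.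
Proof.
have [f1 f1'] := jost_at1 fS k.
rewrite energyE subr0 f1 f1' normcN Normc.normcM normc_i Normc.normc1; ring.
Qed.

Lemma jost_bound k x : 1 <= N k -> 0 <= complex.Im k -> 0 <= x <= 1 ->
  N (jost S x k) <= 2 * expR sigma * expR (complex.Im k * (1 - x)) /\
  N (jost' S x k) <= 2 * N k * expR sigma * expR (complex.Im k * (1 - x)).
Proof.
move=> k1 Ik x01; have x01' : 0 <= 1 - x <= 1 by lra.
have [] := solution_bound (fun x => qs (1 - x)) (reversed_jost k) k1 Ik x01'.
rewrite jost_energy0 subKr normcN.
have k0 : 0 < N k by exact: lt_le_trans k1.
have k2 : 0 < N k ^+ 2 by rewrite exprn_gt0.
set e := expR (complex.Im k * (1 - x)); set s := expR sigma => H1 H2.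
have e0 : 0 < e by exact: expR_gt0.
have s0 : 0 < s by exact: expR_gt0.
have se : 0 <= N k ^+ 2 * (s ^+ 2 * e ^+ 2) by rewrite !mulr_ge0 ?exprn_ge0 ?ltW.
split; rewrite -ler_sqr ?nnegrE ?normc_ge0 ?mulr_ge0 ?(ltW e0) ?(ltW s0) ?(ltW k0)//.
  by rewrite -(ler_pM2l k2); apply: le_trans H1 _; move: se; rewrite !exprMn; lra.
by apply: le_trans H2 _; move: se; rewrite !exprMn; lra.
Qed.

Lemma sol_sin_bound k x : 1 <= N k -> 0 <= complex.Im k -> 0 <= x <= 1 ->
  N k * N (sol_sin S x k) <= expR sigma * expR (complex.Im k * x).
Proof.
move=> k1 Ik x01; have [/(_ k)[_ hp] /(_ k)[_ _ p0 p0'] _] := fS.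
have [] := solution_bound qs hp k1 Ik x01.
rewrite energyE p0 p0' Normc.normc0 Normc.normc1 => + _.
rewrite expr1n expr0n/= mulr0 addr0 mulr1 divff// mul1r -!exprMn.
by rewrite ler_sqr// nnegrE mulr_ge0 ?normc_ge0 ?expR_ge0.
Qed.

Lemma coupling_cst_ge0 : 0 <= G.
Proof.
by rewrite !mulr_ge0 ?exprn_ge0 ?expR_ge0//; exact: le_trans (qs 0).
Qed.

Lemma jost_impedance (e : R) : 0 < e -> exists K, forall k, 0 <= complex.Im k ->
  K <= N k -> N ('i * k * jostA S k - jostB S k) <= e * N k * expR (complex.Im k).
Proof.
move=> e0; exists (1 + G / e ^+ 2) => k Ik Kk.
have e2 : 0 < e ^+ 2 by rewrite exprn_gt0.
have Ge : 0 <= G / e ^+ 2 by rewrite divr_ge0 ?coupling_cst_ge0// ltW.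
have k1 : 1 <= N k by lra.
have k0 : 0 < N k by lra.
have [H _] := jost_scattering_bound k1 Ik.
rewrite -ler_sqr ?nnegrE ?normc_ge0 ?mulr_ge0 ?expR_ge0 ?(ltW e0) ?(ltW k0)//.
apply: le_trans H _; rewrite exprMn ler_wpM2r ?exprn_ge0 ?expR_ge0//.
rewrite exprMn [N k ^+ 2]expr2 mulrA ler_wpM2r ?(ltW k0)//.
by rewrite mulrC -ler_pdivrMr//; lra.
Qed.

Lemma jostA_lower : exists2 K, 1 <= K & forall k, 0 <= complex.Im k -> K <= N k ->
  4 * N ('i * k * jostA S k - jostB S k) <= N k * expR (complex.Im k) /\
  3 * expR (complex.Im k) <= 4 * N (jostA S k).
Proof.
(* For |k| >= 16 G the outgoing part is at most |k| E / 4, and the incoming part at least 7 |k| E /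
   4, since 49 / 16 <= 4 - 1 / 16. Their sum is 2 i k A, whence |A| >= 3 E / 4. *)
have G0 := coupling_cst_ge0; exists (1 + 16 * G) => [|k Ik Kk]; first lra.
have k1 : 1 <= N k by lra.
have k0 : 0 < N k by lra.
have [H1 H2] := jost_scattering_bound k1 Ik.
set E := expR (complex.Im k) in H1 H2 *.
have E0 : 0 < E by exact: expR_gt0.
have kE : 0 < N k * E by rewrite mulr_gt0.
set out := 'i * k * _ - _ in H1 *; set inc := 'i * k * _ + _ in H2.
have GE : 16 * (G * N k * E ^+ 2) <= (N k * E) ^+ 2.
  have Gk : 16 * G <= N k by lra.
  have NE : 0 <= N k * E ^+ 2 by rewrite mulr_ge0 ?exprn_ge0 ?ltW.
  by have := ler_wpM2r NE Gk; move: (G) => g; rewrite exprMn expr2; lra.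
have out_le : 4 * N out <= N k * E.
  rewrite -ler_sqr ?nnegrE ?mulr_ge0 ?normc_ge0 ?(ltW E0) ?(ltW k0)//.
  apply: (le_trans _ GE).
  have -> : (4 * N out) ^+ 2 = 16 * N out ^+ 2 by ring.
  by rewrite ler_pM2l.
have inc_ge : 7 * (N k * E) <= 4 * N inc.
  rewrite -ler_sqr ?nnegrE ?mulr_ge0 ?normc_ge0 ?(ltW E0) ?(ltW k0)//.
  have -> : (4 * N inc) ^+ 2 = 16 * N inc ^+ 2 by ring.
  have -> : (7 * (N k * E)) ^+ 2 = 49 * (N k * E) ^+ 2 by ring.
  have := sqr_ge0 (N k * E); move: H2 GE; rewrite mulrBl !exprMn; lra.
split => //; rewrite -(ler_pM2l k0).
have : 2 * (N k * N (jostA S k)) = N (inc + out).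
  have -> : inc + out = 2%:C * ('i * k * jostA S k).
    by rewrite /inc /out rmorphMn rmorph1; ring.
  by rewrite !Normc.normcM normc_real normc_i mul1r ger0_norm// mulrA.
have := ler_distD_normc inc (- out); rewrite opprK normcN; lra.
Qed.

End JostBounds.
End Bounds.

Section PairBounds.
Context {R : realType}.
Local Notation C := R[i].
Local Notation N z := (Normc.normc z).
Context (q p : R -> R) (sigma : R) (S T : @solution_pair R).
Context (qs : forall x, `|q x| <= sigma) (ps : forall x, `|p x| <= sigma).
Context (fS : fundamental q S) (fT : fundamental p T).

(** With b = i k A - B for each side, W = - 2 i k A_S A_T + A_S b_T + A_T b_S, and |b| <= |k| |A| /
    3 for large |k| by [jostA_lower]. *)
Lemma jostW_lower : exists2 K, 1 <= K & forall k : C, 0 <= complex.Im k -> K <= N k ->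
  [/\ N k * (N (jostA S k) * N (jostA T k)) <= N (jostW S T k),
      3 * expR (complex.Im k) <= 4 * N (jostA S k) &
      3 * expR (complex.Im k) <= 4 * N (jostA T k)].
Proof.
have [K1 K11 H1] := jostA_lower qs fS; have [K2 K21 H2] := jostA_lower ps fT.
exists (Num.max K1 K2) => [|k Ik]; first by rewrite le_max K11.
rewrite ge_max => /andP[/(H1 k Ik)[b1 a1] /(H2 k Ik)[b2 a2]]; split => //.
set E := expR _ in b1 b2 a1 a2.
have E0 : 0 < E by exact: expR_gt0.
set b := 'i * k * jostA S k - jostB S k in b1.
set b' := 'i * k * jostA T k - jostB T k in b2.
have WE : jostW S T k = - (2%:C * ('i * k * (jostA S k * jostA T k)) -
    (jostA S k * b' + jostA T k * b)).
  by rewrite /jostW /b /b' rmorphMn rmorph1; ring.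
rewrite WE normcN; apply: le_trans (ler_distD_normc _ _).
have := le_normcD (jostA S k * b') (jostA T k * b).
rewrite !Normc.normcM normc_real normc_i mul1r ger0_norm//.
have NS := normc_ge0 (jostA S k); have NT := normc_ge0 (jostA T k).
have k0 := normc_ge0 k.
have c1 : 3 * N b <= N k * N (jostA S k).
  have := ler_wpM2l k0 a1; lra.
have c2 : 3 * N b' <= N k * N (jostA T k).
  have := ler_wpM2l k0 a2; lra.
have := ler_wpM2l NS c2; have := ler_wpM2l NT c1.
have := mulr_ge0 k0 (mulr_ge0 NS NT); lra.
Qed.

End PairBounds.

(** * The potential from the data *)

Section DataDeterminesJost.
Context {R : realType}.
Local Notation C := R[i].
Local Notation N z := (Normc.normc z).
Context (q1 q2 p1 p2 : R -> R) (sigma : R) (S1 S2 T1 T2 : @solution_pair R).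
Context (q1s : forall x, `|q1 x| <= sigma) (q2s : forall x, `|q2 x| <= sigma).
Context (p1s : forall x, `|p1 x| <= sigma) (p2s : forall x, `|p2 x| <= sigma).
Context (fS1 : fundamental q1 S1) (fS2 : fundamental q2 S2).
Context (fT1 : fundamental p1 T1) (fT2 : fundamental p2 T2).
Local Notation A1 := (jostA S1).
Local Notation A2 := (jostA S2).
Local Notation D1 := (jostA T1).
Local Notation D2 := (jostA T2).
Local Notation B1 := (jostB S1).
Local Notation B2 := (jostB S2).
Local Notation F1 := (jostB T1).
Local Notation F2 := (jostB T2).
Local Notation W1 := (jostW S1 T1).
Local Notation W2 := (jostW S2 T2).
Context (W1_neq0 : forall k : C, 0 <= complex.Im k -> k != 0 -> W1 k != 0).
Context (W2_neq0 : forall k : C, 0 <= complex.Im k -> k != 0 -> W2 k != 0).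
Context (dataA : forall x : R, 0 < x -> A1 x%:C * W2 x%:C = A2 x%:C * W1 x%:C).
Context (dataD : forall x : R, 0 < x -> D1 x%:C * W2 x%:C = D2 x%:C * W1 x%:C).

Let eA1 := entire_jostA fS1.
Let eA2 := entire_jostA fS2.
Let eD1 := entire_jostA fT1.
Let eD2 := entire_jostA fT2.
Let eB1 := entire_jostB fS1.
Let eB2 := entire_jostB fS2.
Let eF1 := entire_jostB fT1.
Let eF2 := entire_jostB fT2.
Let eW1 := entire_jostW fS1 fT1.
Let eW2 := entire_jostW fS2 fT2.

Lemma entire_eq_pos (h g : C -> C) : entire h -> entire g ->
  (forall x : R, 0 < x -> h x%:C = g x%:C) -> forall k, h k = g k.
Proof.
move=> eh eg hg k; apply/eqP; rewrite -subr_eq0; apply/eqP.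
by apply: (entire_eq0 (entireB eh eg)) => x x0; rewrite hg// subrr.
Qed.

Lemma dataA_entire k : A1 k * W2 k = A2 k * W1 k.
Proof. by apply: (entire_eq_pos (entireM eA1 eW2) (entireM eA2 eW1)). Qed.

Lemma dataD_entire k : D1 k * W2 k = D2 k * W1 k.
Proof. by apply: (entire_eq_pos (entireM eD1 eW2) (entireM eD2 eW1)). Qed.

Lemma pos_neq0 (x : R) : 0 < x -> [/\ 0 <= complex.Im x%:C,
  complex.Re x%:C != 0 & x%:C != 0 :> C].
Proof.
move=> x0; split => //=; first by rewrite gt_eqF.
by rewrite -(rmorph0 (real_complex R)) (inj_eq (@complexI R)) gt_eqF.
Qed.

(** P/Q is the difference of the two Green functions A D / W. It is even because [jostW_odd_part]
    expresses the odd part of each through the data; it is O(1 / x) at 0 by [jostW_ge_real] and O(1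
    / |k|) at infinity by [jostW_lower]. *)
Lemma green_eq k : A1 k * D1 k * W2 k = A2 k * D2 k * W1 k.
Proof.
pose P k := A1 k * D1 k * W2 k - A2 k * D2 k * W1 k.
pose Q k := W1 k * W2 k.
have eP : entire P by apply: entireB; do 2 apply: entireM => //.
have eQ : entire Q by apply: entireM.
have Q0 z : 0 <= complex.Im z -> z != 0 -> Q z != 0.
  by move=> Iz z0; rewrite mulf_neq0 ?W1_neq0 ?W2_neq0.
have PQ z : P z * Q (- z) = P (- z) * Q z.
  apply/eqP; rewrite -subr_eq0; apply/eqP.
  have d1 := dataA_entire z; have d2 := dataA_entire (- z).
  have d3 := dataD_entire z; have d4 := dataD_entire (- z).
  have o1 := jostW_odd_part fS1 fT1 z; have o2 := jostW_odd_part fS2 fT2 z.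
  transitivity (W2 z * W2 (- z) * (A1 z * D1 z * W1 (- z) - A1 (- z) * D1 (- z) * W1 z) -
    W1 z * W1 (- z) * (A2 z * D2 z * W2 (- z) - A2 (- z) * D2 (- z) * W2 z)).
    by rewrite /P /Q; ring.
  rewrite o1 o2.
  transitivity (2 * 'i * z * ((A1 z * W2 z) * (A1 (- z) * W2 (- z)) -
     (A2 z * W1 z) * (A2 (- z) * W1 (- z)) + ((D1 z * W2 z) * (D1 (- z) * W2 (- z)) -
     (D2 z * W1 z) * (D2 (- z) * W1 (- z))))); first by ring.
  by rewrite d1 d2 d3 d4 !subrr addr0 mulr0.
have near0 : exists M, forall x : R, 0 < x <= 1 -> x * N (P x%:C) <= M * N (Q x%:C).
  have [M1 M10 hM1] := entire_bounded 1 (entireM eA1 eD1).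
  have [M2 M20 hM2] := entire_bounded 1 (entireM eA2 eD2).
  exists (M1 + M2) => x /andP[x0 x1].
  have Nx : N x%:C <= 1 by rewrite normc_real gtr0_norm.
  have w1 := jostW_ge_real fS1 fT1 x0; have w2 := jostW_ge_real fS2 fT2 x0.
  have h1 := hM1 _ Nx; have h2 := hM2 _ Nx.
  rewrite /P /Q Normc.normcM; set n1 := N (W1 _) in w1 *; set n2 := N (W2 _) in w2 *.
  have := le_normcB (A1 x%:C * D1 x%:C * W2 x%:C) (A2 x%:C * D2 x%:C * W1 x%:C).
  rewrite [N (_ * W2 _)]Normc.normcM [N (_ * W1 _)]Normc.normcM -/n1 -/n2 => H.
  have xn1 : x <= n1 by lra.
  have xn2 : x <= n2 by lra.
  have n10 : 0 <= n1 by exact: normc_ge0.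
  have n20 : 0 <= n2 by exact: normc_ge0.
  have k1 := ler_wpM2r n20 h1; have k2 := ler_wpM2r n10 h2.
  apply: le_trans (ler_wpM2l (ltW x0) (le_trans H (lerD k1 k2))) _.
  have : x * (M1 * n2) <= n1 * (M1 * n2) by rewrite ler_wpM2r// mulr_ge0// ltW.
  have : x * (M2 * n1) <= n2 * (M2 * n1) by rewrite ler_wpM2r// mulr_ge0// ltW.
  lra.
have [K1 K11 H1] := jostW_lower q1s p1s fS1 fT1.
have [K2 K21 H2] := jostW_lower q2s p2s fS2 fT2.
have lim z : 0 <= complex.Im z -> Num.max K1 K2 <= N z ->
    N z * N (P z) <= 2 * N (Q z).
  move=> Iz; rewrite ge_max => /andP[/(H1 z Iz)[h1 _ _] /(H2 z Iz)[h2 _ _]].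
  have := le_normcB (A1 z * D1 z * W2 z) (A2 z * D2 z * W1 z).
  rewrite !Normc.normcM => H.
  apply: le_trans (ler_wpM2l (normc_ge0 z) H) _.
  have := ler_wpM2r (normc_ge0 (W2 z)) h1; have := ler_wpM2r (normc_ge0 (W1 z)) h2.
  lra.
have z1 (z : C) : Num.max K1 K2 <= N z -> 1 <= N z.
  by apply: le_trans; rewrite le_max K11.
have [e e0|c Pc] := even_quotient_cst eP eQ Q0 PQ near0.
  exists (Num.max (Num.max K1 K2) (2 / e)) => z Iz.
  rewrite ge_max => /andP[Kz]; rewrite ler_pdivrMr// => ze.
  have zz := z1 _ Kz; have := lim z Iz Kz; have NQ := normc_ge0 (Q z).
  have z0 : 0 < N z by lra.
  move=> H; rewrite -(ler_pM2l z0); apply: le_trans H _.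
  have : 2 * N (Q z) <= N z * e * N (Q z) by rewrite ler_wpM2r.
  have : 1 * (N z * e * N (Q z)) <= N z * (N z * e * N (Q z)).
    by rewrite ler_wpM2r// !mulr_ge0// ltW.
  lra.
suff c0 : c = 0.
  by apply/eqP; rewrite -subr_eq0; apply/eqP; have := Pc k; rewrite c0 mul0r.
apply: normc_ltP => e e0; pose t := Num.max (Num.max K1 K2) (2 / e).
have t1 : Num.max K1 K2 <= t by rewrite le_max lexx.
have t2 : 2 / e <= t by rewrite le_max lexx orbT.
have t0 : 0 < t by apply: lt_le_trans t1; rewrite lt_max (lt_le_trans _ K11).
have [It _ tn] := pos_neq0 t0.
have Nt : N t%:C = t by rewrite normc_real gtr0_norm.
have := lim _ It; rewrite Nt => /(_ t1); rewrite Pc Normc.normcM mulrA.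
have Qt : 0 < N (Q t%:C) by rewrite normc_gt0 Q0.
by rewrite ler_pM2r// mulrC -ler_pdivlMr// => /le_trans; apply; rewrite ler_pdivrMr// mulrC -ler_pdivrMr.
Qed.

(** D is the quotient of the Green function A D / W by the datum A / W, and A its quotient by D / W.
    For k > 0 no factor vanishes, and the identities extend to all k. *)
Lemma jostA_eq k : [/\ A1 k = A2 k, D1 k = D2 k & W1 k = W2 k].
Proof.
have eqD x : 0 < x -> D1 x%:C = D2 x%:C.
  move=> x0; have [Ix Rx xn] := pos_neq0 x0.
  have AW : A1 x%:C * W2 x%:C != 0.
    by rewrite mulf_neq0 ?W2_neq0 ?(jostA_neq0 fS1).
  apply: (mulfI AW); have := green_eq x%:C; have := dataA x0 => E1 E2.
  transitivity (A1 x%:C * D1 x%:C * W2 x%:C); first by ring.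
  by rewrite E2 E1; ring.
have eqA x : 0 < x -> A1 x%:C = A2 x%:C.
  move=> x0; have [Ix Rx xn] := pos_neq0 x0.
  have DW : D1 x%:C * W2 x%:C != 0.
    by rewrite mulf_neq0 ?W2_neq0 ?(jostA_neq0 fT1).
  apply: (mulfI DW); have := green_eq x%:C; have := dataD x0 => E1 E2.
  transitivity (A1 x%:C * D1 x%:C * W2 x%:C); first by ring.
  by rewrite E2 E1; ring.
split; [exact: entire_eq_pos eA1 eA2 eqA k|exact: entire_eq_pos eD1 eD2 eqD k|].
apply: (entire_eq_pos eW1 eW2) => x x0; have [Ix Rx xn] := pos_neq0 x0.
apply: (mulfI (jostA_neq0 fS1 Ix Rx)).
by rewrite (dataA x0) (eqA x x0).
Qed.

End DataDeterminesJost.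

(** * Derivatives of the Jost solutions at the source *)

Section ImpedanceDifference.
Context {R : realType}.
Local Notation C := R[i].
Local Notation N z := (Normc.normc z).
Context (q1 q2 p1 p2 : R -> R) (sigma : R) (S1 S2 T1 T2 : @solution_pair R).
Context (q1s : forall x, `|q1 x| <= sigma) (q2s : forall x, `|q2 x| <= sigma).
Context (p1s : forall x, `|p1 x| <= sigma) (p2s : forall x, `|p2 x| <= sigma).
Context (fS1 : fundamental q1 S1) (fS2 : fundamental q2 S2).
Context (fT1 : fundamental p1 T1) (fT2 : fundamental p2 T2).
Local Notation A := (jostA S1).
Local Notation D := (jostA T1).
Local Notation B1 := (jostB S1).
Local Notation B2 := (jostB S2).
Local Notation F1 := (jostB T1).
Local Notation F2 := (jostB T2).
Local Notation W := (jostW S1 T1).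
Context (W_neq0 : forall k : C, 0 <= complex.Im k -> k != 0 -> W k != 0).
Context (eqA : forall k, jostA S2 k = A k) (eqD : forall k, jostA T2 k = D k).
Context (eqW : forall k, jostW S2 T2 k = W k).

Lemma impedance_compat k : A k * (F1 k - F2 k) = - (D k * (B1 k - B2 k)).
Proof.
have := eqW k; rewrite /jostW eqA eqD => /eqP; rewrite -subr_eq0 => /eqP H.
apply/eqP; rewrite -subr_eq0; apply/eqP; rewrite -[RHS]H; ring.
Qed.

(** Evenness of (B1 - B2) / A: by [jost_wronskian], the antisymmetric expression B(k) A(-k) - A(k)
    B(-k) is 2 i k for both potentials. *)
Lemma impedance_even k : (B1 k - B2 k) * A (- k) = A k * (B1 (- k) - B2 (- k)).
Proof.
have E1 := jost_wronskian fS1 k; have E2 := jost_wronskian fS2 k.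
apply/eqP; rewrite -subr_eq0; apply/eqP.
rewrite -[RHS](subrr (2 * 'i * k)) -{1}E1 -E2 !eqA; ring.
Qed.

Lemma jostB_bound (q : R -> R) S (k : C) : (forall x, `|q x| <= sigma) ->
  fundamental q S -> 1 <= N k -> 0 <= complex.Im k ->
  N (jostB S k) <= 2 * expR sigma * (N k * expR (complex.Im k)).
Proof.
move=> qs fS k1 Ik; have x01 : 0 <= (0 : R) <= 1 by rewrite lexx ler01.
have [_] := jost_bound qs fS k1 Ik x01.
have [_ ->] := jost_at0 fS k.
by rewrite subr0 mulr1 => /le_trans; apply; rewrite le_eqVlt; apply/orP; left; apply/eqP; ring.
Qed.

(** The quotient of interest is (B1 - B2) / A = - (F1 - F2) / D, but A and D may vanish on the
    imaginary axis. It is therefore written P / W, whose denominator has no zero in the closed upper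
    half-plane except possibly 0. *)
Lemma jostB_diff : exists c, forall k,
  B1 k - B2 k = c * A k /\ F1 k - F2 k = - (c * D k).
Proof.
have eA := entire_jostA fS1; have eD := entire_jostA fT1.
have eB1 := entire_jostB fS1; have eB2 := entire_jostB fS2.
have eF1 := entire_jostB fT1; have eF2 := entire_jostB fT2.
have eW := entire_jostW fS1 fT1.
pose P k := (F1 k - F2 k) * B1 k - (B1 k - B2 k) * F1 k.
have eP : entire P by apply: entireB; apply: entireM => //; exact: entireB.
have PA k : P k * A k = (B1 k - B2 k) * W k.
  transitivity ((A k * (F1 k - F2 k)) * B1 k - (B1 k - B2 k) * (A k * F1 k)).
    by rewrite /P; ring.
  by rewrite impedance_compat /jostW; ring.
have PW k : P k * W (- k) = P (- k) * W k.
  move: k; apply: entire_eq_pos; rewrite ?eP //.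
  - by apply: entireM => //; exact: entire_comp_opp.
  - by apply: entireM => //; exact: entire_comp_opp.
  move=> x x0; have [Ix Rx _] := pos_neq0 x0.
  have Ix' : 0 <= complex.Im (- x%:C) by rewrite /= oppr0.
  have Rx' : complex.Re (- x%:C) != 0 by rewrite /= oppr_eq0.
  have a1 := jostA_neq0 fS1 Ix Rx; have a2 := jostA_neq0 fS1 Ix' Rx'.
  apply: (mulfI (mulf_neq0 a1 a2)).
  transitivity ((P x%:C * A x%:C) * (A (- x%:C) * W (- x%:C))); first by ring.
  rewrite PA; transitivity ((B1 x%:C - B2 x%:C) * A (- x%:C) * (W x%:C * W (- x%:C))).
    by ring.
  rewrite impedance_even.
  transitivity ((P (- x%:C) * A (- x%:C)) * (A x%:C * W x%:C)); last by ring.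
  by rewrite PA; ring.
have near0 : exists M, forall x : R, 0 < x <= 1 -> x * N (P x%:C) <= M * N (W x%:C).
  have [M M0 hM] := entire_bounded 1 eP.
  exists M => x /andP[x0 x1].
  have Nx : N x%:C <= 1 by rewrite normc_real gtr0_norm.
  have w := jostW_ge_real fS1 fT1 x0; have h := hM _ Nx.
  rewrite mulrC; apply: ler_pM; rewrite ?normc_ge0 ?(ltW x0)//; lra.
have [K K1 hK] := jostW_lower q1s p1s fS1 fT1.
have [e e0|c Pc] := even_quotient_cst eP eW W_neq0 PW near0.
  (* The impedance bounds give |P| <= 8 e1 exp sigma |k|^2 E^2 = (e / 4) |k|^2 E^2, and |k| E^2 <=
     (16 / 9) |W| <= 4 |W|. *)
  pose e1 := e / (32 * expR sigma).
  have s0 := expR_gt0 sigma.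
  have e10 : 0 < e1 by rewrite divr_gt0// mulr_gt0.
  have es : 32 * (e1 * expR sigma) = e by rewrite /e1; field; rewrite gt_eqF.
  have [L1 h1] := jost_impedance q1s fS1 e10; have [L2 h2] := jost_impedance q2s fS2 e10.
  have [L3 h3] := jost_impedance p1s fT1 e10; have [L4 h4] := jost_impedance p2s fT2 e10.
  exists (Num.max K (Num.max (Num.max L1 L2) (Num.max L3 L4))) => k Ik.
  rewrite !ge_max => /andP[Kk /andP[/andP[k1 k2] /andP[k3 k4]]].
  have [w a d] := hK k Ik Kk; have Nk1 : 1 <= N k by lra.
  have {}h1 := h1 k Ik k1; have {}h2 := h2 k Ik k2.
  have {}h3 := h3 k Ik k3; have {}h4 := h4 k Ik k4.
  have b := jostB_bound q1s fS1 Nk1 Ik; have f := jostB_bound p1s fT1 Nk1 Ik.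
  set E := expR _ in a d h1 h2 h3 h4 b f; have E0 : 0 < E by exact: expR_gt0.
  set x := e1 * N k * E in h1 h2 h3 h4.
  have hB : N (B1 k - B2 k) <= 2 * x.
    have -> : B1 k - B2 k = ('i * k * jostA S2 k - B2 k) - ('i * k * A k - B1 k).
      by rewrite eqA; ring.
    by apply: le_trans (le_normcB _ _) _; lra.
  have hF : N (F1 k - F2 k) <= 2 * x.
    have -> : F1 k - F2 k = ('i * k * jostA T2 k - F2 k) - ('i * k * D k - F1 k).
      by rewrite eqD; ring.
    by apply: le_trans (le_normcB _ _) _; lra.
  have k0 : 0 < N k by lra.
  set y := 2 * expR sigma * _ in b f.
  have hP : N (P k) <= 4 * x * y.
    apply: le_trans (le_normcB _ _) _; rewrite !Normc.normcM.
    have -> : 4 * x * y = 2 * x * y + 2 * x * y by ring.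
    by apply: lerD; apply: ler_pM; rewrite ?normc_ge0.
  apply: le_trans hP _.
  have -> : 4 * x * y = e / 4 * N k * (N k * E ^+ 2).
    by rewrite -es /x /y; field.
  have : 9 * E ^+ 2 <= 16 * (N (A k) * N (D k)).
    have E30 : 0 <= 3 * E by rewrite mulr_ge0// ltW.
    have := ler_pM E30 E30 a d; lra.
  move=> /(ler_wpM2l (ltW k0)) AD.
  have NE : N k * E ^+ 2 <= 4 * N (W k).
    have : 0 <= N k * E ^+ 2 by rewrite mulr_ge0 ?exprn_ge0// ltW.
    lra.
  have ek : 0 <= e * N k by rewrite mulr_ge0// ltW.
  have := ler_wpM2l ek NE; lra.
have H k : B1 k - B2 k = c * A k.
  move: k; apply: entire_eq_pos; [exact: entireB| |].
    by apply: entireM => //; exact: entire_cst.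
  move=> x x0; have [Ix Rx xn] := pos_neq0 x0.
  by apply: (mulIf (W_neq0 Ix xn)); rewrite -PA Pc; ring.
exists c => k; split => //; move: k.
apply: entire_eq_pos; [exact: entireB| |].
  by apply: entireN; apply: entireM => //; exact: entire_cst.
move=> x x0; have [Ix Rx xn] := pos_neq0 x0.
apply: (mulfI (jostA_neq0 fS1 Ix Rx)).
by rewrite impedance_compat H; ring.
Qed.

End ImpedanceDifference.

(** * The Borg-Marchenko step on [0, 1] *)

Section HalfLine.
Context {R : realType}.
Local Notation C := R[i].
Local Notation N z := (Normc.normc z).
Local Notation mu := (@lebesgue_measure R).

Lemma is_derive_locally0 (F : R -> R) (x d : R) : (forall t, 0 < t < 1 -> F t = 0) ->
  0 < x < 1 -> is_derive x 1 F d -> d = 0.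
Proof.
move=> F0 /andP[x0 x1] dF.
have : is_derive x 1 (cst 0 : R -> R) d.
  apply: near_eq_is_derive dF; near=> t; rewrite F0//; apply/andP; split; near: t.
    exact: lt_nbhsr.
  exact: lt_nbhsl.
by move=> /(@derive_val _ _ _ _ _ _ _) <-; rewrite derive_cst.
Unshelve. all: by end_near. Qed.

Lemma primitive_locally0_ae (F f : R -> R) : primitive F f ->
  (forall t, 0 < t < 1 -> F t = 0) -> {ae mu, forall x, 0 < x < 1 -> f x = 0}.
Proof.
move=> hF F0; have := primitive_ae_derive hF.
apply: (@filterS _ _ (ae_filter_ringOfSetsType mu)) => x dF x01.
exact: is_derive_locally0 F0 x01 dF.
Qed.

Lemma cprimitive_locally0_ae (F f : R -> C) : cprimitive F f ->
  (forall t, 0 < t < 1 -> F t = 0) -> {ae mu, forall x, 0 < x < 1 -> f x = 0}.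
Proof.
move=> [rF iF] F0.
have r0 : {ae mu, forall x, 0 < x < 1 -> rpart f x = 0}.
  by apply: (primitive_locally0_ae rF) => t /F0; rewrite /rpart => ->.
have i0 : {ae mu, forall x, 0 < x < 1 -> ipart f x = 0}.
  by apply: (primitive_locally0_ae iF) => t /F0; rewrite /ipart => ->.
have [a ar] := (r0, i0).
apply: (@filterS2 _ _ (ae_filter_ringOfSetsType mu)) a ar => x H1 H2 x01.
by apply: eq_ReIm; [exact: H1|exact: H2].
Qed.

Lemma cprimitive_locally0 (F f g : R -> C) (x : R) : cprimitive F f -> cprimitive f g ->
  (forall t, 0 < t < 1 -> F t = 0) -> 0 < x < 1 -> f x = 0.
Proof.
move=> [rF iF] [rf if_] F0 x01.
have dr := primitive_derive rF (@primitive_continuous _ _ _ rf x).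
have di := primitive_derive iF (@primitive_continuous _ _ _ if_ x).
apply: eq_ReIm.
  by apply: (is_derive_locally0 _ x01 dr) => t /F0; rewrite /rpart => ->.
by apply: (is_derive_locally0 _ x01 di) => t /F0; rewrite /ipart => ->.
Qed.

Context (q1 q2 : R -> R) (sigma : R) (S1 S2 : @solution_pair R) (c : C).
Context (q1s : forall x, `|q1 x| <= sigma) (q2s : forall x, `|q2 x| <= sigma).
Context (fS1 : fundamental q1 S1) (fS2 : fundamental q2 S2).
Context (eqA : forall k, jostA S2 k = jostA S1 k).
Context (diffB : forall k, jostB S1 k - jostB S2 k = c * jostA S1 k).

(** The quotient (s_1 f_2 - s_2 f_1) / f(0) with its denominator removed: since f_j / f(0) = cos_j +
    (B_j / A) s_j, the identity B1 / A - B2 / A = c leaves an entire function. *)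
Definition cross x k := sol_sin S1 x k * sol_cos S2 x k -
  sol_sin S2 x k * sol_cos S1 x k - c * (sol_sin S1 x k * sol_sin S2 x k).

Lemma cross_jost x k : jostA S1 k * cross x k =
  sol_sin S1 x k * jost S2 x k - sol_sin S2 x k * jost S1 x k.
Proof.
transitivity (sol_sin S1 x k * (jostA S1 k * sol_cos S2 x k) -
  sol_sin S2 x k * (jostA S1 k * sol_cos S1 x k) -
  (c * jostA S1 k) * (sol_sin S1 x k * sol_sin S2 x k)); first by rewrite /cross; ring.
by rewrite -diffB /jost eqA; ring.
Qed.

(* Both sol_sin * jost products are O(1/k) in the upper half plane while jostA is
   bounded below by exp (Im k), so the entire even function cross is O(1/k). *)
Lemma cross_eq0 x k : 0 <= x <= 1 -> cross x k = 0.
Proof.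
move=> x01.
have [_ _ /(_ x)[e1 _ e2 _]] := fS1; have [_ _ /(_ x)[e3 _ e4 _]] := fS2.
have eh : entire (cross x).
  by do 2 (apply: entireB; last (by apply: entireM => //;
    try exact: entire_cst; exact: entireM)); exact: entireM.
have even z : cross x (- z) = cross x z.
  have [h1 _ h2 _] := sol_even fS1 x z; have [h3 _ h4 _] := sol_even fS2 x z.
  by rewrite /cross h1 h2 h3 h4.
have one0 (z : C) : 0 <= complex.Im z -> z != 0 -> (1 : C) != 0.
  by move=> _ _; exact: oner_neq0.
have [K K1 hK] := jostA_lower q1s fS1.
(* The two products contribute 4 s^2 E together, with s = exp sigma, and E <= (4 / 3) |A|; 16 / 3 is
   rounded up to 6. *)
pose M := 6 * expR sigma ^+ 2.
have M0 : 0 < M by rewrite mulr_gt0// exprn_gt0// expR_gt0.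
have lim z : 0 <= complex.Im z -> K <= N z -> N z * N (cross x z) <= M.
  move=> Iz Kz; have [_ a] := hK z Iz Kz; have z1 : 1 <= N z by lra.
  have [j1 _] := jost_bound q1s fS1 z1 Iz x01.
  have [j2 _] := jost_bound q2s fS2 z1 Iz x01.
  have s1 := sol_sin_bound q1s fS1 z1 Iz x01.
  have s2 := sol_sin_bound q2s fS2 z1 Iz x01.
  set E := expR (complex.Im z) in a.
  have E0 : 0 < E by exact: expR_gt0.
  have EE : expR (complex.Im z * x) * expR (complex.Im z * (1 - x)) = E.
    by rewrite -expRD; congr expR; ring.
  set s := expR sigma in j1 j2 s1 s2.
  set f := expR (_ * x) in s1 s2 EE; set g := expR (_ * (1 - x)) in j1 j2 EE.
  have nA : 0 < N (jostA S1 z) by lra.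
  rewrite -(ler_pM2l nA) mulrCA -Normc.normcM cross_jost.
  apply: le_trans (ler_wpM2l (normc_ge0 z) (le_normcB _ _)) _.
  rewrite !Normc.normcM mulrDr !mulrA.
  have h1 := ler_pM (mulr_ge0 (normc_ge0 _) (normc_ge0 _)) (normc_ge0 _) s1 j2.
  have h2 := ler_pM (mulr_ge0 (normc_ge0 _) (normc_ge0 _)) (normc_ge0 _) s2 j1.
  apply: le_trans (lerD h1 h2) _.
  have -> : s * f * (2 * s * g) + s * f * (2 * s * g) = 4 * s ^+ 2 * E.
    by rewrite -EE; ring.
  have s20 : 0 <= s ^+ 2 by rewrite exprn_ge0// expR_ge0.
  have := ler_wpM2l s20 a; have := mulr_ge0 s20 (ltW E0); rewrite /M -/s; lra.
have [z| | |c' hc] := even_quotient_cst eh (entire_cst 1) one0.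
- by rewrite even.
- have [B B0 hB] := entire_bounded 1 eh; exists B => y /andP[y0 y1].
  rewrite Normc.normc1 mulr1 -[B]mul1r ler_pM ?normc_ge0 ?(ltW y0)//.
  by apply: hB; rewrite normc_real gtr0_norm.
- move=> e e0; exists (Num.max K (M / e)) => z Iz; rewrite ge_max => /andP[Kz].
  rewrite ler_pdivrMr// => Me; rewrite Normc.normc1 mulr1.
  have z1 : 1 <= N z by lra.
  have z0 : 0 < N z by lra.
  rewrite -(ler_pM2l z0); apply: le_trans (lim z Iz Kz) _.
  by apply: le_trans Me _; rewrite ler_pM2l// ler_peMr// ltW.
suff c0 : c' = 0 by rewrite hc c0 mul0r.
apply: normc_ltP => e e0; pose t := Num.max K (M / e).
have t1 : K <= t by rewrite le_max lexx.
have t2 : M / e <= t by rewrite le_max lexx orbT.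
have t0 : 0 < t by lra.
have [It _ tn] := pos_neq0 t0.
have Nt : N t%:C = t by rewrite normc_real gtr0_norm.
have := lim _ It; rewrite Nt => /(_ t1); rewrite hc mulr1.
move: t2; rewrite ler_pdivrMr// => t2 H.
by rewrite -(ler_pM2l t0); apply: le_trans H t2.
Qed.

(** The single value k = 0 suffices. There [cross] = 0 says that the fundamental pairs (a, b) of q1
    and (u, v) of q2 have the same ratio, and equal Wronskians make the pairs equal. Comparing
    second derivatives, q1 - q2 kills both a and b, which have no common zero. *)
Lemma potential_eq_half : {ae mu, forall x, 0 < x < 1 -> q1 x = q2 x}.
Proof.
pose k : C := 0.
pose a x := sol_cos S1 x k; pose a' x := sol_cos' S1 x k.
pose b x := sol_sin S1 x k; pose b' x := sol_sin' S1 x k.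
pose v x := sol_sin S2 x k; pose v' x := sol_sin' S2 x k.
pose u x := sol_cos S2 x k + (- c) * v x; pose u' x := sol_cos' S2 x k + (- c) * v' x.
have [/(_ k)[ha hb] /(_ k)[a0 a0' b0 b0'] _] := fS1.
have [/(_ k)[hu0 hv] /(_ k)[u0 u0' v0 v0'] _] := fS2.
have hu : schrodinger q2 k u u' by exact: schrodingerD hu0 (schrodingerZ _ hv).
have Wab x : a x * b' x - a' x * b x = 1 by exact: sol_wronskian fS1 x k.
have Wuv x : u x * v' x - u' x * v x = 1.
  by rewrite /u /u' -[RHS](sol_wronskian fS2 x k) /v /v'; ring.
have X x : 0 < x < 1 -> b x * u x - v x * a x = 0.
  move=> /andP[x0 x1]; rewrite -[RHS](@cross_eq0 x k); last by rewrite !ltW.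
  by rewrite /cross /u /v /a /b; ring.
have hX := cprimitiveB (cprimitiveM hb.1 hu.1) (cprimitiveM hv.1 ha.1).
have hX' := cprimitiveB (cprimitiveD (cprimitiveM hb.2 hu.1) (cprimitiveM hb.1 hu.2))
  (cprimitiveD (cprimitiveM hv.2 ha.1) (cprimitiveM hv.1 ha.2)).
have X' x : 0 < x < 1 -> b' x * u x + b x * u' x - (v' x * a x + v x * a' x) = 0.
  exact: cprimitive_locally0 hX hX' X.
(* The vanishing of b u - v a amounts to u = rho a and v = rho b; both Wronskians being 1, rho^2 =
   1. *)
pose rho x := u x * b' x - v x * a' x.
have rho2 x : 0 < x < 1 -> rho x ^+ 2 = 1.
  move=> x01; have E := X x x01; have E' := X' x x01.
  rewrite -[1]mulr1 -{1}(Wab x) -(Wuv x).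
  apply/eqP; rewrite -subr_eq0; apply/eqP.
  transitivity (rho x * (b' x * u x + b x * u' x - (v' x * a x + v x * a' x)) -
    (b x * u x - v x * a x) * (b' x * u' x - a' x * v' x)); last by rewrite E E' mulr0 mul0r subr0.
  by rewrite /rho; ring.
have hrho := cprimitiveB (cprimitiveM hu.1 hb.2) (cprimitiveM hv.1 ha.2).
have rho1 x : 0 < x < 1 -> rho x = 1.
  move=> x01; have [x0 x1] := andP x01.
  have /eqP := rho2 x x01; rewrite -subr_eq0 subr_sqr_1 mulf_eq0 subr_eq0 addr_eq0.
  case/orP => /eqP // rhoN.
  (* A continuous function with square 1 that starts from rho(0) = 1 cannot reach -1 without
     vanishing in between. *)
  have cr : {within `[0, x], continuous (rpart rho)}.
    exact/continuous_subspaceT/(primitive_continuous hrho.1).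
  have r0 : rpart rho 0 = 1.
    by rewrite /rpart /rho /u /a' /v /b' u0 v0 b0' mulr0 addr0 mulr1 mul0r subr0.
  have r1 : rpart rho x = -1 by rewrite /rpart rhoN.
  have [|t] := @IVT _ (rpart rho) 0 x 0 (ltW x0) cr.
    rewrite r0 r1; apply/andP; split.
      by rewrite ge_min; apply/orP; right; lra.
    by rewrite le_max; apply/orP; left; lra.
  rewrite in_itv/= => /andP[t0 tx] rt.
  have [t00|tn0] := eqVneq t 0; first by move: rt; rewrite t00 r0 => /eqP; rewrite oner_eq0.
  have tp : 0 < t by move: t0; rewrite le_eqVlt eq_sym (negbTE tn0).
  have t01 : 0 < t < 1 by rewrite tp (le_lt_trans tx x1).
  have /eqP := rho2 t t01; rewrite -subr_eq0 subr_sqr_1 mulf_eq0 subr_eq0 addr_eq0.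
  by case/orP => /eqP E; move: rt; rewrite /rpart E /= => /eqP;
    rewrite ?oppr_eq0 oner_eq0.
have ua x : 0 < x < 1 -> u x - a x = 0.
  move=> x01; have E := X x x01; have r1 := rho1 x x01.
  transitivity (u x * (a x * b' x - a' x * b x) - a x * rho x); first by rewrite Wab r1; ring.
  transitivity (- a' x * (b x * u x - v x * a x)); first by rewrite /rho; ring.
  by rewrite E mulr0.
have vb x : 0 < x < 1 -> v x - b x = 0.
  move=> x01; have E := X x x01; have r1 := rho1 x x01.
  transitivity (v x * (a x * b' x - a' x * b x) - b x * rho x); first by rewrite Wab r1; ring.
  transitivity (- b' x * (b x * u x - v x * a x)); first by rewrite /rho; ring.
  by rewrite E mulr0.
have ua' x : 0 < x < 1 -> u' x - a' x = 0.
  exact: cprimitive_locally0 (cprimitiveB hu.1 ha.1) (cprimitiveB hu.2 ha.2) ua.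
have vb' x : 0 < x < 1 -> v' x - b' x = 0.
  exact: cprimitive_locally0 (cprimitiveB hv.1 hb.1) (cprimitiveB hv.2 hb.2) vb.
have Ha := cprimitive_locally0_ae (cprimitiveB hu.2 ha.2) ua'.
have Hb := cprimitive_locally0_ae (cprimitiveB hv.2 hb.2) vb'.
apply: (@filterS2 _ _ (ae_filter_ringOfSetsType mu)) Ha Hb => x Ha Hb x01.
have {}ua : u x = a x by apply/eqP; rewrite -subr_eq0 ua.
have {}vb : v x = b x by apply/eqP; rewrite -subr_eq0 vb.
suff : (q1 x)%:C - (q2 x)%:C = 0.
  by move=> /eqP; rewrite subr_eq0 => /eqP [].
have {}Ha : ((q2 x)%:C - k ^+ 2) * a x - ((q1 x)%:C - k ^+ 2) * a x = 0.
  by rewrite -{1}ua; exact: Ha x01.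
have {}Hb : ((q2 x)%:C - k ^+ 2) * b x - ((q1 x)%:C - k ^+ 2) * b x = 0.
  by rewrite -{1}vb; exact: Hb x01.
transitivity (((q1 x)%:C - (q2 x)%:C) * (a x * b' x - a' x * b x)).
  by rewrite Wab mulr1.
transitivity (- (((q2 x)%:C - k ^+ 2) * a x - ((q1 x)%:C - k ^+ 2) * a x) * b' x +
   (((q2 x)%:C - k ^+ 2) * b x - ((q1 x)%:C - k ^+ 2) * b x) * a' x); first by ring.
by rewrite Ha Hb oppr0 !mul0r addr0.
Qed.

End HalfLine.
Section Uniqueness.
Context {R : realType}.
Local Notation C := R[i].
Local Notation mu := (@lebesgue_measure R).

Lemma ae_reflect (P : R -> Prop) (a : R) : {ae mu, forall x, P x} ->
  {ae mu, forall x, P (a - x)}.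
Proof.
move=> [A [mA A0 PA]]; exists ((fun x => a - x) @^-1` A); split.
- rewrite -[X in measurable X]setTI.
  by apply: (measurable_reflect a) => //; exact: measurableT.
- by rewrite -A0; exact/esym/(lebesgue_measure_reflect a mA).
- by move=> x /= Px; apply: PA.
Qed.

Lemma potential_eq (q1 q2 : R -> R) (sigma : R) (S1 S2 T1 T2 : @solution_pair R) :
  (forall x, `|q1 x| <= sigma) -> (forall x, `|q2 x| <= sigma) ->
  fundamental q1 S1 -> fundamental q2 S2 ->
  fundamental (fun x => q1 (0 - x)) T1 -> fundamental (fun x => q2 (0 - x)) T2 ->
  (forall k : C, 0 <= complex.Im k -> k != 0 -> jostW S1 T1 k != 0) ->
  (forall k : C, 0 <= complex.Im k -> k != 0 -> jostW S2 T2 k != 0) ->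
  (forall x : R, 0 < x -> jostA S1 x%:C * jostW S2 T2 x%:C =
                          jostA S2 x%:C * jostW S1 T1 x%:C) ->
  (forall x : R, 0 < x -> jostA T1 x%:C * jostW S2 T2 x%:C =
                          jostA T2 x%:C * jostW S1 T1 x%:C) ->
  {ae mu, forall x, 0 < `|x| < 1 -> q1 x = q2 x}.
Proof.
move=> q1s q2s fS1 fS2 fT1 fT2 W1 W2 dA dD.
have p1s x : `|q1 (0 - x)| <= sigma by [].
have p2s x : `|q2 (0 - x)| <= sigma by [].
have E := jostA_eq q1s q2s p1s p2s fS1 fS2 fT1 fT2 W1 W2 dA dD.
have eA k : jostA S2 k = jostA S1 k by have [] := E k.
have eD k : jostA T2 k = jostA T1 k by have [] := E k.
have eW k : jostW S2 T2 k = jostW S1 T1 k by have [] := E k.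
have [c hc] := jostB_diff q1s q2s p1s p2s fS1 fS2 fT1 fT2 W1 eA eD eW.
have H1 := potential_eq_half q1s q2s fS1 fS2 eA (fun k => (hc k).1).
have hc' k : jostB T1 k - jostB T2 k = (- c) * jostA T1 k.
  by rewrite (hc k).2 mulNr.
have /(ae_reflect 0) H2 := potential_eq_half p1s p2s fT1 fT2 eD hc'.
apply: (@filterS2 _ _ (ae_filter_ringOfSetsType mu)) H1 H2 => x h1 h2 /andP[x0 x1].
have [xp|xn] := ltP 0 x.
  by apply: h1; move: x1; rewrite gtr0_norm// xp.
by move: h2 x0 x1; rewrite ler0_norm// subKr sub0r => h2 x0 x1; apply: h2; rewrite x0 x1.
Qed.

End Uniqueness.

(** * Mollification *)

Section Smooth.
Context {R : realType}.
Implicit Types (F : nat -> R -> R) (f g : R -> R) (x t : R).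
Local Notation mu := (@lebesgue_measure R).

(** A smooth function is carried together with all its derivatives, so that constructions act on
    every order at once. *)
Definition smooth_family F := forall n x, is_derive x 1 (F n) (F n.+1 x).

Lemma smooth_continuous F n : smooth_family F -> continuous (F n).
Proof.
move=> sF x; apply: differentiable_continuous; apply/derivable1_diffP.
exact: (@ex_derive _ _ _ _ _ _ _ (sF n x)).
Qed.

Lemma smooth_primitive F n : smooth_family F -> primitive (F n) (F n.+1).
Proof.
by move=> sF; apply: derive_primitive; [exact: sF|exact: smooth_continuous].
Qed.

Lemma smooth_derive1n F n : smooth_family F -> derive1n n (F 0%N) = F n.
Proof.
move=> sF; elim: n => [//|n ih].
rewrite derive1nS ih; apply/funext => x.
by rewrite derive1E; exact: (@derive_val _ _ _ _ _ _ _ (sF n x)).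
Qed.

Lemma derive1n_zero n : derive1n n (fun=> 0 : R) = (fun=> 0).
Proof.
elim: n => [//|n ih]; rewrite derive1nS ih; apply/funext => x.
by rewrite derive1E derive_cst.
Qed.

Lemma smooth_test_function F : smooth_family F ->
  (exists M, forall x, M < `|x| -> F 0%N x = 0) ->
  test_function (fun x => (F 0%N x)%:C).
Proof.
move=> sF [M hM]; split=> [n x|]; last by exists M => x /hM ->.
have r : rpart (fun x => (F 0%N x)%:C) = F 0%N by [].
have i : ipart (fun x => (F 0%N x)%:C) = (fun=> 0) by [].
rewrite /cderivable /cderiven r i smooth_derive1n// derive1n_zero; split.
  exact: (@ex_derive _ _ _ _ _ _ _ (sF n x)).
exact: derivable_cst.
Qed.

Lemma smooth_cderiven F n x : smooth_family F ->
  cderiven n (fun x => (F 0%N x)%:C) x = (F n x)%:C.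
Proof.
move=> sF; rewrite /cderiven.
have r : rpart (fun x => (F 0%N x)%:C) = F 0%N by [].
have i : ipart (fun x => (F 0%N x)%:C) = (fun=> 0) by [].
by rewrite r i smooth_derive1n// derive1n_zero.
Qed.

Lemma is_derive_affine f x a b d : is_derive (a * x + b) 1 f d ->
  is_derive x 1 (fun t => f (a * t + b)) (a * d).
Proof.
move=> df.
have d0 : is_derive x 1 (fun t : R => a * t) (a *: 1) by apply: is_deriveZ.
have d1 : is_derive x 1 (fun t : R => a * t + b) (a *: 1 + 0) by apply: is_deriveD.
have := @is_derive1_comp _ f (fun t : R => a * t + b) x _ _ df d1.
by rewrite /GRing.scale/= mulr1 addr0 mulrC.
Qed.

Lemma smooth_affine F a b c : smooth_family F ->
  smooth_family (fun n x => c * a ^+ n * F n (a * x + b)).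
Proof.
move=> sF n x; have d := is_derive_affine (sF n (a * x + b)).
rewrite exprSr mulrA -mulrA.
exact: (is_deriveZ (c * a ^+ n) d).
Qed.

(* This family is stable under differentiation. *)
Definition bump (p : {poly R}) m x :=
  if `|x| < 1 then p.[x] * (1 - x ^+ 2) ^- m * expR (- (1 - x ^+ 2)^-1) else 0.

Definition bump_deriv (p : {poly R}) m : {poly R} :=
  p^`() * (1 - 'X ^+ 2) ^+ 2 + (2 * m%:R)%:P * 'X * (1 - 'X ^+ 2) * p - 2%:P * 'X * p.

(** With w = 1 - x^2, exp (1 / w) >= w^-(m + 2) / (m + 2)!, so that two powers of w survive the
    factor w^-m. This is the second order of vanishing that [quadratic_is_derive] requires at the
    points of modulus 1. *)
Lemma bump_le p m : exists2 C : R, 0 <= C & forall x,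
  `|bump p m x| <= C * (1 - x ^+ 2) ^+ 2 /\ (1 <= `|x| -> bump p m x = 0).
Proof.
have [M M0 hM] : exists2 M : R, 0 <= M & forall x, `|x| < 1 -> `|p.[x]| <= M.
  have cp : continuous (fun x => p.[x]) by exact: continuous_horner.
  have [_ /(_ 1)[M hM]] := continuous_locally_bounded cp.
  exists M => [|x x1]; last by apply: hM; exact: ltW.
  by apply: le_trans (hM 0 _); rewrite ?normr_ge0// normr0.
exists (M * (m.+2)`!%:R) => [|x]; first by rewrite mulr_ge0.
split; last by rewrite /bump ltNge => ->.
rewrite /bump; case: ifPn => [x1|_]; last first.
  by rewrite normr0; apply: mulr_ge0; [apply: mulr_ge0|apply: sqr_ge0].
have w0 : 0 < 1 - x ^+ 2.
  by rewrite subr_gt0 -real_normK ?num_real// expr_lt1.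
set w := 1 - x ^+ 2 in w0 *.
have e1 : w^-1 ^+ m.+2 / (m.+2)`!%:R <= expR w^-1.
  by have := @expR_ge1Dxn R w^-1 m.+1; rewrite invr_ge0 (ltW w0) => /(_ isT); lra.
have f0 : 0 < (m.+2)`!%:R :> R by rewrite ltr0n fact_gt0.
have e2 : expR (- w^-1) <= (m.+2)`!%:R * w ^+ m.+2.
  have wp : 0 < w ^+ m.+2 by rewrite exprn_gt0.
  rewrite expRN -[(_)^-1]mul1r ler_pdivrMr ?expR_gt0//.
  have := ler_wpM2l (ltW (mulr_gt0 f0 wp)) e1; rewrite exprVn.
  have -> : (m.+2)`!%:R * w ^+ m.+2 * ((w ^+ m.+2)^-1 / (m.+2)`!%:R) = 1.
    by field; rewrite !gt_eqF.
  by [].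
have wm : 0 < w ^+ m by rewrite exprn_gt0.
rewrite !normrM normfV (ger0_norm (expR_ge0 _)) (ger0_norm (ltW wm)).
have -> : M * (m.+2)`!%:R * w ^+ 2 = M * (w ^+ m)^-1 * ((m.+2)`!%:R * w ^+ m.+2).
  rewrite -[m.+2]addn2 exprD; field; exact: lt0r_neq0.
apply: ler_pM; rewrite ?expR_ge0// ?mulr_ge0 ?invr_ge0 ?(ltW wm)//.
by apply: ler_wpM2r; rewrite ?invr_ge0 ?(ltW wm)// hM.
Qed.

Lemma is_derive_exprn (f : R -> R) m (x d : R) : is_derive x 1 f d ->
  is_derive x 1 (fun t => f t ^+ m) (m%:R * f x ^+ m.-1 * d).
Proof.
move=> df; elim: m => [|m ih].
  rewrite !mul0r; exact: is_derive_cst.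
have d' := is_deriveM df ih.
have -> : m.+1%:R * f x ^+ m.+1.-1 * d = f x *: (m%:R * f x ^+ m.-1 * d) + f x ^+ m *: d.
  rewrite /GRing.scale/= mulrSr; case: m {ih d'} => [|m] /=; last rewrite exprS; ring.
have -> : (fun t => f t ^+ m.+1) = (f * (fun t => f t ^+ m)).
  by apply/funext => t; rewrite exprS.
exact: d'.
Qed.

Lemma bump_is_derive p m x :
  is_derive x 1 (bump p m) (bump (bump_deriv p m) m.+2 x).
Proof.
have [x1|x1|x1] := ltgtP `|x| 1.
- have w0 : 1 - x ^+ 2 != 0.
    by rewrite gt_eqF// subr_gt0 -real_normK ?num_real// expr_lt1.
  pose V t : R := (1 - t ^+ 2)^-1.
  have dw : is_derive x 1 (fun t : R => 1 - t ^+ 2) (- (2 * x)).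
    have d := is_deriveB (is_derive_cst (1 : R) x 1) (is_derive_exprn 2 (is_derive_id x 1)).
    have -> : - (2 * x) = 0 - 2%:R * x ^+ 2.-1 * 1 by rewrite expr1; ring.
    exact: d.
  have dV : is_derive x 1 V (2 * x * V x ^+ 2).
    have d := @is_deriveV R (fun t : R => 1 - t ^+ 2) x _ 1 w0 dw.
    have -> : 2 * x * V x ^+ 2 = - (1 - x ^+ 2) ^- 2 *: - (2 * x).
      by rewrite /GRing.scale/= /V exprVn; ring.
    exact: d.
  have dE : is_derive x 1 (fun t => expR (- V t)) (expR (- V x) * - (2 * x * V x ^+ 2)).
    have d := @is_derive1_comp _ expR (fun t => - V t) x _ _ (is_derive_expR _) (is_deriveN dV).
    exact: d.
  have dG := is_deriveM (is_deriveM (is_derive_poly p x) (is_derive_exprn m dV)) dE.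
  have -> : bump (bump_deriv p m) m.+2 x = (p.[x] * V x ^+ m) *: (expR (- V x) * - (2 * x * V x ^+ 2)) +
     expR (- V x) *: (p.[x] *: (m%:R * V x ^+ m.-1 * (2 * x * V x ^+ 2)) + V x ^+ m *: p^`().[x]).
    have bdE : (bump_deriv p m).[x] = p^`().[x] * (1 - x ^+ 2) ^+ 2 +
        2 * m%:R * x * (1 - x ^+ 2) * p.[x] - 2 * x * p.[x].
      by rewrite /bump_deriv !(hornerD, hornerN, hornerM, hornerC, hornerX, horner_exp).
    rewrite /bump x1 bdE /GRing.scale/= -/(V x) -exprVn -/(V x).
    have Vw : V x * (1 - x ^+ 2) = 1 by rewrite /V mulVf.
    move: Vw; set W := 1 - x ^+ 2; set v := V x => Vw.
    have -> : v ^+ m.+2 = v ^+ m * v ^+ 2 by rewrite -exprD addn2.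
    have -> : m%:R * v ^+ m.-1 * (2 * x * v ^+ 2) = m%:R * (2 * x) * v ^+ m * v :> R.
      by case: (m) => [|l]; [rewrite !mul0r|rewrite /= (exprS _ l); ring].
    have Wv2 : v ^+ 2 * W ^+ 2 = 1 by rewrite -exprMn Vw expr1n.
    have Wv1 : v ^+ 2 * W = v by rewrite expr2 -mulrA Vw mulr1.
    transitivity (expR (- v) * v ^+ m * (p^`().[x] * (v ^+ 2 * W ^+ 2) +
       2 * m%:R * x * (v ^+ 2 * W) * p.[x] - 2 * x * p.[x] * v ^+ 2)); last first.
      by rewrite Wv2 Wv1; ring.
    by ring.
  apply: (near_eq_is_derive _ dG); near=> t.
  rewrite /bump ifT; last by near: t; exact: (cvgr_lt _ (@norm_continuous _ R x) _ x1).
  by rewrite -exprVn.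
- rewrite /bump ltNge (ltW x1)/=.
  apply: (near_eq_is_derive _ (is_derive_cst (0 : R) x 1)); near=> t.
  rewrite /bump ifF//; apply/negbTE; rewrite -leNgt ltW//.
  by near: t; exact: (cvgr_gt _ (@norm_continuous _ R x) _ x1).
- have -> : bump (bump_deriv p m) m.+2 x = 0 by rewrite /bump x1 ltxx.
  have [C C0 hC] := bump_le p m.
  (* For |x| = 1, 1 - t^2 = (x - t) (x + t) with |x + t| <= 3, whence the square 9. *)
  apply: (@quadratic_is_derive _ _ _ _ (9 * C)) => t tx.
  have [_ /(_ _)->] := hC x; last by rewrite x1.
  rewrite mul0r !subr0; have [t1|t1] := leP 1 `|t|.
    have [_ ->//] := hC t; rewrite normr0 mulr_ge0 ?sqr_ge0// mulr_ge0//.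
  have [h _] := hC t; apply: le_trans h _.
  rewrite [9 * C]mulrC -mulrA; apply: ler_wpM2l => //.
  have -> : 9 * (t - x) ^+ 2 = (3 * (t - x)) ^+ 2 by ring.
  have x2 : x ^+ 2 = 1 by rewrite -real_normK ?num_real// x1 expr1n.
  have -> : 1 - t ^+ 2 = (x - t) * (x + t) by rewrite -x2; ring.
  rewrite !exprMn; have -> : 3 ^+ 2 * (t - x) ^+ 2 = (x - t) ^+ 2 * 3 ^+ 2 by ring.
  rewrite ler_wpM2l ?sqr_ge0// -real_normK ?num_real// lerXn2r ?nnegrE//.
  by apply: le_trans (ler_normD _ _) _; rewrite x1; lra.
Unshelve. all: by end_near. Qed.

Fixpoint bump_data n : {poly R} * nat :=
  if n is n'.+1 then
    let pm := bump_data n' in (bump_deriv pm.1 pm.2, pm.2.+2) else (1, 0%N).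

Definition bumps n x := bump (bump_data n).1 (bump_data n).2 x.

Lemma smooth_bumps : smooth_family bumps.
Proof. by move=> n x; exact: bump_is_derive. Qed.

Lemma bumps0 n x : 1 <= `|x| -> bumps n x = 0.
Proof.
by have [C _ /(_ x)[_]] := bump_le (bump_data n).1 (bump_data n).2; exact.
Qed.

Lemma bumps_bound x : 0 <= bumps 0 x <= 1.
Proof.
rewrite /bumps /bump /=; case: ifPn => [x1|_]; last by rewrite lexx ler01.
have w0 : 0 < 1 - x ^+ 2.
  by rewrite subr_gt0 -real_normK ?num_real// expr_lt1.
rewrite hornerC mul1r expr0 invr1 mul1r expR_ge0/= -[X in _ <= X]expR0 ler_expR.
by rewrite oppr_le0 invr_ge0 ltW.
Qed.

Definition bump_mass := integral0 (bumps 0) 1 - integral0 (bumps 0) (-1).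

Lemma bumps_locally_bounded n : locally_bounded (bumps n).
Proof. exact/continuous_locally_bounded/smooth_continuous/smooth_bumps. Qed.

Lemma primitive_bump_mass : primitive (integral0 (bumps 0)) (bumps 0).
Proof. exact/primitive_integral0/bumps_locally_bounded. Qed.

Lemma bump_mass_gt0 : 0 < bump_mass.
Proof.
have hP := primitive_bump_mass; set P := integral0 _ in hP.
have le1 a b : a <= b -> P a <= P b.
  by move=> ab; apply: (primitive_le hP ab) => x _; have /andP[] := bumps_bound x.
(* On [-1/2, 1/2] one has 1 - x^2 >= 1/2, so the bump is at least exp (-2) there. *)
have hQ := primitiveB hP (primitiveZ (expR (-2)) (@primitive_id R)).
have half : P (- 2^-1) - expR (-2) * (- 2^-1) <= P 2^-1 - expR (-2) * 2^-1.
  apply: (primitive_le hQ) => [|x x2]; first lra.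
  rewrite mulr1 subr_ge0 /bumps /bump /= ifT; last by rewrite ltr_norml; lra.
  have w0 : 2^-1 <= 1 - x ^+ 2 by nra.
  rewrite hornerC mul1r expr0 invr1 mul1r ler_expR lerN2.
  by rewrite -[2]invrK lef_pV2 ?posrE//; lra.
rewrite /bump_mass -/P.
have m1 : (2^-1 : R) <= 1 by lra.
have m2 : (-1 : R) <= - 2^-1 by lra.
have := le1 _ _ m1; have := le1 _ _ m2; have := expR_gt0 (-2 : R).
by move: half; lra.
Qed.

Lemma integral_bumps a b : a <= -1 -> 1 <= b ->
  integral0 (bumps 0) b - integral0 (bumps 0) a = bump_mass.
Proof.
move=> a1 b1; have hP := primitive_bump_mass; rewrite /bump_mass.
set P := integral0 _ in hP *.
have z1 t : 1 <= t <= b -> `|bumps 0 t| <= 0.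
  by move=> /andP[t1 _]; rewrite bumps0 ?normr0// (le_trans t1)// ler_norm.
have z2 t : a <= t <= -1 -> `|bumps 0 t| <= 0.
  move=> /andP[_ t1]; rewrite bumps0 ?normr0// -normrN (le_trans _ (ler_norm _))//; lra.
have := primitive_lipschitz hP b1 z1; have := primitive_lipschitz hP a1 z2.
by rewrite !mul0r !normr_le0 !subr_eq0 => /eqP -> /eqP ->.
Qed.

(** The n-th derivative of the bump rescaled to half-width 1 / (m + 1) and integral 1; the summand 0
    gives it the shape of [smooth_affine]. *)
Definition mollifier m n x :=
  m.+1%:R / bump_mass * m.+1%:R ^+ n * bumps n (m.+1%:R * x + 0).

Lemma smooth_mollifier m : smooth_family (mollifier m).
Proof. exact/smooth_affine/smooth_bumps. Qed.

Lemma mollifier0 m n x : m.+1%:R^-1 <= `|x| -> mollifier m n x = 0.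
Proof.
move=> mx; rewrite /mollifier addr0 bumps0 ?mulr0// normrM ger0_norm//.
by rewrite mulrC -ler_pdivrMr// mul1r.
Qed.

Lemma mollifier_bound m x : 0 <= mollifier m 0 x <= m.+1%:R / bump_mass.
Proof.
have /andP[b0 b1] := bumps_bound (m.+1%:R * x + 0).
have c0 : 0 <= m.+1%:R / bump_mass by rewrite divr_ge0 ?(ltW bump_mass_gt0).
by rewrite /mollifier expr0 mulr1 mulr_ge0//= ler_piMr.
Qed.

Lemma Rintegral_le_bound (h : R -> R) a b M : locally_bounded h -> a <= b ->
  (forall t, a <= t <= b -> `|h t| <= M) ->
  `|\int[mu]_(t in `[a, b]) h t| <= M * (b - a).
Proof.
move=> lh ab hM; have hH := primitive_integral0 lh.
by case: (hH) => _ <-//; exact: primitive_lipschitz hH ab hM.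
Qed.

Lemma mollifier_mass m x (L : R) : `|x| + 1 <= L ->
  \int[mu]_(t in `[- L, L]) mollifier m 0 (x - t) = 1.
Proof.
move=> xL; have m0 : 0 < m.+1%:R :> R by rewrite ltr0n.
have M0 := bump_mass_gt0.
pose P t := - bump_mass^-1 * integral0 (bumps 0) (- m.+1%:R * t + m.+1%:R * x).
have dP t : is_derive t 1 P (mollifier m 0 (x - t)).
  have d0 := primitive_derive primitive_bump_mass
    (@smooth_continuous _ 0 smooth_bumps (- m.+1%:R * t + m.+1%:R * x)).
  have d := is_deriveZ (- bump_mass^-1) (is_derive_affine d0).
  have -> : mollifier m 0 (x - t) =
      - bump_mass^-1 *: (- m.+1%:R * bumps 0 (- m.+1%:R * t + m.+1%:R * x)).
    rewrite /mollifier /GRing.scale/= expr0 mulr1 addr0.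
    have -> : m.+1%:R * (x - t) = - m.+1%:R * t + m.+1%:R * x by ring.
    by ring.
  exact: d.
have cP : continuous (fun t => mollifier m 0 (x - t)).
  move=> t; apply: (@continuous_comp _ _ _ (fun t : R => x - t) (mollifier m 0)).
    by apply: cvgB; [exact: cvg_cst|exact: cvg_id].
  exact: (smooth_continuous (smooth_mollifier m)).
have [_ <-] := derive_primitive dP cP; last by have := normr_ge0 x; lra.
have := ler_norm x; have := ler_norm (- x); rewrite normrN => x1 x2.
have m1 : 1 <= m.+1%:R :> R by rewrite ler1n.
have B1 : 1 <= - m.+1%:R * - L + m.+1%:R * x by nra.
have B2 : - m.+1%:R * L + m.+1%:R * x <= -1 by nra.
have := integral_bumps B2 B1; rewrite /P => E.
transitivity (bump_mass^-1 * bump_mass); last by rewrite mulVf// gt_eqF.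
by rewrite -[X in _ = _ * X]E; ring.
Qed.

Lemma smooth_taylor F n (K B s s' : R) : smooth_family F ->
  (forall t, `|t| <= K -> `|F n.+2 t| <= B) -> `|s| <= K -> `|s'| <= K ->
  `|F n s' - F n s - F n.+1 s * (s' - s)| <= B * (s' - s) ^+ 2.
Proof.
move=> sF hB sK s'K.
have h0 := smooth_primitive n sF; have h1 := smooth_primitive n.+1 sF.
have B0 : 0 <= B by exact: le_trans (hB s sK).
have key t : `|t| <= K -> `|t - s| <= `|s' - s| -> `|F n.+1 t - F n.+1 s| <= B * `|s' - s|.
  move=> tK ts; apply: le_trans (primitive_lipschitz_sym h1 hB sK tK) _.
  by rewrite ler_wpM2l.
rewrite -[(s' - s) ^+ 2]real_normK ?num_real// expr2 mulrA.
have [ss|ss] := leP s s'.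
  rewrite [in X in _ <= _ * X](ger0_norm (_ : 0 <= s' - s)) ?subr_ge0//.
  apply: (primitive_approx h0 ss) => t tss; apply: key.
    by move: sK s'K; rewrite !ler_norml; lra.
  by rewrite !ger0_norm ?subr_ge0//; lra.
rewrite -normrN [in X in _ <= _ * X](_ : `|s' - s| = s - s'); last first.
  by rewrite ler0_norm ?opprB// subr_le0 ltW.
have -> : - (F n s' - F n s - F n.+1 s * (s' - s)) = F n s - F n s' - F n.+1 s * (s - s').
  by ring.
apply: (primitive_approx h0 (ltW ss)) => t tss; apply: key.
  by move: sK s'K; rewrite !ler_norml; lra.
by rewrite distrC [`|s' - s|]distrC !ger0_norm ?subr_ge0//; lra.
Qed.
Lemma Rintegral_lin f g a b (c : R) : locally_bounded f -> locally_bounded g ->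
  a <= b -> \int[mu]_(t in `[a, b]) (f t + c * g t) =
  \int[mu]_(t in `[a, b]) f t + c * \int[mu]_(t in `[a, b]) g t.
Proof.
move=> /primitive_integral0 hf /primitive_integral0 hg ab.
case: (hf) => _ <-//; case: (hg) => _ <-//.
by case: (primitiveD hf (primitiveZ c hg)) => _ <-//; ring.
Qed.

Definition conv L f g x := \int[mu]_(t in `[- L, L]) (f (x - t) * g t).

Lemma conv_lb f g x : continuous f -> locally_bounded g ->
  locally_bounded (fun t => f (x - t) * g t).
Proof.
move=> cf lg; apply: locally_boundedM => //.
exact/locally_bounded_reflect/continuous_locally_bounded.
Qed.

(** Differentiation under the integral: the Taylor remainder of [F n] is quadratic in the increment,
    uniformly for t in the window. *)
Lemma smooth_conv L F g : 0 <= L -> smooth_family F -> locally_bounded g ->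
  smooth_family (fun n => conv L (F n) g).
Proof.
move=> L0 sF lg n x; have LL : - L <= L by lra.
have cF j := smooth_continuous (n := j) sF.
have [B B0 hB] := locally_bounded_gt0 (`|x| + 1 + L) (continuous_locally_bounded (cF n.+2)).
have [G G0 hG] := locally_bounded_gt0 L lg.
apply: (@quadratic_is_derive _ _ _ _ (B * G * (2 * L))) => s sx.
have lbF j y := @conv_lb (F j) g y (cF j) lg.
rewrite mulrC -[conv L (F n) g s - _ - _](_ : \int[mu]_(t in `[- L, L])
  (F n (s - t) * g t + -1 * (F n (x - t) * g t + (s - x) * (F n.+1 (x - t) * g t))) = _); last first.
  have l1 := locally_boundedM (locally_bounded_cst (s - x)) (lbF n.+1 x).
  have l2 := locally_boundedD (lbF n x) l1.
  by rewrite (Rintegral_lin (-1) (lbF n s) l2 LL) (Rintegral_lin _ (lbF n x) (lbF n.+1 x) LL) /conv; ring.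
have -> : B * G * (2 * L) * (s - x) ^+ 2 = B * (s - x) ^+ 2 * G * (L - - L) by ring.
apply: Rintegral_le_bound => // [|t tL].
  have l1 := locally_boundedM (locally_bounded_cst (s - x)) (lbF n.+1 x).
  have l2 := locally_boundedM (locally_bounded_cst (-1)) (locally_boundedD (lbF n x) l1).
  exact: (locally_boundedD (lbF n s) l2).
have -> : F n (s - t) * g t + -1 * (F n (x - t) * g t + (s - x) * (F n.+1 (x - t) * g t)) =
  (F n (s - t) - F n (x - t) - F n.+1 (x - t) * ((s - t) - (x - t))) * g t by ring.
have tL' : `|t| <= L by rewrite ler_norml.
rewrite normrM ler_pM// ?hG//.
have -> : (s - x) ^+ 2 = ((s - t) - (x - t)) ^+ 2 by ring.
apply: (smooth_taylor sF hB).
  by apply: le_trans (ler_normB _ _) _; lra.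
have -> : s - t = s - x + (x - t) by ring.
apply: le_trans (ler_normD _ _) _; apply: le_trans (lerD sx (ler_normB _ _)) _; lra.
Qed.

Lemma mollifier_bound1 : exists2 C : R, 0 <= C & forall m x,
  `|mollifier m 1 x| <= C * m.+1%:R ^+ 2.
Proof.
have [C C0 hC] := bump_le (bump_data 1).1 (bump_data 1).2.
have M0 := ltW bump_mass_gt0.
exists (C / bump_mass) => [|m x]; first by rewrite divr_ge0.
set y := m.+1%:R * x + 0; have [b1 b2] := hC y.
have b : `|bumps 1 y| <= C.
  have [/b2 E|y1] := leP 1 `|y|; first by rewrite /bumps E normr0.
  have y2 : 0 <= y ^+ 2 <= 1.
    by rewrite sqr_ge0 -real_normK ?num_real// expr_le1// ltW.
  by apply: le_trans b1 _; rewrite ler_piMr// expr_le1//; lra.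
rewrite /mollifier -/y normrM ger0_norm ?mulr_ge0 ?invr_ge0 ?exprn_ge0//.
have -> : C / bump_mass * m.+1%:R ^+ 2 = m.+1%:R / bump_mass * m.+1%:R ^+ 1 * C by ring.
by rewrite ler_wpM2l// !mulr_ge0 ?invr_ge0 ?exprn_ge0.
Qed.

Lemma mollifier_far m n x t L : `|x| + 1 <= L -> t = L \/ t = - L ->
  mollifier m n (x - t) = 0.
Proof.
move=> xL tL; apply: mollifier0; apply: (@le_trans _ _ 1).
  by rewrite invf_le1 ?ler1n ?ltr0n.
have := ler_norm x; have := ler_norm (- x); rewrite normrN.
by case: tL => ->; [rewrite distrC|] => ? ?; apply: le_trans (ler_norm _); lra.
Qed.

(* Integrating by parts moves the derivative to the mollifier, so that only the
   first-order expansion of the primitive of [g] at [x] matters. *)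
Lemma conv_mollifier_parts m G g x L : primitive G g -> `|x| + 1 <= L ->
  conv L (mollifier m 0) g x - g x =
  \int[mu]_(t in `[- L, L]) (mollifier m 1 (x - t) * (G t - G x - g x * (t - x))).
Proof.
move=> hG xL; have LL : - L <= L by have := normr_ge0 x; lra.
have lg := primitive_lb hG.
have cm n := smooth_continuous (n := n) (smooth_mollifier m).
have lm n := locally_bounded_reflect x (continuous_locally_bounded (cm n)).
have lH := locally_boundedD lg (locally_bounded_cst (- g x)).
have hH : primitive (fun t => G t - G x - g x * (t - x)) (fun t => g t + - g x).
  have h1 := primitiveB hG (primitive_cst (G x)).
  have h2 := primitiveZ (g x) (primitiveB (@primitive_id R) (primitive_cst x)).
  by apply: primitive_eq (primitiveB h1 h2) _ _ => t //; ring.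
have hm := primitive_reflect x (smooth_primitive 0 (smooth_mollifier m)).
have [_ /(_ _ _ LL)] := primitiveM hm hH.
rewrite (mollifier_far m 0 xL (or_introl erefl)) (mollifier_far m 0 xL (or_intror erefl)) !mul0r subrr => E.
have lK := locally_boundedM (lm 1%N) (primitive_locally_bounded hH).
have := Rintegral_lin (-1) (locally_boundedM (lm 0%N) lH) lK LL.
have -> : \int[mu]_(t in `[- L, L]) (mollifier m 0 (x - t) * (g t + - g x) + -1 *
   (mollifier m 1 (x - t) * (G t - G x - g x * (t - x)))) = 0.
  by rewrite E; apply: eq_Rintegral => t _; ring.
have := Rintegral_lin (- g x) (conv_lb x (cm 0%N) lg) (lm 0%N) LL.
rewrite mollifier_mass// => E2.
have -> : \int[mu]_(t in `[- L, L]) (mollifier m 0 (x - t) * (g t + - g x)) =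
  \int[mu]_(t in `[- L, L]) (mollifier m 0 (x - t) * g t + - g x * mollifier m 0 (x - t)).
  by apply: eq_Rintegral => t _; ring.
rewrite E2 -/(conv _ _ _ _) => E3; lra.
Qed.

Lemma derive_approx (f : R -> R) x d (e : R) : is_derive x 1 f d -> 0 < e ->
  \forall m \near \oo, forall t, `|t - x| <= m.+1%:R^-1 ->
    `|f t - f x - d * (t - x)| <= e * `|t - x|.
Proof.
move=> df e0.
have : h^-1 *: (f (h *: 1 + x) - f x) @[h --> 0^'] --> (d : R).
  by rewrite -(@derive_val _ _ _ _ _ _ _ df); exact: (@ex_derive _ _ _ _ _ _ _ df).
move=> /cvgrPdist_le /(_ _ e0) [r /= r0 hr].
near=> m => t tx; have [->|tx0] := eqVneq t x; first by rewrite !subrr mulr0 subrr normr0 mulr0.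
have tr : `|0 - (t - x)| < r.
  rewrite sub0r normrN; apply: le_lt_trans tx _.
  by near: m; apply: near_infty_natSinv_lt (PosNum r0).
have tx1 : t - x != 0 by rewrite subr_eq0.
have := hr _ tr tx1; rewrite /GRing.scale/= mulr1 subrK => h.
have -> : f t - f x - d * (t - x) = - (d - (t - x)^-1 * (f t - f x)) * (t - x) by field.
by rewrite normrM normrN ler_wpM2r.
Unshelve. all: by end_near. Qed.

(** Convergence at each point where the primitive of [g] has derivative g(x), hence almost
    everywhere when [g] is only locally bounded. *)
Lemma conv_cvg G g x (L : R) : primitive G g -> is_derive x 1 G (g x) -> `|x| + 1 <= L ->
  conv L (mollifier m 0) g x @[m --> \oo] --> g x.
Proof.
move=> hG dG xL; have LL : - L <= L by have := normr_ge0 x; lra.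
have [C C0 hC] := mollifier_bound1.
have cm m n := smooth_continuous (n := n) (smooth_mollifier m).
apply/cvgrPdist_le => /= e e0.
(* The derivative of the mollifier is at most C (m + 1)^2 on an interval of length 2 / (m + 1),
   where the expansion error is at most this constant divided by m + 1; the product is 2 C times the
   constant. *)
have e'0 : 0 < e / (2 * C + 1) by rewrite divr_gt0// ltr_wpDl// mulr_ge0.
near=> m; rewrite distrC (conv_mollifier_parts m hG xL).
have m0 : 0 < m.+1%:R :> R by rewrite ltr0n.
set d := m.+1%:R^-1 : R; have d0 : 0 < d by rewrite invr_gt0.
have d1 : d <= 1 by rewrite invf_le1 ?ler1n.
have key : forall t, `|t - x| <= d ->
    `|G t - G x - g x * (t - x)| <= e / (2 * C + 1) * `|t - x|.
  by rewrite /d; near: m; exact: derive_approx.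
pose h t := mollifier m 1 (x - t) * (G t - G x - g x * (t - x)).
rewrite -/h; have lh : locally_bounded h.
  apply: locally_boundedM; first exact/locally_bounded_reflect/continuous_locally_bounded.
  apply: continuous_locally_bounded => t; apply: cvgB; last first.
    by apply: cvgM; [exact: cvg_cst|apply: cvgB; [exact: cvg_id|exact: cvg_cst]].
  by apply: cvgB; [exact: (primitive_continuous hG)|exact: cvg_cst].
have [x1 x2] : - L <= x - d /\ x + d <= L.
  by have := ler_norm x; have := ler_norm (- x); rewrite normrN; split; lra.
have h0 t : d <= `|t - x| -> `|h t| <= 0.
  by move=> tx; rewrite /h mollifier0 ?mul0r ?normr0// distrC.
have xd1 : x - d <= x + d by lra.
rewrite (Rintegral_itv_split lh x1 (le_trans xd1 x2)) (Rintegral_itv_split lh xd1 x2).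
have I1 : `|\int[mu]_(t in `[- L, x - d]) h t| <= 0 * (x - d - - L).
  by apply: Rintegral_le_bound => // t tt; apply: h0; rewrite distrC (le_trans _ (ler_norm _))//; lra.
have I2 : `|\int[mu]_(t in `[x + d, L]) h t| <= 0 * (L - (x + d)).
  by apply: Rintegral_le_bound => // t tt; apply: h0; rewrite (le_trans _ (ler_norm _))//; lra.
have I3 : `|\int[mu]_(t in `[x - d, x + d]) h t| <= C * m.+1%:R ^+ 2 * (e / (2 * C + 1) * d) * (x + d - (x - d)).
  apply: Rintegral_le_bound => // t tt.
  have td : `|t - x| <= d by rewrite ler_norml; lra.
  rewrite normrM ler_pM ?hC// (le_trans (key _ td))// ler_wpM2l// ltW//.
move: I1 I2; rewrite !mul0r !normr_le0 => /eqP -> /eqP ->; rewrite add0r addr0.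
apply: le_trans I3 _.
have -> : C * m.+1%:R ^+ 2 * (e / (2 * C + 1) * d) * (x + d - (x - d)) = (2 * C) / (2 * C + 1) * e.
  by rewrite /d; field; lra.
by rewrite ler_piMl ?(ltW e0)// ler_pdivrMr; lra.
Unshelve. all: by end_near. Qed.

End Smooth.

(** * Outgoing solutions *)

Section WeakSolution.
Context {R : realType}.
Local Notation C := R[i].
Local Notation N z := (Normc.normc z).
Local Notation mu := (@lebesgue_measure R).
Implicit Types (F : nat -> R -> R) (p q r v : R -> R) (x t : R).

Lemma smooth_reflect F x : smooth_family F ->
  smooth_family (fun n t => (-1) ^+ n * F n (x - t)).
Proof.
move=> sF n t; have := smooth_affine (-1) x 1 sF n t.
have E j : (fun t => (-1) ^+ j * F j (x - t)) = (fun t => 1 * (-1) ^+ j * F j (-1 * t + x)).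
  by apply/funext => s; rewrite mul1r mulN1r addrC.
by rewrite E (_ : (-1) ^+ n.+1 * F n.+1 (x - t) = 1 * (-1) ^+ n.+1 * F n.+1 (-1 * t + x)) // mul1r mulN1r addrC.
Qed.

Lemma primitive_cst_on f g x y : primitive f g -> x <= y ->
  (forall t, x <= t <= y -> g t = 0) -> f y = f x.
Proof.
move=> hf xy g0; apply/eqP; rewrite -subr_eq0 -normr_le0.
have := @primitive_lipschitz R f g 0 x y hf xy; rewrite mul0r; apply.
by move=> t /g0 ->; rewrite normr0.
Qed.

(** The slope is expressed by the values at 0 and 1, so that the formula survives the pointwise
    limit of mollifications in [weak_affine]. *)
Lemma smooth_affine_on F K x : smooth_family F -> 1 <= K ->
  (forall t, `|t| <= K -> F 2%N t = 0) -> `|x| <= K ->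
  F 0%N x = F 0%N 0 + (F 0%N 1 - F 0%N 0) * x.
Proof.
move=> sF K1 F2 xK.
have h0 := smooth_primitive 0 sF; have h1 := smooth_primitive 1 sF.
have cst f g s : primitive f g -> (forall t, `|t| <= K -> g t = 0) -> `|s| <= K -> f s = f 0.
  move=> hf g0; rewrite ler_norml => sK; have [s0|/ltW s0] := leP 0 s.
    by apply: (primitive_cst_on hf s0) => t ts; apply: g0; rewrite ler_norml; lra.
  by apply/esym/(primitive_cst_on hf s0) => t ts; apply: g0; rewrite ler_norml; lra.
have c1 s : `|s| <= K -> F 1%N s = F 1%N 0 by exact: (cst _ _ _ h1 F2).
have hl := primitiveB h0 (primitiveZ (F 1%N 0) (@primitive_id R)).
have hl0 t : `|t| <= K -> F 1%N t - F 1%N 0 * 1 = 0 by move=> /c1 ->; ring.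
have Ex := cst _ _ _ hl hl0 xK.
have E1 : F 0%N 1 - F 1%N 0 * 1 = F 0%N 0 - F 1%N 0 * 0 by apply: (cst _ _ _ hl hl0); rewrite normr1.
have -> : F 0%N 1 - F 0%N 0 = F 1%N 0 by lra.
by lra.
Qed.

(** The reflected mollifier is itself an admissible test function, so the mollifications of [r] have
    second derivative 0 near the given points and are affine there; so is their limit. *)
Lemma weak_affine r x : continuous r ->
  (forall F L, smooth_family F -> (forall n t, L <= `|t| -> F n t = 0) ->
    \int[mu]_(t in `[- L, L]) (r t * F 2%N t) = 0) ->
  r x = r 0 + (r 1 - r 0) * x.
Proof.
move=> cr hr.
have lr := continuous_locally_bounded cr; have hG := primitive_integral0 lr.
pose K := `|x| + 1; pose L := K + 1.
have x0 := normr_ge0 x; have K1 : 1 <= K by rewrite /K lerDr.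
have L0 : 0 <= L by rewrite /L; lra.
have F2 m t : `|t| <= K -> conv L (mollifier m 2) r t = 0.
  move=> tK; have sF := smooth_reflect t (@smooth_mollifier R m).
  have zF n s : L <= `|s| -> (-1) ^+ n * mollifier m n (t - s) = 0.
    move=> Ls; rewrite mollifier0 ?mulr0// (@le_trans _ _ 1) ?invf_le1 ?ler1n//.
    by rewrite distrC; apply: le_trans (lerB_dist _ _); move: Ls; rewrite /L; lra.
  rewrite -[RHS](hr _ L sF zF); apply: eq_Rintegral => s _.
  by rewrite sqrrN expr1n mul1r mulrC.
have aff m t : `|t| <= K -> conv L (mollifier m 0) r t =
    conv L (mollifier m 0) r 0 + (conv L (mollifier m 0) r 1 - conv L (mollifier m 0) r 0) * t.
  exact: smooth_affine_on (smooth_conv L0 (@smooth_mollifier R m) lr) K1 (F2 m).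
have lim t : `|t| <= K -> conv L (mollifier m 0) r t @[m --> \oo] --> r t.
  move=> tK; apply: (conv_cvg hG (primitive_derive hG (cr t))).
  by rewrite /L lerD2r.
have n0 : `|0 : R| <= K by rewrite normr0; lra.
have n1 : `|1 : R| <= K by rewrite normr1.
have nx : `|x| <= K by rewrite /K lerDl.
have <- := cvg_lim (@norm_hausdorff _ R^o) (lim x nx).
apply: cvg_lim; first exact: norm_hausdorff.
rewrite (funext (fun m => aff m x nx)).
apply: (@cvgD _ R^o); first exact: lim n0.
by apply: (@cvgM R); [apply: (@cvgB _ R^o); exact: lim|exact: cvg_cst].
Qed.

(* [(x + |x|) / 2] is a fundamental solution of the second derivative. *)
Lemma weak_solution v p (eps : R) : continuous v -> locally_bounded p ->
  (forall F L, 0 <= L -> smooth_family F -> (forall n t, L <= `|t| -> F n t = 0) ->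
    \int[mu]_(t in `[- L, L]) (v t * (- F 2%N t + p t * F 0%N t)) = eps * F 0%N 0) ->
  exists V V' : R -> R, [/\ primitive V V', primitive V' (fun x => p x * v x) &
    forall x, v x = V x - eps * ((x + `|x|) / 2)].
Proof.
move=> cv lp hv; have lv := continuous_locally_bounded cv.
have h1 := primitive_integral0 (locally_boundedM lp lv).
have h0 := primitive_integral0 (primitive_locally_bounded h1).
set V' := integral0 _ in h1 h0; set V := integral0 _ in h0.
pose H x : R := (x + `|x|) / 2.
have cH : continuous H.
  move=> x; apply: cvgM; last exact: cvg_cst.
  by apply: cvgD; [exact: cvg_id|exact: norm_continuous].
pose r x := v x - V x + eps * H x.
have cr : continuous r.
  move=> x; apply: cvgD; last by apply: cvgM; [exact: cvg_cst|exact: cH].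
  by apply: cvgB; [exact: cv|exact: (primitive_continuous h0)].
have lH := continuous_locally_bounded cH.
have rE x : r x = r 0 + (r 1 - r 0) * x.
  apply: weak_affine cr _ => F; move=> L sF zF.
  have [L0|L0] := leP 0 L; last first.
    by rewrite set_itv_ge ?Rintegral_set0// bnd_simp -ltNge; lra.
  have LL : - L <= L by lra.
  have zL n : F n L = 0 /\ F n (- L) = 0.
    by split; apply: zF; rewrite ?normrN ler_norm.
  have lF n := continuous_locally_bounded (smooth_continuous (n := n) sF).
  have hF n := smooth_primitive n sF.
  have E1 : \int[mu]_(t in `[- L, L]) (V t * F 2%N t) = \int[mu]_(t in `[- L, L]) (p t * v t * F 0%N t).
    have hP := primitiveB (primitiveM h0 (hF 1%N)) (primitiveM h1 (hF 0%N)).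
    case: (hP) => _ /(_ _ _ LL).
    rewrite !(zL _).1 !(zL _).2 !mulr0 subrr => E.
    have lpvF := locally_boundedM (primitive_lb h1) (lF 0%N).
    have lVF := locally_boundedM (primitive_locally_bounded h0) (lF 2%N).
    have := Rintegral_lin (-1) lVF lpvF LL.
    rewrite (_ : \int[mu]_(t in `[- L, L]) (V t * F 2%N t + -1 * _) = 0); first by lra.
    by rewrite [RHS]E; apply: eq_Rintegral => t _; ring.
  have E2 : \int[mu]_(t in `[- L, L]) (H t * F 2%N t) = F 0%N 0.
    have lHF := locally_boundedM lH (lF 2%N).
    have L0' : - L <= 0 by lra.
    rewrite (Rintegral_itv_split lHF L0' L0).
    have -> : \int[mu]_(t in `[- L, 0]) (H t * F 2%N t) = 0.
      apply/eqP; rewrite -normr_le0.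
      apply: le_trans (Rintegral_le_bound (M := 0) lHF L0' _) _; last by rewrite mul0r.
      by move=> t /andP[_ t0]; rewrite /H (ler0_norm t0) subrr !mul0r normr0.
    rewrite add0r.
    transitivity (\int[mu]_(t in `[0, L]) (1 * F 1%N t + t * F 2%N t - F 1%N t)).
      apply: eq_Rintegral => t; rewrite inE/= in_itv/= => /andP[t0 _].
      by rewrite /H ger0_norm//; field.
    have hP := primitiveB (primitiveM (@primitive_id R) (hF 1%N)) (hF 0%N).
    by case: (hP) => _ <-//; rewrite !(zL _).1; ring.
  have lvF2 := locally_boundedM lv (lF 2%N).
  have lVF2 := locally_boundedM (primitive_locally_bounded h0) (lF 2%N).
  have lHF2 := locally_boundedM lH (lF 2%N).
  have lpvF := locally_boundedM (primitive_lb h1) (lF 0%N).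
  transitivity (\int[mu]_(t in `[- L, L]) (v t * F 2%N t + -1 * (V t * F 2%N t + - eps * (H t * F 2%N t)))).
    by apply: eq_Rintegral => t _; rewrite /r; ring.
  have lVH := locally_boundedD lVF2 (locally_boundedM (locally_bounded_cst (- eps)) lHF2).
  rewrite (Rintegral_lin (-1) lvF2 lVH LL) (Rintegral_lin (- eps) lVF2 lHF2 LL) E1 E2.
  have := hv F L L0 sF zF.
  rewrite (_ : \int[mu]_(t in `[- L, L]) (v t * (- _ + _)) = \int[mu]_(t in `[- L, L]) (p t * v t * F 0%N t + -1 * (v t * F 2%N t))); last first.
    by apply: eq_Rintegral => t _; ring.
  by rewrite (Rintegral_lin (-1) lpvF lvF2 LL); lra.
exists (fun x => V x + (r 0 + (r 1 - r 0) * x)), (fun x => V' x + (0 + (r 1 - r 0) * 1)); split.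
- exact: (primitiveD h0 (primitiveD (primitive_cst (r 0)) (primitiveZ (r 1 - r 0) (@primitive_id R)))).
- by apply: primitive_eq (primitiveD h1 (primitive_cst (0 + (r 1 - r 0) * 1))) _ _ => x//; rewrite addr0.
- by move=> x; rewrite -rE /r -/(H x); ring.
Qed.
Lemma weak_is_derive (v V V' : R -> R) (eps x : R) : primitive V V' -> continuous V' ->
  (forall x, v x = V x - eps * ((x + `|x|) / 2)) ->
  (0 < x -> is_derive x 1 v (V' x - eps)) /\ (x < 0 -> is_derive x 1 v (V' x)).
Proof.
move=> hV cV' vE; have dV := primitive_derive hV (cV' x).
split=> x0.
  have d := is_deriveB dV (is_deriveZ eps (is_derive_id x 1)).
  have -> : V' x - eps = V' x - eps *: (1 : R^o) by rewrite /GRing.scale/= mulr1.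
  apply: (near_eq_is_derive _ d); near=> t.
  have t0 : 0 < t by near: t; exact: lt_nbhsr.
  transitivity (V t - eps * t) => //.
  by rewrite vE ger0_norm ?(ltW t0)//; field.
apply: (near_eq_is_derive _ dV); near=> t.
have t0 : t < 0 by near: t; exact: lt_nbhsl.
by rewrite vE ler0_norm ?(ltW t0)// subrr mul0r mulr0 subr0.
Unshelve. all: by end_near. Qed.

Lemma cprimitive_cst_on (f g : R -> C) x y : cprimitive f g -> x <= y ->
  (forall t, x <= t <= y -> g t = 0) -> f y = f x.
Proof.
move=> [rf jf] xy g0.
by apply: eq_ReIm; [apply: (primitive_cst_on rf xy)|apply: (primitive_cst_on jf xy)]
  => t txy; rewrite /rpart /ipart g0.
Qed.

(** Beyond 1, b = y' - i k y satisfies b' = - i k b, so |b| is constant there and the radiation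
    condition forces b(1) = 0. Wronskians with the fundamental pair then carry the values from 1 to
    0. The equation is assumed for x >= 0 only, because y will be the regular part of u continued
    across the source. *)
Lemma half_line_jost q S (k : R) (y y' f : R -> C) :
  fundamental q S -> (forall x, 1 <= x -> q x = 0) ->
  cprimitive y y' -> cprimitive y' f ->
  (forall x, 0 <= x -> f x = ((q x)%:C - k%:C ^+ 2) * y x) ->
  (forall e, 0 < e -> exists2 x, 1 <= x & N (y' x - 'i * k%:C * y x) <= e) ->
  y 0 = y 1 * jostA S k%:C /\ y' 0 = y 1 * jostB S k%:C.
Proof.
move=> fS q0 hy hy' fE rad.
have [/(_ k%:C)[[ht ht'] [hp hp']] /(_ k%:C)[t0 t0' p0 p0'] _] := fS.
have b1 : y' 1 = 'i * k%:C * y 1.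
  apply/eqP; rewrite -subr_eq0; apply/eqP/normc_ltP => e /rad[x x1]; congr (_ <= _).
  have [hb jb] := cprimitiveB hy' (cprimitiveZ ('i * k%:C) hy).
  set b := (fun x => y' x - _) in hb jb; rewrite -/(b x) -/(b 1).
  have hn := primitiveD (primitiveM hb hb) (primitiveM jb jb).
  have -> : b = (fun x => rpart b x +i* ipart b x).
    by apply/funext => t; rewrite /rpart /ipart; case: (b t).
  rewrite /= !expr2; congr Num.sqrt; apply: (primitive_cst_on hn x1) => t /andP[t1 _].
  have -> : rpart (fun x => f x - 'i * k%:C * y' x) t = k * ipart b t.
    rewrite /rpart /ipart fE ?q0 ?(le_trans ler01)// /b.
    by case: (y t) (y' t) => [? ?] [? ?] /=; ring.
  have -> : ipart (fun x => f x - 'i * k%:C * y' x) t = - k * rpart b t.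
    rewrite /rpart /ipart fE ?q0 ?(le_trans ler01)// /b.
    by case: (y t) (y' t) => [? ?] [? ?] /=; ring.
  by ring.
have wr z z' : cprimitive z z' ->
    cprimitive z' (fun x => ((q x)%:C - k%:C ^+ 2) * z x) ->
    y 1 * z' 1 - y' 1 * z 1 = y 0 * z' 0 - y' 0 * z 0.
  move=> hz hz'.
  apply: (cprimitive_cst_on (cprimitiveB (cprimitiveM hy hz') (cprimitiveM hy' hz)) ler01).
  by move=> t /andP[t0_ _]; rewrite fE//; ring.
have := wr _ _ ht ht'; have := wr _ _ hp hp'.
rewrite t0 t0' p0 p0' b1 /jostA /jostB !mulr0 !mulr1 subr0 sub0r => <- E; split; first by ring.
by rewrite -[LHS]opprK -E; ring.
Qed.

Lemma rpart_continuous (u : R -> C) : continuous (u : R -> R[i]^o) ->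
  continuous (rpart u) /\ continuous (ipart u).
Proof.
move=> cu; split=> x; apply/cvgrPdist_le => /= e e0;
  have e0' : 0 < e%:C by rewrite ltcR.
  have /cvgrPdist_le /(_ _ e0') := cu x.
  apply: filterS => t; rewrite /Num.norm/= lecR; apply: le_trans.
  by apply: le_trans (ge_Re_normc _); rewrite /rpart ReD; case: (u t).
have /cvgrPdist_le /(_ _ e0') := cu x.
apply: filterS => t; rewrite /Num.norm/= lecR; apply: le_trans.
by apply: le_trans (ge_Im_normc _); rewrite /ipart ImD; case: (u t).
Qed.
Lemma Rintegral_supported (g : R -> R) (L : R) :
  (forall t, L <= `|t| -> g t = 0) ->
  \int[mu]_t g t = \int[mu]_(t in `[- L, L]) g t.
Proof.
move=> g0; rewrite [RHS]Rintegral_mkcond; congr (Rintegral _ _ _).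
apply/funext => t; rewrite patchE; case: ifPn => // tL.
apply: g0; rewrite leNgt; apply: contra tL => tL.
by rewrite inE/= in_itv/= -ler_norml ltW.
Qed.

Lemma point_source_weak q (k : R) u : point_source_equation q k u ->
  forall F L, smooth_family F -> (forall n t, L <= `|t| -> F n t = 0) ->
  \int[mu]_(t in `[- L, L]) (rpart u t * (- F 2%N t + (q t - k ^+ 2) * F 0%N t)) = F 0%N 0 /\
  \int[mu]_(t in `[- L, L]) (ipart u t * (- F 2%N t + (q t - k ^+ 2) * F 0%N t)) = 0.
Proof.
move=> hu F L sF zF.
have tF : test_function (fun x => (F 0%N x)%:C).
  by apply: (smooth_test_function sF); exists L => x /ltW /zF.
have E x : u x * (ell0 q (fun x => (F 0%N x)%:C) x - (k ^+ 2)%:C * (F 0%N x)%:C) =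
    u x * (- F 2%N x + (q x - k ^+ 2) * F 0%N x)%:C.
  by rewrite /ell0 smooth_cderiven//; congr (_ * _); rewrite !rmorphD rmorphN !rmorphM rmorphB; ring.
have := hu _ tF; rewrite (funext E) /cintegral => -[rE iE].
split.
  rewrite -[RHS]rE -Rintegral_supported; last by move=> t tL; rewrite !zF// oppr0 mulr0 addr0 mulr0.
  by congr (Rintegral _ _ _); apply/funext => t; rewrite /rpart ReM mulr0 subr0.
rewrite -[RHS]iE -Rintegral_supported; last by move=> t tL; rewrite !zF// oppr0 mulr0 addr0 mulr0.
by congr (Rintegral _ _ _); apply/funext => t; rewrite /ipart ImM mulr0 add0r.
Qed.

Lemma cvg_pinfty_small (f : R -> C) :
  (f x : R[i]^o) @[x --> +oo%R] --> (0 : R[i]^o) -> 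
  forall e, 0 < e -> exists2 x, 1 <= x & N (f x) <= e.
Proof.
move=> cf e e0; have e0' : 0 < e%:C by rewrite ltcR.
have /cvgrPdist_le /(_ _ e0')[M [_ hM]] := cf.
exists (Num.max 1 (M + 1)); first by rewrite le_max lexx.
have /hM : M < Num.max 1 (M + 1) by rewrite lt_max ltrDl ltr01 orbT.
by rewrite sub0r normrN /Num.norm/= lecR.
Qed.

Lemma cvg_ninfty_small (f : R -> C) :
  (f x : R[i]^o) @[x --> -oo%R] --> (0 : R[i]^o) -> 
  forall e, 0 < e -> exists2 x, 1 <= x & N (f (0 - x)) <= e.
Proof.
move=> cf e e0; have e0' : 0 < e%:C by rewrite ltcR.
have /cvgrPdist_le /(_ _ e0')[M [_ hM]] := cf.
exists (Num.max 1 (- M + 1)); first by rewrite le_max lexx.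
have /hM : 0 - Num.max 1 (- M + 1) < M.
  by rewrite sub0r ltrNl lt_max ltrDl ltr01 orbT.
by rewrite [in X in X -> _]sub0r normrN /Num.norm/= lecR.
Qed.

Lemma Rintegral_ae_itv (f g : R -> R) (a b : R) :
  measurable_fun setT f -> measurable_fun setT g -> {ae mu, forall x, f x = g x} ->
  \int[mu]_(t in `[a, b]) f t = \int[mu]_(t in `[a, b]) g t.
Proof.
move=> mf mg fg; rewrite /Rintegral; congr fine; apply: ae_eq_integral => //.
- by apply/measurable_EFinP; exact: measurable_funTS.
- by apply/measurable_EFinP; exact: measurable_funTS.
by apply: (@filterS _ _ (ae_filter_ringOfSetsType mu) _ _ _ fg) => x -> _.
Qed.

Lemma outgoing_jost q0 q S T (k : R) u : measurable_fun setT q0 ->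
  {ae mu, forall x, q0 x = q x} -> locally_bounded q ->
  (forall x, 1 <= `|x| -> q x = 0) ->
  fundamental q S -> fundamental (fun x => q (0 - x)) T ->
  outgoing_solution q0 k u ->
  u 1 * jostW S T k%:C = jostA T k%:C /\ u (-1) * jostW S T k%:C = jostA S k%:C.
Proof.
move=> mq0 qq lq qout fS fT [cu eu [_ _ rad1 rad2]].
have [rc ic] := rpart_continuous cu.
have ae_int v F L : continuous v -> smooth_family F ->
    \int[mu]_(t in `[- L, L]) (v t * (- F 2%N t + (q t - k ^+ 2) * F 0%N t)) =
    \int[mu]_(t in `[- L, L]) (v t * (- F 2%N t + (q0 t - k ^+ 2) * F 0%N t)).
  move=> cv sF; have mv := continuous_measurable_fun cv.
  have mF n := continuous_measurable_fun (smooth_continuous (n := n) sF).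
  have m p : measurable_fun setT p ->
      measurable_fun setT (fun t => v t * (- F 2%N t + (p t - k ^+ 2) * F 0%N t)).
    move=> mp; apply: measurable_funM => //; apply: measurable_funD.
      exact: measurableT_comp.
    by apply: measurable_funM => //; exact: measurable_funB.
  apply: Rintegral_ae_itv; [exact: m lq.1|exact: m|].
  by apply: (@filterS _ _ (ae_filter_ringOfSetsType mu) _ _ _ qq) => x ->.
have lp : locally_bounded (fun x => q x - k ^+ 2).
  exact: locally_boundedB lq (locally_bounded_cst _).
(* Tested against real functions, delta charges only the real part: [eps] is 1 here and 0 for the
   imaginary part. *)
have [V [V' [hV hV' vE]]] : exists V V' : R -> R, [/\ primitive V V',
    primitive V' (fun x => (q x - k ^+ 2) * rpart u x) &
    forall x, rpart u x = V x - 1 * ((x + `|x|) / 2)].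
  apply: (weak_solution rc lp) => F L _ sF zF.
  by rewrite ae_int//; have [-> _] := point_source_weak eu sF zF; rewrite mul1r.
have [Z [Z' [hZ hZ' zE]]] : exists V V' : R -> R, [/\ primitive V V',
    primitive V' (fun x => (q x - k ^+ 2) * ipart u x) &
    forall x, ipart u x = V x - 0 * ((x + `|x|) / 2)].
  apply: (weak_solution ic lp) => F L _ sF zF.
  by rewrite ae_int//; have [_ ->] := point_source_weak eu sF zF; rewrite mul0r.
(* [U] is the solution with its kink removed: u = U - x to the right of the source and u = U to its
   left, with [U'] continuous. *)
pose U x : C := V x +i* Z x; pose U' x : C := V' x +i* Z' x.
have hU : cprimitive U U' by [].
have hU' : cprimitive U' (fun x => ((q x)%:C - k%:C ^+ 2) * u x).
  split; [apply: primitive_eq hV' _ _ => x //|apply: primitive_eq hZ' _ _ => x //].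
    by rewrite /rpart ReM; case: (u x) => a b /=; ring.
  by rewrite /ipart ImM; case: (u x) => a b /=; ring.
have uU x : 0 <= x -> u x = U x - x%:C.
  move=> x0; apply: eq_ReIm; rewrite ?ReD ?ImD /=.
    by have := vE x; rewrite /rpart => ->; rewrite ger0_norm//; field.
  by have := zE x; rewrite /ipart => ->; ring.
have uU' x : x <= 0 -> u x = U x.
  move=> x0; apply: eq_ReIm => /=.
    by have := vE x; rewrite /rpart => ->; rewrite ler0_norm// subrr mul0r mulr0 subr0.
  by have := zE x; rewrite /ipart => ->; rewrite mul0r subr0.
have du x : (0 < x -> cderiven 1 u x = U' x - 1) /\ (x < 0 -> cderiven 1 u x = U' x).
  have [rp rn] := weak_is_derive x hV (primitive_continuous hV') vE.
  have [ip im] := weak_is_derive x hZ (primitive_continuous hZ') zE.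
  rewrite /cderiven !derive1n1 !derive1E; split=> x0.
    by rewrite (@derive_val _ _ _ _ _ _ _ (rp x0)) (@derive_val _ _ _ _ _ _ _ (ip x0)) /U' !subr0; apply: eq_ReIm => //=; ring.
  by rewrite (@derive_val _ _ _ _ _ _ _ (rn x0)) (@derive_val _ _ _ _ _ _ _ (im x0)).
have [r0 r1] : U 0 - 0 = u 1 * jostA S k%:C /\ U' 0 - 1 = u 1 * jostB S k%:C.
  have hid := cprimitive_real (@primitive_id R).
  rewrite (uU 1)//.
  apply: (half_line_jost fS _ (cprimitiveB hU hid) (cprimitiveB hU' (cprimitive_cst 1))).
  - by move=> x x1; apply: qout; rewrite ger0_norm// (le_trans ler01).
  - by move=> x x0 /=; rewrite subr0 uU.
  - move=> e e0; have [x x1 h] := cvg_pinfty_small rad1 e0; exists x => //.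
    have x0 : 0 < x by rewrite (lt_le_trans ltr01).
    by move: h; rewrite (du x).1// uU// ltW.
have [l0 l1] : U (0 - 0) = u (-1) * jostA T k%:C /\ - U' (0 - 0) = u (-1) * jostB T k%:C.
  have hR := cprimitive_reflect 0 hU; have hR' := cprimitiveN (cprimitive_reflect 0 hU').
  rewrite uU' ?lerN10// -[-1]sub0r.
  apply: (half_line_jost fT _ hR hR').
  - by move=> x x1; apply: qout; rewrite sub0r normrN ger0_norm// (le_trans ler01).
  - by move=> x x0 /=; rewrite opprK uU'// sub0r oppr_le0.
  - move=> e e0; have [x x1 h] := cvg_ninfty_small rad2 e0; exists x => //.
    have x0 : 0 < x by rewrite (lt_le_trans ltr01).
    by move: h; rewrite (du (0 - x)).2 ?sub0r ?oppr_lt0// uU'// oppr_le0 ltW.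
rewrite !subr0 in r0 l0 l1; rewrite /jostW.
(* The one-sided derivatives of u at 0 are U'(0) - 1 and U'(0); this is the unit jump produced by
   delta. *)
have jump : u 1 * jostB S k%:C + u (-1) * jostB T k%:C = -1 by rewrite -r1 -l1; ring.
split.
  transitivity (- (u 1 * jostA S k%:C * jostB T k%:C + u 1 * jostB S k%:C * jostA T k%:C)); first by ring.
  rewrite -r0 l0.
  transitivity (- (u 1 * jostB S k%:C + u (-1) * jostB T k%:C) * jostA T k%:C); first by ring.
  by rewrite jump opprK mul1r.
transitivity (- (jostA S k%:C * (u (-1) * jostB T k%:C) + jostB S k%:C * (u (-1) * jostA T k%:C))); first by ring.
rewrite -l0 r0.
transitivity (- (u 1 * jostB S k%:C + u (-1) * jostB T k%:C) * jostA S k%:C); first by ring.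
by rewrite jump opprK mul1r.
Qed.
End WeakSolution.

(** * Bound states *)

Section Dominated.
Context {R : realType}.
Local Notation N z := (Normc.normc z).
Local Notation mu := (@lebesgue_measure R).
Implicit Types (h : R -> R) (x c D : R).

Lemma integrable_expR_abs c : 0 < c ->
  mu.-integrable setT (fun x => (expR (- c * `|x|))%:E).
Proof.
move=> c0.
have ip : mu.-integrable setT (EFin \o exponential_pdf c) by exact: integrable_exponential_pdf.
have mr := @measurable_reflect R 0.
have ir : mu.-integrable setT (EFin \o (fun x => exponential_pdf c (0 - x))).
  apply/integrableP; split.
    apply/measurable_EFinP; apply: (measurableT_comp _ mr).
    exact: measurable_exponential_pdf.
  apply: (@le_lt_trans _ _ (\int[pushforward mu (fun x => (0 - x)%R : measurableTypeR R)]_x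
     `|(EFin \o exponential_pdf c) x|)%E).
    rewrite ge0_integral_pushforward//=.
    apply/measurable_EFinP; apply: measurableT_comp => //.
    exact: measurable_exponential_pdf.
  case/integrableP : ip => _; congr (_ < _)%E.
  by apply: eq_measure_integral => A mA _; exact: lebesgue_measure_reflect.
apply: (le_integrable _ _ _ (integrableZl _ c^-1 (integrableD _ ip ir))) => //.
  apply/measurable_EFinP; apply: continuous_measurable_fun => x.
  apply: continuous_comp; last exact: continuous_expR.
  by apply: cvgM; [exact: cvg_cst|exact: norm_continuous].
move=> x _; rewrite /= lee_fin ger0_norm ?expR_ge0//.
apply: le_trans (ler_norm _); rewrite ler_pdivlMl//.
have pdfE y : 0 <= y -> exponential_pdf c y = c * expR (- c * y).
  by move=> y0; rewrite exponential_pdfE.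
have [x0|x0] := leP 0 x.
  by rewrite ger0_norm// [exponential_pdf c x]pdfE// lerDl exponential_pdf_ge0 ?(ltW c0).
rewrite ltr0_norm// [exponential_pdf c (0 - x)]pdfE ?sub0r ?oppr_ge0 ?(ltW x0)//.
by rewrite lerDr exponential_pdf_ge0 ?(ltW c0).
Qed.

Lemma L2_norm_real h :
  L2_norm (fun x => (h x)%:C) = ((\int[mu]_x ((h x) ^+ 2)%:E) `^ 2^-1)%E.
Proof.
rewrite /L2_norm unlock; congr (_ `^ _)%E; apply: eq_integral => x _.
rewrite normc_real abse_EFin normr_id poweR_EFin.
by rewrite powR_mulrn// real_normK ?num_real.
Qed.

Lemma expR_abs_sqr (c D x : R) : (D * expR (- c * `|x|)) ^+ 2 = D ^+ 2 * expR (- (c + c) * `|x|).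
Proof. by rewrite exprMn -[expR _ ^+ 2]expRM_natl; congr (_ * expR _); ring. Qed.

Lemma integrable_dom c D : 0 < c ->
  mu.-integrable setT (fun x => ((D * expR (- c * `|x|)) ^+ 2)%:E).
Proof.
move=> c0; rewrite (_ : (fun x => _) = (fun x => (D ^+ 2)%:E * (expR (- (c + c) * `|x|))%:E)%E); last first.
  by apply/funext => x; rewrite expR_abs_sqr.
by apply: integrableZl => //; apply: integrable_expR_abs; rewrite addr_gt0.
Qed.

Lemma Lfun2_dominated h c D : 0 < c -> measurable_fun setT h ->
  (forall x, `|h x| <= D * expR (- c * `|x|)) -> h \in Lfun mu 2%:E.
Proof.
move=> c0 mh hD; rewrite inE; apply/andP; split; first by rewrite inE.
rewrite inE/= /finite_norm unlock /= poweR_lty//.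
under eq_integral do rewrite powR_mulrn// real_normK ?num_real//.
have /integrableP[md] := integrable_dom D c0; apply: le_lt_trans.
apply: ge0_le_integral => //=.
- by move=> x _; rewrite lee_fin sqr_ge0.
- by apply/measurable_EFinP; exact: measurable_funX.
- by apply/measurable_EFinP; apply: measurableT_comp => //; exact/measurable_EFinP.
- move=> x _; rewrite lee_fin [leRHS]ger0_norm ?sqr_ge0//.
  rewrite -[leLHS]real_normK ?num_real// lerXn2r ?nnegrE//.
  by rewrite (le_trans _ (hD x)).
Qed.

Lemma L2_dominated_cvg (h : nat -> R -> R) c D : 0 < c ->
  (forall n, measurable_fun setT (h n)) ->
  {ae mu, forall x, (forall n, `|h n x| <= D * expR (- c * `|x|)) /\
     h n x @[n --> \oo] --> (0 : R)} ->
  L2_norm (fun x => (h n x)%:C) @[n --> \oo] --> 0%E.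
Proof.
move=> c0 mh hae.
have aeW (P : R -> Prop) : (forall x, ((forall n, `|h n x| <= D * expR (- c * `|x|)) /\
     h n x @[n --> \oo] --> (0 : R)) -> P x) -> {ae mu, forall x, P x}.
  by move=> hP; apply: (@filterS _ _ (ae_filter_ringOfSetsType mu) _ _ _ hae).
pose I n := (\int[mu]_x ((h n x) ^+ 2)%:E)%E.
have I0 : I n @[n --> \oo] --> 0%E.
  have mI n : measurable_fun setT (fun x => ((h n x) ^+ 2)%:E).
    by apply/measurable_EFinP; exact: measurable_funX.
  have cI : {ae mu, forall x, setT x -> ((h n x) ^+ 2)%:E @[n --> \oo] --> (cst 0%E x : \bar R)}.
    apply: aeW => x [_ hx] _; apply: cvg_EFin; first exact: nearW.
    rewrite -[0 in X in _ --> X](mulr0 (0 : R)).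
    rewrite (_ : _ \o _ = (fun n => h n x * h n x)); last by apply/funext => n; rewrite -expr2.
    exact: (@cvgM R).
  have dI : {ae mu, forall x n, setT x -> (`|((h n x) ^+ 2)%:E| <= ((D * expR (- c * `|x|)) ^+ 2)%:E)%E}.
    apply: aeW => x [hx _] n _; rewrite abse_EFin lee_fin ger0_norm ?sqr_ge0//.
    rewrite -[leLHS]real_normK ?num_real// lerXn2r ?nnegrE//.
    by rewrite (le_trans _ (hx n)).
  have [_ _] := @dominated_convergence _ _ _ mu setT measurableT _ _ _ mI (measurable_cst _) cI (integrable_dom D c0) dI.
  by rewrite integral_cst// mul0e.
have I0' : fine (I n) @[n --> \oo] --> (0 : R) by exact: fine_cvg I0.
apply: (@cvg_trans _ ((Num.sqrt (fine (I n)))%:E @[n --> \oo])).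
  apply: near_eq_cvg; near=> n.
  have fI : I n \is a fin_num by near: n; exact: cvg_is_fine I0.
  rewrite L2_norm_real -/(I n) -[in RHS](fineK fI) poweR_EFin powR12_sqrt// fine_ge0//.
  by apply: integral_ge0 => x _; rewrite lee_fin sqr_ge0.
apply: cvg_EFin; first exact: nearW.
rewrite -[0 in X in _ --> X]sqrtr0.
exact: (continuous_cvg _ (@sqrt_continuous R 0) I0').
Unshelve. all: by end_near. Qed.
End Dominated.

(** * Smooth cut-off functions and local properties of mollification *)

Section Cutoff.
Context {R : realType}.
Local Notation N z := (Normc.normc z).
Local Notation mu := (@lebesgue_measure R).
Implicit Types (g z y : R -> R) (x t : R).

Definition smooth_step j x : R :=
  if j is i.+1 then bump_mass^-1 * bumps i x
  else bump_mass^-1 * (integral0 (bumps 0) x - integral0 (bumps 0) (-1)).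

Lemma smooth_smooth_step : smooth_family smooth_step.
Proof.
case=> [|j] x; last exact: (is_deriveZ bump_mass^-1 (smooth_bumps j x)).
have c0 : {for x, continuous (@bumps R 0)} := @smooth_continuous _ _ 0%N (@smooth_bumps R) x.
have d := is_deriveB (primitive_derive (@primitive_bump_mass R) c0)
  (is_derive_cst (integral0 (@bumps R 0) (-1)) x 1).
rewrite subr0 in d; exact: (is_deriveZ bump_mass^-1 d).
Qed.

Lemma smooth_step_left j x : x <= -1 -> smooth_step j x = 0.
Proof.
move=> x1; case: j => [|j] /=; last first.
  by rewrite bumps0 ?mulr0// ler0_norm; lra.
rewrite (primitive_cst_on (@primitive_bump_mass R) x1) ?subrr ?mulr0// => t /andP[_ t1].
by rewrite bumps0// ler0_norm; lra.
Qed.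

Lemma smooth_step_right j x : 1 <= x -> smooth_step j x = (j == 0%N)%:R.
Proof.
move=> x1; case: j => [|j] /=; last first.
  by rewrite bumps0 ?mulr0// (le_trans x1)// ler_norm.
by rewrite integral_bumps// mulVf// gt_eqF// bump_mass_gt0.
Qed.

Lemma smooth_step_bounded j : exists2 B, 0 <= B & forall x, `|smooth_step j x| <= B.
Proof.
have [M M0 hM] := locally_bounded_gt0 1
  (continuous_locally_bounded (@smooth_continuous _ _ j smooth_smooth_step)).
exists (M + 1) => [|x]; first lra.
have [x1|x1] := leP `|x| 1; first by have := hM x x1; lra.
have [x0|x0] := leP 0 x.
  rewrite smooth_step_right ?(le_trans (ltW x1)) ?ger0_norm//.
  by case: (j == 0%N) => /=; lra.
rewrite smooth_step_left ?normr0; first lra.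
by move: x1; rewrite ltr0_norm//; lra.
Qed.

(** The transition from 1 to 0 takes place for |x| between n + 1 and n + 3; its width does not
    depend on n, so the derivatives are bounded uniformly in n. *)
Definition cutoff (n : nat) j x :=
  smooth_step j (x + (n%:R + 2)) - smooth_step j (x - (n%:R + 2)).

Lemma smooth_cutoff n : smooth_family (cutoff n).
Proof.
move=> j x; have shift a : is_derive x 1 (fun t => smooth_step j (t + a)) (smooth_step j.+1 (x + a)).
  have := smooth_affine 1 a 1 smooth_smooth_step j x.
  rewrite (_ : (fun t => _) = (fun t => smooth_step j (t + a))); last first.
    by apply/funext => t; rewrite expr1n !mul1r.
  by rewrite expr1n !mul1r.
exact: is_deriveB (shift _) (shift _).
Qed.

Lemma cutoff_in n j x : `|x| <= n%:R + 1 -> cutoff n j x = (j == 0%N)%:R.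
Proof.
move=> xn; move: (xn); rewrite ler_norml => /andP[x1 x2].
by rewrite /cutoff smooth_step_right ?smooth_step_left ?subr0//; lra.
Qed.

Lemma cutoff_out n j x : n%:R + 3 <= `|x| -> cutoff n j x = 0.
Proof.
have n0 : 0 <= n%:R :> R by [].
have [x0|x0] := leP 0 x.
  by rewrite ger0_norm// => xn; rewrite /cutoff !smooth_step_right ?subrr//; lra.
by rewrite ltr0_norm// => xn; rewrite /cutoff !smooth_step_left ?subrr//; lra.
Qed.

Lemma cutoff_bounded : exists2 B : R, 0 <= B & forall n j x, (j <= 2)%N -> `|cutoff n j x| <= B.
Proof.
have [B0 B00 h0] := smooth_step_bounded 0.
have [B1 B10 h1] := smooth_step_bounded 1.
have [B2 B20 h2] := smooth_step_bounded 2.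
exists (2 * (B0 + B1 + B2)) => [|n j x j2]; first lra.
apply: le_trans (ler_normB _ _) _.
have H t : `|smooth_step j t| <= B0 + B1 + B2.
  by case: j j2 => [|[|[|//]]] _; [have := h0 t|have := h1 t|have := h2 t]; lra.
by have := H (x + (n%:R + 2)); have := H (x - (n%:R + 2)); lra.
Qed.

Lemma conv_parts (F : nat -> R -> R) n z z' (L : R) x : 0 <= L -> smooth_family F -> primitive z z' ->
  z L = 0 -> z (- L) = 0 -> conv L (F n.+1) z x = conv L (F n) z' x.
Proof.
move=> L0 sF hz zL zL'; have LL : - L <= L by lra.
have hF := primitive_reflect x (smooth_primitive n sF).
have cF j := smooth_continuous (n := j) sF.
have [_ /(_ _ _ LL)] := primitiveM hF hz; rewrite zL zL' !mulr0 subrr => E.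
have := Rintegral_lin (-1) (conv_lb x (cF n) (primitive_lb hz))
  (conv_lb x (cF n.+1) (primitive_locally_bounded hz)) LL.
rewrite (_ : \int[mu]_(t in _) (_ + -1 * _) = 0); first by rewrite /conv; lra.
by rewrite [RHS]E; apply: eq_Rintegral => t _; ring.
Qed.

Lemma conv_bound m g x (L M : R) : locally_bounded g -> `|x| + 1 <= L ->
  (forall t, `|t - x| <= 1 -> `|g t| <= M) -> `|conv L (mollifier m 0) g x| <= M.
Proof.
move=> lg xL gM; have LL : - L <= L by have := normr_ge0 x; lra.
have cm := smooth_continuous (n := 0%N) (@smooth_mollifier R m).
have lm := locally_bounded_reflect x (continuous_locally_bounded cm).
(* The values c = 1 and c = -1 give the two sides of the bound, the mollifier being nonnegative with
   integral 1. *)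
have key (c : R) : `|c| <= 1 -> 0 <= M + c * conv L (mollifier m 0) g x.
  move=> c1; have l1 := locally_boundedM lm (locally_bounded_cst M).
  have := Rintegral_lin c l1 (conv_lb x cm lg) LL.
  have -> : \int[mu]_(t in `[- L, L]) (mollifier m 0 (x - t) * M) = M.
    have := Rintegral_lin M (locally_bounded_cst 0) lm LL; rewrite mollifier_mass// Rintegral_cst//= mul0r add0r mulr1 => E.
    by rewrite -[RHS]E; apply: eq_Rintegral => t _; ring.
  move=> <-; apply: Rintegral_ge0 => t _.
  have -> : mollifier m 0 (x - t) * M + c * (mollifier m 0 (x - t) * g t) =
    mollifier m 0 (x - t) * (M + c * g t) by ring.
  have [tx|tx] := leP `|t - x| 1; last first.
    rewrite mollifier0 ?mul0r// distrC (le_trans _ (ltW tx))//.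
    by rewrite invf_le1 ?ler1n ?ltr0n.
  have /andP[m0 _] := mollifier_bound m (x - t).
  apply: mulr_ge0 => //.
  have : `|c * g t| <= M.
    by rewrite normrM -[M]mul1r ler_pM// gM.
  by rewrite ler_norml; lra.
have k1 : `|1 : R| <= 1 by rewrite normr1.
have k2 : `|-1 : R| <= 1 by rewrite normrN normr1.
by have := key _ k1; have := key _ k2; rewrite ler_norml; lra.
Qed.

(** Allows the window and the cut-off, which grow with n in the approximants, to be replaced by
    fixed ones when a limit is taken at x. *)
Lemma conv_local m g g' x (L L' : R) : `|x| + 1 <= L -> `|x| + 1 <= L' ->
  (forall t, `|t| <= `|x| + 1 -> g t = g' t) ->
  conv L (mollifier m 0) g x = conv L' (mollifier m 0) g' x.
Proof.
have m1 : m.+1%:R^-1 <= 1 :> R by rewrite invf_le1 ?ler1n ?ltr0n.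
have out f K t : `|x| + 1 <= K -> K <= `|t| -> mollifier m 0 (x - t) * f t = 0.
  move=> xK Kt; rewrite mollifier0 ?mul0r// (le_trans m1)// distrC.
  by apply: le_trans (lerB_dist _ _); lra.
move=> xL xL' gg'; rewrite /conv -!Rintegral_supported; try by move=> t; exact: out.
congr (Rintegral _ _ _); apply/funext => t.
have [tx|tx] := leP `|t| (`|x| + 1); first by rewrite gg'.
by rewrite !(out _ (`|x| + 1))// ltW.
Qed.
End Cutoff.

(** * Decaying solutions belong to the closure of [ell0] *)

Section Eigenfunction.
Context {R : realType}.
Local Notation N z := (Normc.normc z).
Local Notation mu := (@lebesgue_measure R).
Implicit Types (g z y : R -> R) (x t : R).


Lemma expR_abs_shift (c x t : R) : 0 <= c -> `|t - x| <= 1 ->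
  expR (- c * `|t|) <= expR c * expR (- c * `|x|).
Proof.
move=> c0 tx; rewrite -expRD ler_expR.
have : `|x| <= `|t| + 1.
  have -> : x = t - (t - x) by ring.
  by apply: le_trans (ler_normB _ _) _; rewrite lerD2l.
by nra.
Qed.

Lemma decaying_in_L2 y (c D : R) : 0 < c -> continuous y ->
  (forall x, `|y x| <= D * expR (- c * `|x|)) -> in_L2 (fun x => (y x)%:C).
Proof.
move=> c0 cy yD; have my := continuous_measurable_fun cy.
split; first exact: (Lfun2_dominated c0 my yD).
apply: (@Lfun2_dominated _ _ c 0) => // [|x]; first exact: measurable_cst.
by rewrite normr0 mul0r.
Qed.

(** The approximants are [y] cut off, then mollified. Two integrations by parts move the second
    derivative onto the cut-off function, where it is bounded and exponentially small; it converges
    only almost everywhere, at the points where y' is differentiable, which dominated convergence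
    accepts. *)
Lemma decaying_ell_graph (q q' : R -> R) (sigma c D : R) y y' :
  measurable_fun setT q -> {ae mu, forall x, q x = q' x} ->
  locally_bounded q' -> (forall x, `|q' x| <= sigma) -> 0 < c ->
  primitive y y' -> primitive y' (fun x => (q' x + c ^+ 2) * y x) ->
  (forall x, `|y x| <= D * expR (- c * `|x|) /\ `|y' x| <= D * expR (- c * `|x|)) ->
  ell_graph q (fun x => (y x)%:C) (fun x => (- c ^+ 2)%:C * (y x)%:C).
Proof.
move=> mq qq' lq' q's c0 hy hy' yD.
pose p x := q' x + c ^+ 2; pose P := sigma + c ^+ 2.
have pP x : `|p x| <= P.
  by apply: le_trans (ler_normD _ _) _; rewrite (ger0_norm (sqr_ge0 c)) lerD2r.
have P0 : 0 <= P by exact: le_trans (pP 0).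
have e0 x : 0 < expR (- c * `|x|) := expR_gt0 _.
have D0 : 0 <= D.
  by have [h _] := yD 0; move: (le_trans (normr_ge0 _) h); rewrite pmulr_lge0.
have cy := primitive_continuous hy; have my := continuous_measurable_fun cy.
have [B B0 hB] := @cutoff_bounded R.
pose z n x := cutoff n 0 x * y x.
pose z1 n x := cutoff n 1 x * y x + cutoff n 0 x * y' x.
pose z2 n x := (cutoff n 2 x * y x + cutoff n 1 x * y' x) +
  (cutoff n 1 x * y' x + cutoff n 0 x * (p x * y x)).
have hc n j := smooth_primitive j (@smooth_cutoff R n).
have hz n : primitive (z n) (z1 n) by exact: primitiveM (hc n 0%N) hy.
have hz1 n : primitive (z1 n) (z2 n).
  exact: primitiveD (primitiveM (hc n 1%N) hy) (primitiveM (hc n 0%N) hy').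
(* [z n] vanishes beyond n + 3 and mollification spreads it by at most 1, so the window contains the
   support of the result with room to spare. *)
pose L n : R := n%:R + 5.
have n0 n : 0 <= n%:R :> R by [].
have L0 n : 0 <= L n by rewrite /L; have := n0 n; lra.
pose phi n j := conv (L n) (mollifier n j) (z n).
have sphi n : smooth_family (phi n).
  exact: smooth_conv (L0 n) (@smooth_mollifier R n) (primitive_locally_bounded (hz n)).
have out n x : n%:R + 3 <= `|x| -> [/\ z n x = 0, z1 n x = 0 & z2 n x = 0].
  by move=> nx; rewrite /z /z1 /z2 !cutoff_out// !mul0r !addr0.
have inn n x : `|x| <= n%:R + 1 -> z n x = y x /\ z2 n x = p x * y x.
  by move=> nx; rewrite /z /z2 !cutoff_in//= !mul0r !mul1r !add0r.
have phi2 n x : phi n 2%N x = conv (L n) (mollifier n 0) (z2 n) x.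
  have Ln : n%:R + 3 <= `|L n| by rewrite ger0_norm// /L; lra.
  have Ln' : n%:R + 3 <= `|- L n| by rewrite normrN.
  have [zL zL1 _] := out n _ Ln; have [zL' zL1' _] := out n _ Ln'.
  rewrite /phi (conv_parts 1%N x (L0 n) (@smooth_mollifier R n) (hz n) zL zL').
  by rewrite (conv_parts 0%N x (L0 n) (@smooth_mollifier R n) (hz1 n) zL1 zL1').
(* [z2 n] has four terms, three bounded by B D exp (- c |x|) and one by B P D exp (- c |x|); the
   factor exp c pays for a displacement of at most 1. *)
pose K := B * (3 * D + P * D) * expR c.
have zK n t : `|z n t| <= B * (3 * D + P * D) * expR (- c * `|t|) /\
    `|z2 n t| <= B * (3 * D + P * D) * expR (- c * `|t|).
  have [y1 y2] := yD t; set e := expR _ in y1 y2 *.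
  have e1 : 0 <= e by exact: expR_ge0.
  have b0 := hB n 0%N t isT; have b1 := hB n 1%N t isT; have b2 := hB n 2%N t isT.
  have De : 0 <= D * e by exact: mulr_ge0.
  have m j w : `|cutoff n j t| <= B -> `|w| <= D * e -> `|cutoff n j t * w| <= B * (D * e).
    by move=> ? ?; rewrite normrM ler_pM.
  have mp : `|cutoff n 0 t * (p t * y t)| <= B * (P * (D * e)).
    by rewrite !normrM; apply: ler_pM; rewrite ?mulr_ge0//; apply: ler_pM.
  have BPe : 0 <= B * (P * (D * e)) by rewrite !mulr_ge0.
  have BDe : 0 <= B * (D * e) by rewrite mulr_ge0.
  have -> : B * (3 * D + P * D) * e = (B * (D * e) + B * (D * e)) + (B * (D * e) + B * (P * (D * e))).
    by ring.
  split; first by have := m _ _ b0 y1; rewrite /z; lra.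
  apply: le_trans (ler_normD _ _) _; apply: lerD.
    by apply: le_trans (ler_normD _ _) _; apply: lerD; exact: m.
  by apply: le_trans (ler_normD _ _) _; apply: lerD => //; exact: m.
have bnd n (g : R -> R) x : locally_bounded g -> (forall t, n%:R + 3 <= `|t| -> g t = 0) ->
    (forall t, `|g t| <= B * (3 * D + P * D) * expR (- c * `|t|)) ->
    `|conv (L n) (mollifier n 0) g x| <= K * expR (- c * `|x|).
  move=> lg g0 gK.
  have M0 : 0 <= B * (3 * D + P * D) by rewrite mulr_ge0// addr_ge0 ?mulr_ge0.
  have [xL|xL] := leP (`|x| + 1) (L n).
    apply: conv_bound => // t tx; apply: le_trans (gK t) _.
    by rewrite /K -[leRHS]mulrA ler_wpM2l// expR_abs_shift// ltW.
  rewrite /conv (_ : (fun t => _) = cst 0); last first.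
    apply/funext => t; have [tn|tn] := leP (n%:R + 3) `|t|; first by rewrite g0// mulr0.
    rewrite mollifier0 ?mul0r// (@le_trans _ _ 1) ?invf_le1 ?ler1n ?ltr0n//.
    apply: le_trans (lerB_dist _ _); move: xL tn; rewrite /L; lra.
  by rewrite Rintegral_cst// mul0r normr0 mulr_ge0 ?expR_ge0// mulr_ge0 ?expR_ge0.
have bphi n x : `|phi n 0%N x| <= K * expR (- c * `|x|).
  apply: bnd => [|t /out[]//|t]; last by have [] := zK n t.
  exact: primitive_locally_bounded (hz n).
have bphi2 n x : `|phi n 2%N x| <= K * expR (- c * `|x|).
  rewrite phi2; apply: bnd => [|t /out[]//|t]; last by have [] := zK n t.
  exact: primitive_lb (hz1 n).
have lim (g : nat -> R -> R) (w W : R -> R) x : primitive W w -> is_derive x 1 W (w x) ->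
    (forall n t, `|t| <= n%:R + 1 -> g n t = w t) ->
    conv (L n) (mollifier n 0) (g n) x @[n --> \oo] --> w x.
  move=> hW dW gw; have := conv_cvg hW dW (lexx (`|x| + 1)).
  apply: cvg_trans; apply: near_eq_cvg; near=> n.
  have xn : `|x| <= n%:R by near: n; exact: nbhs_infty_ger.
  apply/esym/conv_local => //; first by rewrite /L; lra.
  by move=> t tx; apply: gw; lra.
have limphi x : phi n 0%N x @[n --> \oo] --> y x.
  apply: (lim z) (primitive_integral0 (continuous_locally_bounded cy)) _ _.
    exact: primitive_derive (primitive_integral0 (continuous_locally_bounded cy)) (cy x).
  by move=> n t /inn[].
have limphi2 : {ae mu, forall x, phi n 2%N x @[n --> \oo] --> p x * y x}.
  apply: (@filterS _ _ (ae_filter_ringOfSetsType mu) _ _ _ (primitive_ae_derive hy')) => x dx.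
  rewrite (funext (fun n => phi2 n x)).
  by apply: (lim z2 _ _ x hy' dx) => n t /inn[].
have cphi n j : measurable_fun setT (phi n j).
  exact: continuous_measurable_fun (smooth_continuous (sphi n)).
split.
- exact: (decaying_in_L2 c0 cy (fun x => (yD x).1)).
- have -> : (fun x => (- c ^+ 2)%:C * (y x)%:C) = (fun x => (- c ^+ 2 * y x)%:C).
    by apply/funext => x; rewrite rmorphM.
  apply: (@decaying_in_L2 _ c (c ^+ 2 * D)) => //.
    by move=> x; apply: cvgM; [exact: cvg_cst|exact: cy].
  by move=> x; rewrite normrM normrN (ger0_norm (sqr_ge0 c)) -mulrA ler_wpM2l ?sqr_ge0// (yD x).1.
exists (fun n x => (phi n 0%N x)%:C); split.
- move=> n; apply: (smooth_test_function (sphi n)); exists (n%:R + 4) => x nx.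
  rewrite /phi /conv (_ : (fun t => _) = cst 0) ?Rintegral_cst ?mul0r//.
  apply/funext => t; have [tn|tn] := leP (n%:R + 3) `|t|.
    by have [-> _ _] := out n _ tn; rewrite mulr0.
  rewrite mollifier0 ?mul0r// (@le_trans _ _ 1) ?invf_le1 ?ler1n ?ltr0n//.
  by apply: le_trans (lerB_dist _ _); lra.
- rewrite /L2_cvg.
  rewrite (_ : (fun n => _) = (fun n => L2_norm (fun x => (phi n 0%N x - y x)%:C))); last first.
    by apply/funext => n; congr L2_norm; apply/funext => x; rewrite rmorphB.
  apply: (@L2_dominated_cvg _ _ c (K + D) c0) => [n|].
    exact: measurable_funB.
  apply: (@filterS _ _ (ae_filter_ringOfSetsType mu) _ _ _ qq') => x _; split=> [n|].
    apply: le_trans (ler_normB _ _) _; rewrite mulrDl; apply: lerD => //; exact: (yD x).1.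
  by rewrite -(subrr (y x)); apply: (@cvgB _ R^o) => //; exact: cvg_cst.
rewrite /L2_cvg.
rewrite (_ : (fun n => _) = (fun n => L2_norm (fun x =>
    (- phi n 2%N x + q x * phi n 0%N x - - c ^+ 2 * y x)%:C))); last first.
  apply/funext => n; congr L2_norm; apply/funext => x.
  by rewrite /ell0 (smooth_cderiven 2 x (sphi n)) !rmorphB /= !rmorphM !rmorphN /=; ring.
apply: (@L2_dominated_cvg _ _ c (K + sigma * K + c ^+ 2 * D) c0) => [n|].
  apply: measurable_funB; last exact: measurable_funM.
  by apply: measurable_funD; [exact: measurableT_comp|exact: measurable_funM].
apply: (@filterS2 _ _ (ae_filter_ringOfSetsType mu) _ _ _ _ qq' limphi2) => x qx lx; split=> [n|].
  rewrite qx; set e := expR _.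
  have -> : (K + sigma * K + c ^+ 2 * D) * e = (K * e + sigma * (K * e)) + c ^+ 2 * (D * e) by ring.
  apply: le_trans (ler_normB _ _) _; apply: lerD.
    apply: le_trans (ler_normD _ _) _; apply: lerD; first by rewrite normrN.
    by rewrite normrM ler_pM.
  by rewrite normrM normrN (ger0_norm (sqr_ge0 c)) ler_wpM2l ?sqr_ge0// (yD x).1.
have -> : (0 : R) = - (p x * y x) + q x * y x - - c ^+ 2 * y x by rewrite /p qx; ring.
apply: (@cvgB _ R^o); last exact: cvg_cst.
apply: (@cvgD _ R^o); first exact: (@cvgN _ R^o).
by apply: (@cvgM R) => //; exact: cvg_cst.
Unshelve. all: by end_near. Qed.
End Eigenfunction.

(** * Zeros of the Wronskian on the imaginary axis *)

Section BoundState.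
Context {R : realType}.
Local Notation C := R[i].
Local Notation N z := (Normc.normc z).
Local Notation mu := (@lebesgue_measure R).
Implicit Types (q : R -> R) (x : R).

Lemma primitive_expR (a : R) : primitive (fun x => expR (a * x)) (fun x => a * expR (a * x)).
Proof.
have d x : is_derive x 1 (fun t => expR (a * t)) (a * expR (a * x)).
  have := @is_derive_affine _ expR x a 0 _ (is_derive_expR (a * x + 0)).
  by rewrite addr0 (_ : (fun t => _) = (fun t => expR (a * t)))//; apply/funext => t; rewrite addr0.
apply: (derive_primitive d) => x; apply: cvgM; first exact: cvg_cst.
apply: continuous_comp; last exact: continuous_expR.
by apply: cvgM; [exact: cvg_cst|exact: cvg_id].
Qed.

Lemma normc_le_abs (z : C) : N z <= `|complex.Re z| + `|complex.Im z|.
Proof.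
have -> : z = (complex.Re z)%:C + 'i * (complex.Im z)%:C.
  by case: z => a b; apply: eq_ReIm; rewrite ?ReD ?ImD ?ReM ?ImM /=; ring.
apply: le_trans (le_normcD _ _) _; rewrite Normc.normcM normc_i mul1r !normc_real.
by rewrite !ReD !ImD !ReM !ImM /= !mul0r !mul1r !subr0 !addr0 !add0r.
Qed.

Lemma cprimitive_bounded (f g : R -> C) : cprimitive f g ->
  exists2 M : R, 0 <= M & forall x, `|x| <= 1 -> N (f x) <= M.
Proof.
move=> [hr hi].
have [M M0 hM] := locally_bounded_gt0 1 (primitive_locally_bounded hr).
have [M' M'0 hM'] := locally_bounded_gt0 1 (primitive_locally_bounded hi).
exists (M + M') => [|x x1]; first lra.
by apply: le_trans (normc_le_abs _) _; apply: lerD; [exact: hM|exact: hM'].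
Qed.

Lemma imag_sqr (c : R) : ('i * c%:C) ^+ 2 = (- c ^+ 2)%:C :> C.
Proof. by apply: eq_ReIm; rewrite /= ?mul0r ?mul1r ?mulr0; ring. Qed.

(** At k = i c the condition at 1 reads y' + c y = 0. Beyond 1, exp (- c x) (y' + c y) is constant,
    hence 0, and y = exp (- c (x - 1)) there. On [0, 1] boundedness suffices, since exp (c (1 - x))
    >= 1. *)
Lemma jost_decay q S (c : R) : fundamental q S -> (forall x, 1 <= x -> q x = 0) ->
  0 < c -> exists2 D : R, 0 <= D & forall x, 0 <= x ->
    N (jost S x ('i * c%:C)) <= D * expR (- c * x) /\
    N (jost' S x ('i * c%:C)) <= D * expR (- c * x).
Proof.
move=> fS q0 c0; set k := 'i * c%:C.
have [hj hj'] := jost_schrodinger fS k.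
set y := (fun x => jost S x k) in hj hj'; set y' := (fun x => jost' S x k) in hj hj'.
have ik : 'i * k = - c%:C by rewrite /k mulrA -expr2 sqr_i mulN1r.
have [y1 y'1] : y 1 = 1 /\ y' 1 = - c%:C by rewrite /y /y'; have [-> ->] := jost_at1 fS k.
have b0 x : 1 <= x -> y' x + c%:C * y x = 0.
  move=> x1.
  have h := cprimitiveM (cprimitive_real (primitive_expR (- c))) (cprimitiveD hj' (cprimitiveZ c%:C hj)).
  have := cprimitive_cst_on h x1; rewrite y1 y'1 mulr1 addNr mulr0 => E.
  have /eqP : (expR (- c * x))%:C * (y' x + c%:C * y x) = 0.
    apply: E => t /andP[t1 _]; by rewrite q0// imag_sqr -/(y t) rmorph0 rmorphM !rmorphN rmorphXn /=; ring.
  by rewrite mulf_eq0 -normc_eq0 normc_real normr_eq0 gt_eqF ?expR_gt0//= => /eqP.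
have ye x : 1 <= x -> y x = (expR c * expR (- c * x))%:C.
  move=> x1.
  have h := cprimitiveM (cprimitive_real (primitive_expR c)) hj.
  have := cprimitive_cst_on h x1; rewrite y1 !mulr1 => E.
  have {}E : (expR (c * x))%:C * y x = (expR c)%:C.
    apply: E => t /andP[t1 _].
    rewrite rmorphM /= -mulrA [c%:C * _]mulrC -mulrA -mulrDr [y t * _]mulrC addrC b0 ?mulr0//.
  by rewrite mulNr expRN rmorphM /= -E mulrAC -rmorphM /= mulfV ?mul1r// gt_eqF// expR_gt0.
have [M M0 hM] := cprimitive_bounded hj; have [M' M'0 hM'] := cprimitive_bounded hj'.
have e0 : 0 <= expR c by exact: expR_ge0.
exists ((M + M' + 1 + c) * expR c) => [|x x0]; first by rewrite mulr_ge0//; lra.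
rewrite -/(y x) -/(y' x); have ex : 0 <= expR c * expR (- c * x) by rewrite mulr_ge0 ?expR_ge0.
rewrite -mulrA; have [x1|/ltW x1] := leP 1 x.
  have -> : y' x = - c%:C * y x.
    by apply/eqP; rewrite -subr_eq0 mulNr opprK b0.
  rewrite [- c%:C * y x]mulNr normcN Normc.normcM ye// !normc_real (ger0_norm ex) (ger0_norm (ltW c0)).
  by split; [rewrite -[leLHS]mul1r|]; rewrite ler_wpM2r//; lra.
have e1 : 1 <= expR c * expR (- c * x).
  by rewrite -expRD -[leLHS]expR0 ler_expR; nra.
have ax : `|x| <= 1 by rewrite ger0_norm.
have := hM x ax; have := hM' x ax; split.
  by apply: le_trans (hM x ax) _; rewrite -[leLHS]mulr1 ler_pM//; lra.
by apply: le_trans (hM' x ax) _; rewrite -[leLHS]mulr1 ler_pM//; lra.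
Qed.

Lemma ae_zero_continuous (y : R -> R) (x : R) : continuous y ->
  {ae mu, forall x, y x = 0} -> y x = 0.
Proof.
move=> cy y0; apply/eqP/negPn/negP => yx.
have nyx : 0 < `|y x| by rewrite normr_gt0.
have [r /= r0 hr] : \forall t \near x, y t != 0.
  have := cvgr_neq0 _ (cy x) yx; exact.
have : mu (ball x r) = 0%E.
  apply: measure_negligible; first exact: measurable_ball.
  by apply: negligibleS y0 => t xt /= /eqP; apply/negP; exact: hr.
rewrite lebesgue_measure_ball ?ltW// => -[] /eqP.
by rewrite mulrn_eq0/= gt_eqF.
Qed.

(* A zero of [jostW] at [i c] would be an eigenvalue [- c^2]: the two Jost
   solutions, decaying at [+oo] and at [-oo], are then proportional. *)
Lemma jostW_imag_neq0 q q' (sigma c : R) S T : measurable_fun setT q ->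
  {ae mu, forall x, q x = q' x} -> locally_bounded q' ->
  (forall x, `|q' x| <= sigma) -> (forall x, 1 <= `|x| -> q' x = 0) ->
  fundamental q' S -> fundamental (fun x => q' (0 - x)) T ->
  no_negative_eigenvalue q -> 0 < c -> jostW S T ('i * c%:C) != 0.
Proof.
move=> mq qq' lq' q's q'0 fS fT nn c0; apply/eqP => W0.
set k := 'i * c%:C in W0.
have qS x : 1 <= x -> q' x = 0.
  by move=> x1; rewrite q'0// ger0_norm// (le_trans ler01).
have qT x : 1 <= x -> q' (0 - x) = 0.
  by move=> x1; rewrite q'0// sub0r normrN ger0_norm// (le_trans ler01).
have [DS DS0 hS] := jost_decay fS qS c0.
have [DT DT0 hT] := jost_decay fT qT c0.
have nz : jostA T k != 0 \/ jostB T k != 0.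
  have [A0|] := eqVneq (jostA T k) 0; last by left.
  right; apply/eqP => B0; have [] := jost_at1 fT k.
  by rewrite /jost A0 B0 !mul0r addr0 => /eqP; rewrite eq_sym oner_eq0.
have [d [dA dB]] : exists d, jostA S k = d * jostA T k /\ jostB S k = - (d * jostB T k).
  move: W0; rewrite /jostW => /eqP; rewrite oppr_eq0 => /eqP W0.
  have [A0|A0] := eqVneq (jostA T k) 0; last first.
    exists (jostA S k / jostA T k); split; first by rewrite divfK.
    apply: (mulIf A0); rewrite mulNr mulrAC divfK//.
    by apply/eqP; rewrite -subr_eq0 opprK addrC W0.
  have B0 : jostB T k != 0 by case: nz => //; rewrite A0 eqxx.
  exists (- (jostB S k / jostB T k)); split; last by rewrite mulNr opprK divfK.
  by move: W0; rewrite A0 !mulr0 addr0 => /eqP; rewrite mulf_eq0 (negbTE B0) orbF => /eqP.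
have hT' : schrodinger q' k (fun x => d * jost T (0 - x) k) (fun x => d * - jost' T (0 - x) k).
  have := schrodingerZ d (schrodinger_reflect 0 (jost_schrodinger fT k)).
  by rewrite (_ : (fun x => q' _) = q')//; apply/funext => x; rewrite !sub0r opprK.
have E x : jost S x k = d * jost T (0 - x) k /\ jost' S x k = d * - jost' T (0 - x) k.
  have [-> ->] := solution_decomp fS x hT'.
  have [-> ->] := solution_decomp fS x (jost_schrodinger fS k).
  rewrite !subr0; have [-> ->] := jost_at0 fS k; have [-> ->] := jost_at0 fT k.
  by rewrite dA dB mulrN.
have [[hy _] [hy' _]] := jost_schrodinger fS k.
(* At k = i c the equation has real coefficients, so the real part is a solution; it is not zero
   because its value at 1 is 1. *)
pose y := rpart (fun x => jost S x k); pose y' := rpart (fun x => jost' S x k).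
have hy'2 : primitive y' (fun x => (q' x + c ^+ 2) * y x).
  apply: primitive_eq hy' _ _ => // x.
  rewrite /rpart imag_sqr -rmorphB /= opprK.
  by rewrite /y /rpart; case: (jost S x k) => a b /=; ring.
have Dy x : `|y x| <= (DS + N d * DT) * expR (- c * `|x|) /\
    `|y' x| <= (DS + N d * DT) * expR (- c * `|x|).
  have e0 : 0 <= expR (- c * `|x|) by exact: expR_ge0.
  have [x0|x0] := leP 0 x.
    rewrite ger0_norm// in e0 *; have [h1 h2] := hS x x0.
    have le : DS * expR (- c * x) <= (DS + N d * DT) * expR (- c * x).
      by rewrite ler_wpM2r// lerDl mulr_ge0// normc_ge0.
    by split; apply: le_trans (ge_Re_normc _) _; [apply: le_trans h1 _|apply: le_trans h2 _].
  rewrite ltr0_norm// in e0 *; have x0' : 0 <= 0 - x by rewrite sub0r oppr_ge0 ltW.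
  have [] := hT (0 - x) x0'; rewrite -/k => h1 h2.
  have le : N d * (DT * expR (- c * - x)) <= (DS + N d * DT) * expR (- c * - x).
    by rewrite mulrDl mulrA lerDr mulr_ge0.
  have [E1 E2] := E x; rewrite sub0r in h1 h2.
  split; apply: le_trans (ge_Re_normc _) _; rewrite ?E1 ?E2 Normc.normcM ?normcN sub0r;
    by apply: le_trans le; rewrite ler_wpM2l// normc_ge0.
have graph := decaying_ell_graph mq qq' lq' q's c0 hy hy'2 Dy.
have c2 : - c ^+ 2 < 0 by rewrite oppr_lt0 exprn_gt0.
apply: (nn _ c2); exists (fun x => (y x)%:C); split; first exact: graph.
move=> ae0; have y0 : {ae mu, forall x, y x = 0}.
  by apply: (@filterS _ _ (ae_filter_ringOfSetsType mu) _ _ _ ae0) => x [].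
have := ae_zero_continuous 1 (primitive_continuous hy) y0.
by rewrite /y /rpart; have [-> _] := jost_at1 fS k => /= /eqP; rewrite oner_eq0.
Qed.
End BoundState.

(** * Uniqueness *)

Section Reduction.
Context {R : realType}.
Local Notation C := R[i].
Local Notation mu := (@lebesgue_measure R).
Implicit Types (q : R -> R) (x : R).

Lemma ae_neq (a : R) : {ae mu, forall x, x != a}.
Proof.
exists [set a]; split; [exact: measurable_set1|exact: lebesgue_measure_set1|].
by move=> x /= /negP; rewrite negbK => /eqP.
Qed.

Lemma potential_bounded q : potential q ->
  measurable_fun setT q /\ exists sigma, {ae mu, forall x, `|q x| <= sigma}.
Proof.
move=> [+ _]; rewrite inE => /andP[/[!inE] mq]; rewrite /= /finite_norm unlock /=.
have -> : (0 < mu [set: g_sigma_algebraType (R.-ocitv).-measurable])%E.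
  have E : mu setT = +oo%E by rewrite -set_itvNyy lebesgue_measure_itv.
  by rewrite [X in (_ < X)%E]E ltry.
move=> qfin; split=> //.
exists (fine (ess_sup_inf.ess_sup mu (abse \o (EFin \o q)))).
have := ess_sup_inf.ess_sup_ge mu (abse \o (EFin \o q)).
apply: (@filterS _ _ (ae_filter_ringOfSetsType mu)) => x /=; move: qfin.
by case: (ess_sup_inf.ess_sup mu _).
Qed.

(** A representative bounded at every point, as the Picard estimates require. It is also set to 0 at
    -1 and 1, whose values [potential] leaves free, so that the equation is free on the closed
    half-lines. *)
Lemma potential_truncation q sigma : potential q -> 0 <= sigma ->
  {ae mu, forall x, `|q x| <= sigma} ->
  exists q', [/\ locally_bounded q', forall x, `|q' x| <= sigma,
    forall x, 1 <= `|x| -> q' x = 0 & {ae mu, forall x, q x = q' x}].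
Proof.
move=> hq s0 qs; have [mq _] := potential_bounded hq.
exists (fun x => if (`|x| < 1) && (`|q x| <= sigma) then q x else 0).
have bq x : `|if (`|x| < 1) && (`|q x| <= sigma) then q x else 0| <= sigma.
  by case: ifPn => [/andP[]//|_]; rewrite normr0.
split=> //.
- split; last by move=> K; exists sigma.
  apply: measurable_fun_ifT => //.
  by apply: measurable_and; [apply: measurable_fun_ltr|apply: measurable_fun_ler] => //; exact: measurableT_comp.
- by move=> x x1; rewrite ltNge x1.
apply: (@filterS3 _ _ (ae_filter_ringOfSetsType mu) _ _ _ _ _ qs (ae_neq 1) (ae_neq (-1))) => x qx x1 x2.
rewrite qx andbT; case: ltP => // x3; apply: hq.2.
rewrite lt_neqAle x3 andbT eq_sym eqr_norml negb_and negb_or x1 x2//.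
Qed.

Lemma jostW_neq0_upper q q' (sigma : R) S T : measurable_fun setT q ->
  {ae mu, forall x, q x = q' x} -> locally_bounded q' ->
  (forall x, `|q' x| <= sigma) -> (forall x, 1 <= `|x| -> q' x = 0) ->
  fundamental q' S -> fundamental (fun x => q' (0 - x)) T ->
  no_negative_eigenvalue q ->
  forall k : C, 0 <= complex.Im k -> k != 0 -> jostW S T k != 0.
Proof.
move=> mq qq' lq' q's q'0 fS fT nn k Ik k0.
have [Rk|Rk] := eqVneq (complex.Re k) 0; last exact: (jostW_neq0 fS fT Ik Rk).
have kE : k = 'i * (complex.Im k)%:C.
  by apply: eq_ReIm; rewrite /= ?Rk; ring.
rewrite kE; apply: (jostW_imag_neq0 mq qq' lq' q's q'0 fS fT nn).
rewrite lt_neqAle Ik andbT eq_sym; apply: contra k0 => /eqP I0.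
by rewrite kE I0 mulr0.
Qed.
End Reduction.

Theorem theorem11p1p1 (R : realType) (q1 q2 : R -> R) (u1 u2 : R -> R -> R[i])
    (hq1 : potential q1) (hq2 : potential q2)
    (hneg1 : no_negative_eigenvalue q1) (hneg2 : no_negative_eigenvalue q2)
    (hu1 : forall k : R, 0 < k -> outgoing_solution q1 k (fun x => u1 x k))
    (hu2 : forall k : R, 0 < k -> outgoing_solution q2 k (fun x => u2 x k))
    (hdata : forall k : R, 0 < k -> u1 (-1) k = u2 (-1) k /\ u1 1 k = u2 1 k) :
  {ae @lebesgue_measure R, forall x, q1 x = q2 x}.
Proof.
have [m1 [s1 b1]] := potential_bounded hq1; have [m2 [s2 b2]] := potential_bounded hq2.
pose sigma := `|s1| + `|s2|; have s0 : 0 <= sigma by rewrite addr_ge0.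
have {}b1 : {ae @lebesgue_measure R, forall x, `|q1 x| <= sigma}.
  apply: (@filterS _ _ (ae_filter_ringOfSetsType lebesgue_measure) _ _ _ b1) => x h.
  by rewrite (le_trans h)// (le_trans (ler_norm _))// lerDl.
have {}b2 : {ae @lebesgue_measure R, forall x, `|q2 x| <= sigma}.
  apply: (@filterS _ _ (ae_filter_ringOfSetsType lebesgue_measure) _ _ _ b2) => x h.
  by rewrite (le_trans h)// (le_trans (ler_norm _))// lerDr.
have [p1 [l1 p1s out1 qp1]] := potential_truncation hq1 s0 b1.
have [p2 [l2 p2s out2 qp2]] := potential_truncation hq2 s0 b2.
have [S1 fS1] := fundamental_exists l1 p1s; have [S2 fS2] := fundamental_exists l2 p2s.
have [T1 fT1] := fundamental_exists (locally_bounded_reflect 0 l1) (fun x => p1s (0 - x)).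
have [T2 fT2] := fundamental_exists (locally_bounded_reflect 0 l2) (fun x => p2s (0 - x)).
have W1 := jostW_neq0_upper m1 qp1 l1 p1s out1 fS1 fT1 hneg1.
have W2 := jostW_neq0_upper m2 qp2 l2 p2s out2 fS2 fT2 hneg2.
have data (k : R) : 0 < k ->
    jostA S1 k%:C * jostW S2 T2 k%:C = jostA S2 k%:C * jostW S1 T1 k%:C /\
    jostA T1 k%:C * jostW S2 T2 k%:C = jostA T2 k%:C * jostW S1 T1 k%:C.
  move=> k0; have [dl dr] := hdata k k0.
  have [<- <-] := outgoing_jost m1 qp1 l1 out1 fS1 fT1 (hu1 k k0).
  have [<- <-] := outgoing_jost m2 qp2 l2 out2 fS2 fT2 (hu2 k k0).
  by rewrite dl dr; split; ring.
have pp := potential_eq p1s p2s fS1 fS2 fT1 fT2 W1 W2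
  (fun x x0 => (data x x0).1) (fun x x0 => (data x x0).2).
have q12 : {ae @lebesgue_measure R, forall x, q1 x = p1 x /\ q2 x = p2 x}.
  by apply: (@filterS2 _ _ (ae_filter_ringOfSetsType lebesgue_measure) _ _ _ _ qp1 qp2).
apply: (@filterS3 _ _ (ae_filter_ringOfSetsType lebesgue_measure) _ _ _ _ _ pp q12 (@ae_neq R 0)) => x px [-> ->] x0.
have [x1|x1] := leP 1 `|x|; first by rewrite out1// out2.
by apply: px; rewrite normr_gt0 x0.
Qed.
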